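(* The spaces $R\mathcal{F}_3$, $R\mathcal{C}_3$, $Q\mathcal{F}_3$, $Q\mathcal{C}_3$, $R\mathcal{F}_4$ and $R\mathcal{C}_4$ are $K(\pi,1)$ spaces.
   Context: $\mathcal{F}_n\subset\mathbb{C}^n$ is the ordered configuration space of $n$ distinct points and $p:\mathcal{F}_n\to\mathcal{C}_n=\mathcal{F}_n/\Sigma_n$ the regular covering. $\mathcal{C}_n$ is identified with the space of monic degree $n$ complex polynomials with non-zero discriminant; $Q(X)=n\prod_{k=1}^{n-1}(X-\beta_k)$ with distinct roots is identified with $\{\beta_1,\dots,\beta_{n-1}\}\in\mathcal{C}_{n-1}$. $Q\mathcal{C}_{n-1}=\{Q=n\prod_{k=1}^{n-1}(X-\beta_k)\mid \beta_k\ne\beta_j,\ \int_{\beta_k}^{\beta_j}Q(t)dt\neq0\ \forall k\neq j\}\subset\mathcal{C}_{n-1}$, and $R\mathcal{C}_n=\{\int_0^XQ(t)dt-c\mid Q=n\prod(X-\beta_k)\in Q\mathcal{C}_{n-1},\ c\in\mathbb{C},\ c\ne\int_0^{\beta_k}Q(t)dt\ \forall k\}\subset\mathcal{C}_n$. Put $Q\mathcal{F}_{n-1}=p^{-1}(Q\mathcal{C}_{n-1})$ and $R\mathcal{F}_n=p^{-1}(R\mathcal{C}_n)$. A $K(\pi,1)$ space is a connected space whose only possibly nontrivial homotopy group is its fundamental group. *)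

(* Defs.v *)
From HB Require Import structures.
From mathcomp Require Import all_boot all_order all_algebra all_fingroup.
From mathcomp Require Import complex.
From mathcomp Require Import all_classical all_reals all_analysis.

Import Order.TTheory GRing.Theory Num.Theory.
Import numFieldNormedType.Exports.

Local Open Scope classical_set_scope.
Local Open Scope quotient_scope.
Local Open Scope ring_scope.

Section HomotopyGroups.
Context (R : realType) {X : topologicalType}.
Implicit Types (A : set X) (x : X) (k : nat).

Definition cube k : set 'rV[R]_k := [set t | forall i, 0 <= t 0 i <= 1].

Definition cube_boundary k : set 'rV[R]_k :=
  [set t | cube k t /\ exists i, t 0 i = 0 \/ t 0 i = 1].

(* Continuous maps (I^k, dI^k) -> (A, x).  The functions are total; only their
   restriction to the cube is relevant. *)
Definition spheroid A x k : set ('rV[R]_k -> X) :=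
  [set f | [/\ {within cube k, continuous f},
               forall t, cube k t -> A (f t)
             & forall t, cube_boundary k t -> f t = x]].

(* Homotopy in A, relative to dI^k, between two such maps. *)
Definition homotopic_rel A x {k} (f g : 'rV[R]_k -> X) : Prop :=
  exists H : R * 'rV[R]_k -> X,
    [/\ {within `[0, 1]%classic `*` cube k, continuous H},
        forall s t, 0 <= s <= 1 -> cube k t -> A (H (s, t)),
        forall t, cube k t -> H (0, t) = f t,
        forall t, cube k t -> H (1, t) = g t
      & forall s t, 0 <= s <= 1 -> cube_boundary k t -> H (s, t) = x].

Definition homotopy_class A x {k} (f : 'rV[R]_k -> X) : set ('rV[R]_k -> X) :=
  [set g | spheroid A x k g /\ homotopic_rel A x f g].

(* The underlying set of pi_k(A, x); its neutral element is the class of the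
   constant map, and the group law is not needed to say that it is trivial. *)
Definition homotopy_group A x k : set (set ('rV[R]_k -> X)) :=
  [set homotopy_class A x f | f in spheroid A x k].

Definition K_pi_1 A : Prop :=
  [/\ A !=set0, connected A
    & forall x k, A x -> (2 <= k)%N ->
        homotopy_group A x k = [set homotopy_class A x (fun=> x)]].

End HomotopyGroups.

(* The topology of R[i] is that of its modulus; the library provides it for any
   numFieldType, but not for the type R[i] directly. *)
HB.instance Definition _ (R : rcfType) := NormedModule.copy R[i] R[i]^o.

Section Configurations.
Context (R : realType).
Local Notation C := R[i].

Definition distinct_pts n : set 'rV[C]_n := [set x : 'rV[C]_n | injective (x 0)].

(* F_n, with the topology induced by C^n. *)
Definition ordered_conf n : Type := set_type (distinct_pts n).
HB.instance Definition _ n :=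
  Topological.copy (ordered_conf n) (set_type (distinct_pts n)).

Definition pt {n} (x : ordered_conf n) (i : 'I_n) : C := val x 0 i.

Definition conf_equiv {n} : rel (ordered_conf n) :=
  fun x y => [exists s : 'S_n, [forall i, pt y i == pt x (s i)]].

Lemma conf_equiv_refl n : reflexive (@conf_equiv n).
Proof.
by move=> x; apply/existsP; exists 1%g; apply/forallP => i; rewrite perm1.
Qed.

Lemma conf_equiv_trans n : transitive (@conf_equiv n).
Proof.
move=> y x z /existsP[s /forallP xy] /existsP[t /forallP yz].
apply/existsP; exists (t * s)%g; apply/forallP => i.
by rewrite permM (eqP (yz i)) (eqP (xy _)).
Qed.

Lemma conf_equiv_sym n : symmetric (@conf_equiv n).
Proof.
suff sym x y : @conf_equiv n x y -> conf_equiv y x.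
  by move=> x y; apply/idP/idP; exact: sym.
move=> /existsP[s /forallP xy]; apply/existsP; exists s^-1%g.
by apply/forallP => i; rewrite (eqP (xy _)) permKV.
Qed.

Canonical conf_equivRel n := EquivRel (@conf_equiv n)
  (conf_equiv_refl n) (conf_equiv_sym n) (conf_equiv_trans n).

(* C_n = F_n / Sigma_n, with the quotient topology. *)
Definition conf (n : nat) : Type := quotient_topology {eq_quot @conf_equiv n}.
HB.instance Definition _ n := Topological.on (conf n).

Definition conf_proj {n} (x : ordered_conf n) : conf n :=
  (\pi_{eq_quot @conf_equiv n} x)%qT.

(* The integral of f along the segment from a to b; for polynomial f the
   choice of the path is immaterial. *)
Definition cintegral (f : C -> C) (a b : C) : C :=
  let g (s : R) := f (a + s%:C%C * (b - a)) * (b - a) in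
  (\int[@lebesgue_measure R]_(s in `[0, 1]) complex.Re (g s)
   +i* \int[@lebesgue_measure R]_(s in `[0, 1]) complex.Im (g s))%C.

(* Roots beta_1, ..., beta_m correspond to Q = (m + 1) prod_k (X - beta_k). *)
Definition Qpoly {m} (b : ordered_conf m) : {poly C} :=
  m.+1%:R *: \prod_(k < m) ('X - (pt b k)%:P).

Definition Qint {m} (b : ordered_conf m) : C -> C -> C :=
  cintegral (horner (Qpoly b)).

Definition QC m : set (conf m) :=
  [set conf_proj b | b in
    [set b : ordered_conf m |
      forall k j : 'I_m, k != j -> Qint b (pt b k) (pt b j) != 0]].

Definition RC n : set (conf n) :=
  [set conf_proj x | x in
    [set x : ordered_conf n | exists (b : ordered_conf n.-1) (c : C),
      [/\ QC n.-1 (conf_proj b),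
          forall k : 'I_n.-1, c != Qint b 0 (pt b k)
        & forall z : C, (\prod_(i < n) ('X - (pt x i)%:P)).[z] = Qint b 0 z - c]]].

Definition QF m : set (ordered_conf m) := @conf_proj m @^-1` QC m.

Definition RF n : set (ordered_conf n) := @conf_proj n @^-1` RC n.

End Configurations.

(* Main.v *)
(* [RF 3] and [QF 3] are complements of complex line arrangements in C^3
   which, up to factors C and C^*, are finitely punctured planes.
   A point of [RF 4] determines, through the derivative of its polynomial, a point
   b of [QF 3] (up to order) and a constant term avoiding the critical values of a
   primitive of [Qpoly b].  These pairs form a bundle over [QF 3] with fibre a
   plane with three punctures, and its total space shares finite coverings with
   [RF 4] and [RC 4]; cubes of dimension at least 2 and their homotopies lift to
   coverings by continuity of roots.

   That a cube of dimension at least 2 contracts in a plane with finitely many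
   punctures is proved on the universal cover, a tree of slit planes: the plane
   cut along the half-lines above the punctures is glued to the plane cut along
   the half-lines below them along the vertical strips between consecutive
   punctures.  The lift of a cube meets finitely many slit planes, and the
   outermost ones can be vacated by pushing the cube into the strips through which
   it entered them. *)
Require Import Defs.
From mathcomp Require Import all_boot all_order all_algebra all_fingroup.
From mathcomp Require Import complex separable ring lra.
From mathcomp Require Import all_classical all_reals all_analysis.
Set Implicit Arguments.
Unset Strict Implicit.
Unset Printing Implicit Defensive.
Import Order.TTheory GRing.Theory Num.Theory.
Import numFieldNormedType.Exports.
Local Open Scope classical_set_scope.
Local Open Scope ring_scope.

(** * Continuity and the modulus of complex numbers *)

(** Only null-homotopies relative to the boundary are ever produced, by explicit formulas or by
    lifting; no exact sequence is used. Dimension at least 2 enters because the boundary of the cube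
    is then path-connected: a lift of a map that is constant on the boundary is constant there, so
    it is again a spheroid. The universal cover is not built as a space. Its sheets are named by
    reduced words, and a lift is a labelling of the cube by words, which is all that the induction
    on word length manipulates. Membership in [QF 3] says exactly that the three critical values are
    distinct. During a null-homotopy of the critical points in [QF 3] these values move without
    collision, and the constant term is carried along by injective maps of the plane that follow
    them. Connectedness is a separate argument: [RF 3], [QF 3] and [RF 4] are complements of complex
    hypersurfaces, and a complex line through two of their points meets the hypersurface in finitely
    many points only. *)

Section Continuity.
Context {T : topologicalType} {K : numFieldType}.
Implicit Types f g : T -> K.

Lemma cont_cst {U : topologicalType} (c : U) : continuous (fun _ : T => c).
Proof. by move=> x; exact: cvg_cst. Qed.

Lemma cont_comp {U W : topologicalType} (f : T -> U) (g : U -> W) :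
  continuous f -> continuous g -> continuous (fun x => g (f x)).
Proof. by move=> cf cg x; apply: continuous_comp; [exact: cf | exact: cg]. Qed.

Lemma cont_pair {U W : topologicalType} (f : T -> U) (g : T -> W) :
  continuous f -> continuous g -> continuous (fun x => (f x, g x)).
Proof. by move=> cf cg x; apply: cvg_pair; [exact: cf | exact: cg]. Qed.

Lemma cont_add f g :
  continuous f -> continuous g -> continuous (fun x => f x + g x).
Proof. by move=> cf cg x; apply: cvgD; [exact: cf | exact: cg]. Qed.

Lemma cont_opp f : continuous f -> continuous (fun x => - f x).
Proof. by move=> cf x; apply: cvgN; exact: cf. Qed.

Lemma cont_mul f g :
  continuous f -> continuous g -> continuous (fun x => f x * g x).
Proof. by move=> cf cg x; apply: cvgM; [exact: cf | exact: cg]. Qed.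

Lemma cont_inv f : (forall x, f x != 0) ->
  continuous f -> continuous (fun x => (f x)^-1).
Proof. by move=> f0 cf x; apply: cvgV => //; exact: cf. Qed.

Lemma cont_sum (I : Type) (r : seq I) (f : I -> T -> K) :
  (forall i, continuous (f i)) -> continuous (fun x => \sum_(i <- r) f i x).
Proof.
move=> cf; elim: r => [|i r IH].
  by under eq_fun do rewrite big_nil; exact: cont_cst.
by under eq_fun do rewrite big_cons; exact: cont_add.
Qed.

Lemma cont_prod (I : Type) (r : seq I) (f : I -> T -> K) :
  (forall i, continuous (f i)) -> continuous (fun x => \prod_(i <- r) f i x).
Proof.
move=> cf; elim: r => [|i r IH].
  by under eq_fun do rewrite big_nil; exact: cont_cst.
by under eq_fun do rewrite big_cons; exact: cont_mul.
Qed.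

Lemma cont_fst {U W : topologicalType} : continuous (@fst U W).
Proof. by move=> x; exact: cvg_fst. Qed.

Lemma cont_snd {U W : topologicalType} : continuous (@snd U W).
Proof. by move=> x; exact: cvg_snd. Qed.

End Continuity.

Section RealContinuity.
Context {T : topologicalType} {R : realType}.
Implicit Types f g : T -> R.

Lemma cont_norm f : continuous f -> continuous (fun x => `|f x|).
Proof. by move=> cf x; apply: cvg_norm; exact: cf. Qed.

Lemma maxrE (x y : R) : Num.max x y = (x + y + `|x - y|) / 2.
Proof.
by case: (lerP x y) => h; field.
Qed.

Lemma minrE (x y : R) : Num.min x y = (x + y - `|x - y|) / 2.
Proof.
by case: (lerP x y) => h; field.
Qed.

Lemma cont_max f g :
  continuous f -> continuous g -> continuous (fun x => Num.max (f x) (g x)).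
Proof.
move=> cf cg; under eq_fun do rewrite maxrE.
apply: cont_mul; last exact: cont_cst.
apply: cont_add; first exact: cont_add.
by apply: cont_norm; apply: cont_add => //; exact: cont_opp.
Qed.

Lemma cont_min f g :
  continuous f -> continuous g -> continuous (fun x => Num.min (f x) (g x)).
Proof.
move=> cf cg; under eq_fun do rewrite minrE.
apply: cont_mul; last exact: cont_cst.
apply: cont_add; first exact: cont_add.
by apply: cont_opp; apply: cont_norm; apply: cont_add => //; exact: cont_opp.
Qed.

Lemma cont_row {K : topologicalType} n (f : T -> 'rV[K]_n) :
  (forall j, continuous (fun x => f x 0 j)) -> continuous f.
Proof.
move=> cf x A [P nP PA].
have : \forall y \near x, forall j, P 0 j (f y 0 j).
  by apply: filter_forall => j; apply: cf; exact: nP.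
by apply: filterS => y Py; apply: PA => i j; rewrite (ord1 i).
Qed.

End RealContinuity.

Section Modulus.
Context {R : realType}.
Local Notation C := R[i].

(** The norm of [R[i]] takes its values in [R[i]]; a modulus with values in [R] opens estimates to
    real linear arithmetic. *)
Definition cabs (z : C) : R := Num.sqrt (complex.Re z ^+ 2 + complex.Im z ^+ 2).

Lemma normcE (z : C) : `|z| = (cabs z)%:C%C.
Proof. exact: normc_def. Qed.

Lemma cabs_ge0 z : 0 <= cabs z.
Proof. exact: sqrtr_ge0. Qed.

Lemma cabsM (x y : C) : cabs (x * y) = cabs x * cabs y.
Proof.
have := normrM x y; rewrite !normcE -rmorphM /=.
by move=> /(congr1 (@complex.Re R)).
Qed.

Lemma cabs0 : cabs 0 = 0.
Proof. by rewrite /cabs /= expr0n /= addr0 sqrtr0. Qed.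

Lemma cabs1 : cabs 1 = 1.
Proof. by rewrite /cabs /= expr0n /= expr1n addr0 sqrtr1. Qed.

Lemma cabs_real (x : R) : cabs x%:C%C = `|x|.
Proof. by rewrite /cabs /= expr0n /= addr0 sqrtr_sqr. Qed.

Lemma cabsN x : cabs (- x) = cabs x.
Proof. by case: x => a b; rewrite /cabs /= !sqrrN. Qed.

Lemma cabsB x y : cabs (x - y) = cabs (y - x).
Proof. by rewrite -cabsN opprB. Qed.

Lemma cabsD (x y : C) : cabs (x + y) <= cabs x + cabs y.
Proof.
have := ler_normD x y; rewrite !normcE -rmorphD /= lecE /=.
by case/andP.
Qed.

Lemma cabs_eq0 (x : C) : (cabs x == 0) = (x == 0).
Proof.
by rewrite -(normr_eq0 x) normcE eq_complex /= eqxx andbT.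
Qed.

Lemma cabs_gt0 (x : C) : (0 < cabs x) = (x != 0).
Proof. by rewrite lt_def cabs_ge0 andbT cabs_eq0. Qed.

Lemma cabs_prod (I : Type) (r : seq I) (F : I -> C) :
  cabs (\prod_(i <- r) F i) = \prod_(i <- r) cabs (F i).
Proof. by apply: big_morph; [exact: cabsM | exact: cabs1]. Qed.

Lemma cabs_dist (a b c : C) : cabs (a - c) <= cabs (a - b) + cabs (b - c).
Proof. by rewrite (_ : a - c = (a - b) + (b - c)) ?cabsD //; ring. Qed.

Lemma Re_le_cabs (z : C) : `|complex.Re z| <= cabs z.
Proof.
by rewrite -sqrtr_sqr ler_sqrt ?addr_ge0 ?sqr_ge0 // lerDl sqr_ge0.
Qed.

Lemma Im_le_cabs (z : C) : `|complex.Im z| <= cabs z.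
Proof.
by rewrite -sqrtr_sqr ler_sqrt ?addr_ge0 ?sqr_ge0 // lerDr sqr_ge0.
Qed.

Lemma cabs_le_ReIm (z : C) : cabs z <= `|complex.Re z| + `|complex.Im z|.
Proof.
have -> : z = (complex.Re z)%:C%C + (complex.Im z)%:C%C * 'i%C.
  by case: z => a b; apply/eqP; rewrite eq_complex /=; apply/andP; split;
     apply/eqP; ring.
apply: (le_trans (cabsD _ _)); rewrite cabsM !cabs_real /=.
rewrite (_ : cabs 'i%C = 1) ?mulr1; last first.
  by rewrite /cabs /= expr0n expr1n add0r sqrtr1.
by case: z => a b /=; rewrite ?(mulr0, mul0r, mulr1, addr0, subr0, add0r).
Qed.

Lemma nbhsC_cabs (z : C) (A : set C) :
  nbhs z A <-> exists2 e : R, 0 < e & forall w, cabs (w - z) < e -> A w.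
Proof.
split.
  move=> /(nbhs_ballP z A)[e /= e0 eA].
  have eE : e = (complex.Re e)%:C%C.
    by move: e0; rewrite ltcE /= => /andP[/eqP e1 _]; case: e e1 {eA} => a b /= ->.
  exists (complex.Re e); first by move: e0; rewrite ltcE /= => /andP[].
  move=> w wz; apply: eA; rewrite -ball_normE /= distrC normcE eE.
  by rewrite ltcE /= eqxx.
case=> e e0 eA; apply/(nbhs_ballP z A); exists e%:C%C => /=.
  by rewrite ltcE /= eqxx.
move=> w; rewrite -ball_normE /= distrC normcE ltcE /= eqxx /= => h.
exact: eA.
Qed.

Lemma Re_continuous : continuous (@complex.Re R : C -> R).
Proof.
move=> z; apply/(cvgrPdist_lt (F := nbhs z)) => e e0.
apply/nbhsC_cabs; exists e => // w h.
apply: le_lt_trans h; rewrite cabsB.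
by have := Re_le_cabs (z - w); rewrite raddfB.
Qed.

Lemma Im_continuous : continuous (@complex.Im R : C -> R).
Proof.
move=> z; apply/(cvgrPdist_lt (F := nbhs z)) => e e0.
apply/nbhsC_cabs; exists e => // w h.
apply: le_lt_trans h; rewrite cabsB.
by have := Im_le_cabs (z - w); rewrite raddfB.
Qed.

Lemma cont_complex {T : topologicalType} (a b : T -> R) :
  continuous a -> continuous b -> continuous (fun x => (a x +i* b x)%C : C).
Proof.
move=> ca cb x A /nbhsC_cabs[e e0 eA]; rewrite /nbhs /=.
have e20 : 0 < e / 2 by rewrite divr_gt0.
have na := ca x; have nb := cb x.
move/cvgrPdist_lt: na => /(_ _ e20) na; move/cvgrPdist_lt: nb => /(_ _ e20) nb.
near=> y; apply: eA; rewrite cabsB.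
apply: (le_lt_trans (cabs_le_ReIm _)); rewrite /=.
by rewrite [e in ltRHS]splitr; apply: ltrD; near: y.
Unshelve. all: by end_near. Qed.

Lemma cabs_continuous : continuous cabs.
Proof.
move=> z; apply/(cvgrPdist_lt (F := nbhs z)) => e e0.
apply/nbhsC_cabs; exists e => // w h; apply: le_lt_trans h.
rewrite ler_norml; apply/andP; split.
  by rewrite lerBrDl lerBlDr addrC; have := cabsD (w - z) z; rewrite subrK.
by rewrite lerBlDr cabsB; have := cabsD (z - w) w; rewrite subrK.
Qed.

End Modulus.

(** * Compactness, transport, and cubes *)

Section Compactness.
Context {R : realType} {V : normedModType R}.
Implicit Types (X : set V).

Lemma near_norm (x : V) (A : set V) (d : R) : 0 < d ->
  (forall y, `|x - y| < d -> A y) -> nbhs x A.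
Proof. by move=> d0 dA; apply/nbhs_normP; exists d. Qed.

Lemma lebesgue_number X (P : R -> V -> Prop) : compact X ->
  (forall x, X x -> exists2 r, 0 < r & forall e y, 0 < e -> e < r ->
     `|x - y| < r -> X y -> P e y) ->
  exists2 r, 0 < r & forall y, X y -> P r y.
Proof.
move=> /compact_near_coveringP/near_covering_withinP cX hP.
have h : \forall e \near (0 : R)^'+, X `<=` P e.
  apply: cX => x Xx; have [r r0 hr] := hP _ Xx.
  exists (ball x r, [set e | 0 < e < r]) => /=.
    split; first exact: nbhsx_ballx.
    near=> e; rewrite /=; apply/andP; split; near: e.
      exact: nbhs_right_gt.
    exact: nbhs_right_lt.
  case=> y e [/= xy /andP[e0 er]] Xy; apply: hr => //.
  by move: xy; rewrite -ball_normE.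
have /filter_ex[e []] : \forall e \near (0 : R)^'+, 0 < e /\ X `<=` P e.
  near=> e; split; near: e; first exact: nbhs_right_gt.
  exact: h.
by move=> e0 eP; exists e.
Unshelve. all: by end_near. Qed.

Lemma uniform_continuity {W : normedModType R} X (f : V -> W) (eps : R) :
  compact X -> {within X, continuous f} -> 0 < eps ->
  exists2 r, 0 < r &
    forall x y, X x -> X y -> `|x - y| < r -> `|f x - f y| < eps.
Proof.
move=> cX /subspace_continuousP cf eps0.
have e20 : 0 < eps / 2 by rewrite divr_gt0.
have [|r r0 hr] := @lebesgue_number X
  (fun e y => forall x, X x -> `|x - y| < e -> `|f x - f y| < eps) cX.
  move=> x Xx; have /cvgrPdist_lt/(_ _ e20) := cf x Xx.
  rewrite near_withinE => /nbhs_normP[r /= r0 hr].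
  exists (r / 2); first by rewrite divr_gt0.
  move=> e y e0 er xy Xy z Xz zy.
  have dxy : `|f x - f y| < eps / 2.
    by apply: hr => //=; apply: lt_le_trans xy _; rewrite ler_pdivrMr//; lra.
  have dxz : `|f x - f z| < eps / 2.
    apply: hr => //=; rewrite (_ : x - z = (x - y) + (y - z)); last first.
      by rewrite addrA subrK.
    apply: (le_lt_trans (ler_normD _ _)); rewrite (distrC y) (splitr r).
    by apply: ltrD => //; exact: lt_trans er.
  rewrite (_ : f z - f y = (f z - f x) + (f x - f y)); last by rewrite addrA subrK.
  apply: (le_lt_trans (ler_normD _ _)); rewrite (distrC (f z)) (splitr eps).
  exact: ltrD.
by exists r => // x y Xx Xy; apply: hr.
Qed.

(** The step is iterated along [N + 1] equal pieces of the segment, each shorter than [d]. *)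
Lemma segment_chain (P : V -> Prop) (a b : V) (d : R) : 0 < d ->
  (forall s t : R, 0 <= s <= 1 -> 0 <= t <= 1 ->
     `|(a + s *: (b - a)) - (a + t *: (b - a))| < d ->
     P (a + s *: (b - a)) -> P (a + t *: (b - a))) ->
  P a -> P b.
Proof.
move=> d0 step Pa.
have [N hN] : exists N : nat, `|b - a| < N.+1%:R * d.
  exists (Num.truncn (`|b - a| / d)); rewrite -ltr_pdivrMr //.
  by apply: truncnS_gt.
have N0 : 0 < N.+1%:R :> R by [].
have key i : (i <= N.+1)%N -> P (a + (i%:R / N.+1%:R) *: (b - a)).
  elim: i => [|i IH] iN; first by rewrite mulr0n mul0r scale0r addr0.
  have h j : (j <= N.+1)%N -> 0 <= (j%:R / N.+1%:R : R) <= 1.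
    by move=> jN; rewrite divr_ge0 //= ler_pdivrMr // mul1r ler_nat.
  apply: (step (i%:R / N.+1%:R)) => //; [exact/h/ltnW|exact: h| |exact/IH/ltnW].
  rewrite opprD addrACA subrr add0r -scalerBl -mulrBl normrZ.
  rewrite normrM normfV (ger0_norm (ltW N0)) -natr1 opprD addrA subrr add0r.
  by rewrite normrN1 mul1r mulrC ltr_pdivrMr // mulrC.
by have := key _ (leqnn _); rewrite divff ?gt_eqF // scale1r addrC subrK.
Qed.

End Compactness.

Section Transport.
Context {R : realType} {V : normedModType R} {E : Type}.
(** A covering of [X] given by its fibres only: [over x e] puts [e] in the fibre over [x], and
    [T x e x'] carries it to the fibre over a point [x'] closer than [eta]. The two instances are
    root tuples and sheets of the universal cover. *)
Variables (X : set V) (over : V -> E -> Prop) (T : V -> E -> V -> E) (eta : R).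
Hypothesis eta_gt0 : 0 < eta.
Hypothesis T_over : forall x x' e, X x -> X x' -> `|x - x'| < eta ->
  over x e -> over x' (T x e x').
Hypothesis T_id : forall x e, X x -> over x e -> T x e x = e.
Hypothesis T_cocycle : forall x x' x'' e, X x -> X x' -> X x'' ->
  `|x - x'| < eta -> `|x' - x''| < eta -> `|x - x''| < eta -> over x e ->
  T x' (T x e x') x'' = T x e x''.

(* Transport along the ray from [c]; the cocycle condition makes the result
   locally independent of the ray. *)
Lemma transport_lift (c : V) (e0 : E) : compact X ->
  (forall x (t : R), X x -> 0 <= t <= 1 -> X (c + t *: (x - c))) ->
  X c -> over c e0 ->
  exists h, [/\ h c = e0, forall x, X x -> over x (h x) &
    forall x x', X x -> X x' -> `|x - x'| < eta / 2 -> h x' = T x (h x) x'].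
Proof.
move=> cX star Xc oe0.
have [M bnd] : exists M : R, forall x, X x -> `|x - c| <= M.
  have [M [_ hM]] := compact_bounded cX.
  exists (M + 1 + `|c|) => x Xx; apply: (le_trans (ler_normB _ _)).
  by rewrite lerD2r; apply: hM => //; rewrite ltrDl.
have e20 : 0 < eta / 2 by rewrite divr_gt0.
have [N hN] : exists N : nat, M < N.+1%:R * (eta / 2).
  exists (Num.truncn (M / (eta / 2))); rewrite -ltr_pdivrMr //.
  exact: truncnS_gt.
have N0 : 0 < N.+1%:R :> R by [].
pose g x i : V := c + (i%:R / N.+1%:R) *: (x - c).
pose H x := fix H i := if i is j.+1 then T (g x j) (H j) (g x j.+1) else e0.
have h01 j : (j <= N.+1)%N -> 0 <= (j%:R / N.+1%:R : R) <= 1.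
  by move=> jN; rewrite divr_ge0 //= ler_pdivrMr // mul1r ler_nat.
have Xg x i : X x -> (i <= N.+1)%N -> X (g x i).
  by move=> Xx iN; apply: star => //; exact: h01.
have g0 x : g x 0 = c by rewrite /g mulr0n mul0r scale0r addr0.
have gN x : g x N.+1 = x by rewrite /g divff ?gt_eqF // scale1r addrC subrK.
have dS x i : X x -> `|g x i - g x i.+1| < eta / 2.
  move=> Xx; rewrite opprD addrACA subrr add0r -scalerBl -mulrBl normrZ.
  rewrite normrM normfV (ger0_norm (ltW N0)) -natr1 opprD addrA subrr add0r.
  rewrite normrN1 mul1r mulrC ltr_pdivrMr // mulrC.
  by apply: le_lt_trans hN; exact: bnd.
have dX x x' i : `|x - x'| < eta / 2 -> (i <= N.+1)%N ->
    `|g x i - g x' i| < eta / 2.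
  move=> xx' iN; rewrite opprD addrACA subrr add0r -scalerBr normrZ.
  rewrite opprB addrA subrK.
  apply: le_lt_trans xx'; rewrite ler_piMl //.
  by have /andP[h1 h2] := h01 _ iN; rewrite ger0_norm.
have lt2 a : a < eta / 2 -> a < eta.
  by move=> h; apply: lt_trans h _; rewrite ltr_pdivrMr //; lra.
have oH x i : X x -> (i <= N.+1)%N -> over (g x i) (H x i).
  move=> Xx; elim: i => [|i IH] iN /=; first by rewrite g0.
  by apply: T_over; [exact/Xg/ltnW|exact: Xg|exact/lt2/dS|exact/IH/ltnW].
(* Both ways around the quadrilateral formed by consecutive points on the rays to [x] and [x'] agree
   by the cocycle condition. Its sides are below [eta / 2], which keeps the diagonal below [eta]. *)
have key x x' i : X x -> X x' -> `|x - x'| < eta / 2 -> (i <= N.+1)%N ->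
    H x' i = T (g x i) (H x i) (g x' i).
  move=> Xx Xx' xx'; elim: i => [|i IH] iN /=; first by rewrite !g0 T_id.
  have iN' := ltnW iN.
  have dd : `|g x i - g x' i.+1| < eta.
    rewrite (_ : _ - _ = (g x i - g x' i) + (g x' i - g x' i.+1)); last first.
      by rewrite addrA subrK.
    apply: (le_lt_trans (ler_normD _ _)); rewrite (splitr eta).
    by apply: ltrD; [exact: dX|exact: dS].
  rewrite IH // T_cocycle //; [|exact: Xg|exact: Xg|exact: Xg|exact/lt2/dX
    |exact/lt2/dS|exact: oH].
  rewrite T_cocycle //; [exact: Xg|exact: Xg|exact: Xg|exact/lt2/dS
    |exact/lt2/dX|exact: oH].
exists (fun x => H x N.+1); split.
- have gc i : g c i = c by rewrite /g subrr scaler0 addr0.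
  by elim: N.+1 => //= i ->; rewrite !gc T_id.
- by move=> x Xx; have := oH x N.+1 Xx (leqnn _); rewrite gN.
- by move=> x x' Xx Xx' xx'; rewrite (key x x') // !gN.
Qed.

End Transport.

Section Cube.
Context {R : realType}.

Lemma cube_compact k : compact (cube R k).
Proof.
rewrite (_ : cube R k = [set v | forall i, `[0, 1]%classic (v ord0 i)]).
  by apply: (rV_compact (A := fun=> `[(0 : R), 1]%classic)) => i; exact: segment_compact.
by apply/seteqP; split=> v /= h i; have := h i; rewrite in_itv.
Qed.

Lemma cube_convex k (a b : 'rV[R]_k) (t : R) : cube R k a -> cube R k b ->
  0 <= t <= 1 -> cube R k (a + t *: (b - a)).
Proof.
move=> ca cb /andP[t0 t1] i; rewrite !mxE; have /andP[? ?] := ca i.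
by have /andP[? ?] := cb i; apply/andP; split; nra.
Qed.

Lemma cube0 k : cube R k 0.
Proof. by move=> i; rewrite mxE lexx ler01. Qed.

Lemma cube_boundary0 k : (0 < k)%N -> cube_boundary R k 0.
Proof.
by case: k => // k _; split; [exact: cube0|exists ord0; left; rewrite mxE].
Qed.

Lemma cube_boundary_sub k : cube_boundary R k `<=` cube R k.
Proof. by move=> t []. Qed.

(* From a point with [x_i] in {0,1}, first bring all other coordinates to 0,
   then, since another coordinate vanishes, [x_i] itself. *)
Lemma boundary_segments k (P : 'rV[R]_k -> Prop) : (2 <= k)%N ->
  (forall a b, (forall t : R, 0 <= t <= 1 -> cube_boundary R k (a + t *: (b - a))) ->
     P a -> P b) ->
  P 0 -> forall x, cube_boundary R k x -> P x.
Proof.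
move=> k2 step P0 x [cx [i xi]].
pose y : 'rV[R]_k := \row_j (if j == i then x 0 i else 0).
have cy : cube R k y.
  by move=> j; rewrite mxE; case: eqP => _; rewrite ?cx // lexx ler01.
have [j ji] : exists j : 'I_k, j != i.
  have : (1 < #|'I_k|)%N by rewrite card_ord.
  case/card_gt1P => a [b [_ _ ab]].
  by have [->|ai] := eqVneq i a; [exists b; rewrite eq_sym | exists a; rewrite eq_sym].
have Py : P y.
  apply: step P0 => t t01; split; first by apply: cube_convex => //; exact: cube0.
  by exists j; left; rewrite !mxE (negPf ji) subrr mulr0 addr0.
apply: step Py => t t01; split; first exact: cube_convex.
by exists i; rewrite !mxE eqxx subrr mulr0 addr0.
Qed.

Lemma boundary_chain k (P : 'rV[R]_k -> Prop) (d : R) : (2 <= k)%N -> 0 < d ->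
  (forall x y, cube_boundary R k x -> cube_boundary R k y -> `|x - y| < d ->
     P x -> P y) ->
  P 0 -> forall x, cube_boundary R k x -> P x.
Proof.
move=> k2 d0 step; apply: boundary_segments => // a b ab.
by apply: (segment_chain d0) => s t s01 t01; apply: step; exact: ab.
Qed.

Definition cylinder k : set (R * 'rV[R]_k) := `[0, 1]%classic `*` cube R k.

Lemma cylinderP k s t : cylinder (k := k) (s, t) <-> 0 <= s <= 1 /\ cube R k t.
Proof. by rewrite /cylinder /= in_itv. Qed.

Lemma cylinder_compact k : compact (@cylinder k).
Proof. by apply: compact_setX; [exact: segment_compact|exact: cube_compact]. Qed.

Lemma cylinder_convex k a b (t : R) : @cylinder k a -> @cylinder k b ->
  0 <= t <= 1 -> cylinder (a + t *: (b - a)).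
Proof.
case: a b => [s x] [s' x'] /cylinderP[/andP[h1 h2] cx] /cylinderP[/andP[h3 h4] cx'] t01.
apply/cylinderP; split; last exact: cube_convex.
by move: t01 => /andP[? ?] /=; apply/andP; split; rewrite /GRing.scale /=; nra.
Qed.

Lemma cylinder0 k : @cylinder k (0, 0).
Proof. by apply/cylinderP; split; [rewrite lexx ler01|exact: cube0]. Qed.

End Cube.

Lemma cube_boundary_closed {R : realType} k : closed (cube_boundary R k).
Proof.
have cc : closed (cube R k).
  by apply: compact_closed; [exact: norm_hausdorff|exact: cube_compact].
pose h (x : 'rV[R]_k) : R := \prod_(i < k) (x 0 i * (1 - x 0 i)).
have ch : continuous h.
  apply: cont_prod => i; apply: cont_mul; first exact: coord_continuous.
  apply: cont_add; first exact: cont_cst.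
  by apply: cont_opp; exact: coord_continuous.
rewrite (_ : cube_boundary R k = cube R k `&` h @^-1` [set 0]).
  apply: closedI => //; apply: (iffLR (continuous_closedP _) ch).
  exact: closed_eq.
apply/seteqP; split=> [x [cx [i xi]]|x [cx /= /eqP]].
  split=> //=; rewrite /h (bigD1 i) //=.
  by case: xi => ->; rewrite ?(mul0r, subrr, mulr0, mul0r).
rewrite prodf_seq_eq0 => /hasP[i _ /=]; rewrite mulf_eq0 => /orP h0.
split=> //; exists i; case: h0 => [/eqP ->|]; first by left.
by rewrite subr_eq0 => /eqP <-; right.
Qed.

Lemma cube_boundary_compact {R : realType} k : compact (cube_boundary R k).
Proof.
apply: (subclosed_compact (@cube_boundary_closed R k) (@cube_compact R k)).
exact: cube_boundary_sub.
Qed.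

(** * Homotopies of spheroids *)

Section WithinContinuity.
Context {T U W : topologicalType}.

Lemma withinP (A : set T) (f : T -> W) : {within A, continuous f} <->
  forall x, A x -> forall N, nbhs (f x) N -> nbhs x (fun y => A y -> N (f y)).
Proof.
split=> [/subspace_continuousP cf x Ax N fN|cf]; first exact: cf.
by apply/subspace_continuousP => x Ax N fN; exact: cf.
Qed.

Lemma within_comp (A : set T) (B : set U) (f : T -> U) (g : U -> W) :
  {within A, continuous f} -> (forall x, A x -> B (f x)) ->
  {within B, continuous g} -> {within A, continuous (fun x => g (f x))}.
Proof.
move=> /subspace_continuousP cf AB /subspace_continuousP cg.
apply/subspace_continuousP => x Ax N /(cg _ (AB _ Ax)) NB.
have h : within A (nbhs x) (fun y => B (f y) -> N (g (f y))) := cf x Ax _ NB.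
have hA : within A (nbhs x) A by apply: withinT; exact: nbhs_filter.
have : within A (nbhs x) (fun y => N (g (f y))).
  apply: filterS2 h hA => y hy Ay; apply: hy; exact: AB.
by [].
Qed.

Lemma within_cont (A : set T) (f : T -> W) :
  continuous f -> {within A, continuous f}.
Proof. exact: continuous_subspaceT. Qed.

Lemma within_eq (A : set T) (f g : T -> W) : (forall x, A x -> f x = g x) ->
  {within A, continuous f} -> {within A, continuous g}.
Proof.
move=> fg; apply: subspace_eq_continuous => x /set_mem Ax; exact: fg.
Qed.

Lemma within_sub (A B : set T) (f : T -> W) : A `<=` B ->
  {within B, continuous f} -> {within A, continuous f}.
Proof. exact: continuous_subspaceW. Qed.

Lemma within_local (A : set T) (f : T -> W) :
  (forall x, A x -> exists g : T -> W, {within A, continuous g} /\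
     \forall y \near x, A y -> f y = g y) ->
  {within A, continuous f}.
Proof.
move=> h; apply/subspace_continuousP => x Ax.
have [g [/subspace_continuousP cg fg]] := h x Ax.
have fgx : f x = g x by exact: (nbhs_singleton fg).
move=> N NB; have {NB} : nbhs (g x) N by rewrite -fgx.
move=> /(cg x Ax) gN.
have hA : within A (nbhs x) (fun y => A y -> f y = g y).
  by change (nbhs x (fun y => A y -> A y -> f y = g y)); apply: filterS fg => y fgy _.
have hA' : within A (nbhs x) A by apply: withinT; exact: nbhs_filter.
have hN : within A (nbhs x) (fun y => N (g y)) := gN.
have : within A (nbhs x) (fun y => N (f y)).
  by apply: filterS3 hN hA hA' => y gy fy Ay; rewrite fy.
by [].
Qed.

Lemma near_snd (t : U) (x : T) (N : set T) :
  nbhs x N -> nbhs (t, x) (fun p => N p.2).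
Proof. by move=> Nx; exact: (@cont_snd U T (t, x) N Nx). Qed.

End WithinContinuity.

Section Homotopy.
Context {R : realType} {X : topologicalType}.
Implicit Types (A : set X) (x : X) (k : nat).

(** The part of [K_pi_1] that concerns higher homotopy, in terms of null-homotopies instead of
    classes. It says nothing about connectedness. *)
Definition aspherical A : Prop :=
  forall k x f, (2 <= k)%N -> spheroid R A x k f ->
    homotopic_rel R A x f (fun=> x).

Lemma spheroid_base A x k f : (0 < k)%N -> spheroid R A x k f -> A x.
Proof.
move=> k0 [_ fA fx]; rewrite -(fx 0); last exact: cube_boundary0.
by apply: fA; exact: cube0.
Qed.

Lemma spheroid_cst A x k : A x -> spheroid R A x k (fun=> x).
Proof. by move=> Ax; split => // ; exact/within_cont/cont_cst. Qed.

Lemma homotopic_sym A x k (f g : 'rV[R]_k -> X) :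
  homotopic_rel R A x f g -> homotopic_rel R A x g f.
Proof.
case=> H [cH HA H0 H1 Hx].
have h01 (s : R) : 0 <= s <= 1 -> 0 <= 1 - s <= 1.
  by move=> /andP[? ?]; apply/andP; split; lra.
exists (fun p => H (1 - p.1, p.2)); split.
- apply: (within_comp (f := fun p : R * 'rV[R]_k => (1 - p.1, p.2)) _ _ cH).
    apply: within_cont; apply: cont_pair; last exact: cont_snd.
    apply: cont_add; first exact: cont_cst.
    by apply: cont_opp; exact: cont_fst.
  by move=> [s t] /cylinderP[s01 ct]; apply/cylinderP; split => //; exact: h01.
- by move=> s t s01 ct; apply: HA => //; exact: h01.
- by move=> t ct /=; rewrite subr0 H1.
- by move=> t ct /=; rewrite subrr H0.
- by move=> s t s01 ct; apply: Hx => //; exact: h01.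
Qed.

Lemma homotopic_trans A x k (f g h : 'rV[R]_k -> X) :
  homotopic_rel R A x f g -> homotopic_rel R A x g h ->
  homotopic_rel R A x f h.
Proof.
case=> H [cH HA H0 H1 Hx] [G [cG GA G0 G1 Gx]].
pose Z (p : R * 'rV[R]_k) :=
  if p.1 <= 1 / 2 then H (2 * p.1, p.2) else G (2 * p.1 - 1, p.2).
have lo (s : R) : 0 <= s <= 1 -> s <= 1 / 2 -> 0 <= 2 * s <= 1.
  by move=> /andP[? ?] ?; apply/andP; split; lra.
have hi (s : R) : 0 <= s <= 1 -> 1 / 2 <= s -> 0 <= 2 * s - 1 <= 1.
  by move=> /andP[? ?] ?; apply/andP; split; lra.
have cf1 : continuous (fun p : R * 'rV[R]_k => 2 * p.1).
  by apply: cont_mul; [exact: cont_cst|exact: cont_fst].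
exists Z; split.
- pose A1 : set (R * 'rV[R]_k) := [set p | p.1 <= 1 / 2] `&` @cylinder R k.
  pose A2 : set (R * 'rV[R]_k) := [set p | 1 / 2 <= p.1] `&` @cylinder R k.
  have clc : closed (@cylinder R k).
    by apply: compact_closed; [exact: norm_hausdorff|exact: cylinder_compact].
  have -> : `[0, 1]%classic `*` cube R k = A1 `|` A2.
    apply/seteqP; split=> [p cp|p [[] //|[] //]].
    by case: (lerP p.1 (1 / 2)) => hs; [left|right; split => //=; exact: ltW].
  apply: withinU_continuous.
  + apply: closedI => //.
    exact: (iffLR (continuous_closedP _) cont_fst _ (@closed_le R (1 / 2))).
  + apply: closedI => //.
    exact: (iffLR (continuous_closedP _) cont_fst _ (@closed_ge R (1 / 2))).
  + apply: (@within_eq _ _ A1 (fun p => H (2 * p.1, p.2))).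
      by move=> p [/= p1 _]; rewrite /Z p1.
    apply: (within_comp (f := fun p : R * 'rV[R]_k => (2 * p.1, p.2)) _ _ cH).
      by apply: within_cont; apply: cont_pair => //; exact: cont_snd.
    move=> [s t] [/= s1 /cylinderP[s01 ct]]; apply/cylinderP; split => //; exact: lo.
  + apply: (@within_eq _ _ A2 (fun p => G (2 * p.1 - 1, p.2))).
      move=> [s t] [/= p1 /cylinderP[_ ct]]; rewrite /Z /=; case: ifP => // hs.
      have -> : s = 1 / 2 by apply/eqP; rewrite eq_le hs p1.
      by rewrite mulrC divfK // subrr G0 // H1.
    apply: (within_comp (f := fun p : R * 'rV[R]_k => (2 * p.1 - 1, p.2)) _ _ cG).
      apply: within_cont; apply: cont_pair; last exact: cont_snd.
      by apply: cont_add => //; exact: cont_cst.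
    move=> [s t] [/= s1 /cylinderP[s01 ct]]; apply/cylinderP; split => //; exact: hi.
- move=> s t s01 ct; rewrite /Z /=; case: lerP => hs.
    by apply: HA => //; exact: lo.
  by apply: GA => //; apply: hi => //; exact: ltW.
- by move=> t ct; rewrite /Z /= mulr0 H0 // ifT // divr_ge0.
- move=> t ct; rewrite /Z /= ifF; last by apply/negbTE; rewrite -ltNge; lra.
  by rewrite mulr1 (_ : 2 - 1 = 1 :> R) ?G1 //; ring.
- move=> s t s01 ct; rewrite /Z /=; case: lerP => hs.
    by apply: Hx => //; exact: lo.
  by apply: Gx => //; apply: hi => //; exact: ltW.
Qed.

Lemma homotopic_spheroid A x k (f g : 'rV[R]_k -> X) :
  homotopic_rel R A x f g -> spheroid R A x k g.
Proof.
case=> H [cH HA _ H1 Hx]; have h1 : 0 <= (1 : R) <= 1 by rewrite ler01 lexx.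
split.
- apply: (within_eq (f := fun t => H (1, t))) => //.
  apply: (within_comp _ _ cH) => [|t ct]; last exact/cylinderP.
  have cp : continuous (fun t : 'rV[R]_k => (1 : R, t)).
    apply: cont_pair; last by move=> t; exact: cvg_id.
    by move=> t; exact: (@cont_cst 'rV[R]_k _ (1 : R)).
  exact: within_cont cp.
- by move=> t ct; rewrite -H1 //; exact: HA.
- by move=> t bt; rewrite -H1 ?Hx //; exact: cube_boundary_sub.
Qed.

Lemma aspherical_K_pi_1 A : A !=set0 -> connected A -> aspherical A ->
  K_pi_1 R A.
Proof.
move=> A0 cA asph; split=> // x k Ax k2.
have classE f : spheroid R A x k f ->
    homotopy_class R A x f = homotopy_class R A x (fun=> x).
  move=> sf; apply/seteqP; split=> g [sg _]; split=> //.
    exact/homotopic_sym/asph.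
  exact/(homotopic_trans (asph _ _ _ k2 sf))/homotopic_sym/asph.
apply/seteqP; split=> [_ [f sf <-]|_ ->] /=; first exact: classE.
by exists (fun=> x) => //; exact: spheroid_cst.
Qed.

End Homotopy.

Section HomotopyMap.
Context {R : realType} {X Y : topologicalType}.

Lemma spheroid_map (A : set X) (B : set Y) (h : X -> Y) x k f :
  {within A, continuous h} -> (forall a, A a -> B (h a)) ->
  spheroid R A x k f -> spheroid R B (h x) k (fun t => h (f t)).
Proof.
move=> ch AB [cf fA fx]; split.
- exact: (within_comp cf fA ch).
- by move=> t ct; exact/AB/fA.
- by move=> t bt; rewrite fx.
Qed.

Lemma homotopic_map (A : set X) (B : set Y) (h : X -> Y) x k
    (f g : 'rV[R]_k -> X) :
  {within A, continuous h} -> (forall a, A a -> B (h a)) ->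
  homotopic_rel R A x f g ->
  homotopic_rel R B (h x) (fun t => h (f t)) (fun t => h (g t)).
Proof.
move=> ch AB [H [cH HA H0 H1 Hx]]; exists (fun p => h (H p)); split.
- by apply: (within_comp cH _ ch) => -[s t] /cylinderP[]; exact: HA.
- by move=> s t s01 ct; exact/AB/HA.
- by move=> t ct; rewrite H0.
- by move=> t ct; rewrite H1.
- by move=> s t s01 bt; rewrite Hx.
Qed.

Lemma homotopic_eq (A : set Y) x k (f g f' g' : 'rV[R]_k -> Y) :
  (forall t, cube R k t -> f t = f' t) -> (forall t, cube R k t -> g t = g' t) ->
  homotopic_rel R A x f g -> homotopic_rel R A x f' g'.
Proof.
move=> ff gg [H [cH HA H0 H1 Hx]]; exists H; split=> // t ct.
  by rewrite H0 // ff.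
by rewrite H1 // gg.
Qed.

End HomotopyMap.

Arguments aspherical R {X} A.

(** * Continuity of roots *)

Section Roots.
Context {R : realType} {n : nat}.
Local Notation C := R[i].
Implicit Types (p q : C -> C) (e r : 'rV[C]_n).

(** [p] is a bare function, so that a family of polynomials is a map into [C -> C]; the product
    makes it monic of degree [n], and injectivity of [r] makes its roots simple. *)
Definition roots_of p r : Prop :=
  injective (r 0) /\ forall z, p z = \prod_(i < n) (z - r 0 i).

Lemma roots_of_root p r i : roots_of p r -> p (r 0 i) = 0.
Proof. by case=> _ ->; rewrite (bigD1 i) //= subrr mul0r. Qed.

Lemma root_roots_of p r z : roots_of p r -> p z = 0 -> exists i, z = r 0 i.
Proof.
case=> _ -> /eqP; rewrite prodf_seq_eq0 => /hasP[i _ /=].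
by rewrite subr_eq0 => /eqP ->; exists i.
Qed.

Lemma roots_of_perm p r (f : 'I_n -> 'I_n) : injective f -> roots_of p r ->
  roots_of p (\row_i r 0 (f i)).
Proof.
move=> injf [injr pE]; split.
  by move=> i j; rewrite !mxE => /injr/injf.
move=> z; rewrite pE (reindex_inj injf) /=.
by apply: eq_bigr => i _; rewrite mxE.
Qed.

(** The modulus of [q (e 0 i)] is the product of the [n] distances from [e 0 i] to the roots of [q];
    if it is below [eps ^+ n], one of the distances is below [eps]. *)
Lemma roots_of_near p q e r (eps : R) i : 0 < eps ->
  roots_of p e -> roots_of q r -> cabs (q (e 0 i)) < eps ^+ n ->
  exists j, cabs (e 0 i - r 0 j) < eps.
Proof.
move=> eps0 _ [_ ->]; apply: contraPP => /forallNP h; apply/negP.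
rewrite -leNgt cabs_prod -[in leLHS](card_ord n) -prodr_const.
by apply: ler_prod => j _; rewrite ltW //= leNgt; apply/negP/h.
Qed.

Lemma roots_of_permutation p r r' : roots_of p r -> roots_of p r' ->
  exists s : 'S_n, forall i, r' 0 i = r 0 (s i).
Proof.
move=> pr pr'.
have /choice[g hg] : forall i, exists j, r' 0 i = r 0 j.
  by move=> i; apply: root_roots_of pr _; exact: roots_of_root.
have gi : injective g by move=> i j gij; apply: pr'.1; rewrite !hg gij.
by exists (perm gi) => i; rewrite permE.
Qed.

Definition separated (s : R) r : Prop :=
  forall i j, i != j -> s <= cabs (r 0 i - r 0 j).

Lemma separated_exists r : injective (r 0) -> exists2 s, 0 < s & separated s r.
Proof.
move=> injr.
have h : \forall s \near (0 : R)^'+, forall i j, i != j -> s <= cabs (r 0 i - r 0 j).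
  apply: filter_forall => i; apply: filter_forall => j.
  have [->|ij] := eqVneq i j; first by near=> s.
  near=> s => _; apply: ltW; near: s; apply: nbhs_right_lt.
  by rewrite cabs_gt0 subr_eq0; apply: contraNN ij => /eqP/injr ->.
have /filter_ex[s [s0 hs]] : \forall s \near (0 : R)^'+, 0 < s /\
    forall i j, i != j -> s <= cabs (r 0 i - r 0 j).
  by apply: filterI => //; exact: nbhs_right_gt.
by exists s.
Unshelve. all: by end_near. Qed.

Lemma roots_of_uniq p e r (s : R) : roots_of p e -> roots_of p r ->
  separated s e -> (forall i, cabs (r 0 i - e 0 i) < s) -> r = e.
Proof.
move=> pe pr se h; apply/rowP => i.
have [j rj] := root_roots_of pe (roots_of_root i pr).
rewrite rj; have [->//|ij] := eqVneq j i.
by have := se _ _ ij; rewrite -rj leNgt h.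
Qed.

(** No entry of [r] is within [eps] of two entries of [e], as these are at least [2 * eps] apart;
    the choice is thus injective, hence bijective on a finite set. *)
Lemma matching e r (s eps : R) : 2 * eps <= s -> separated s e ->
  (forall i, exists j, cabs (e 0 i - r 0 j) < eps) ->
  exists g : 'I_n -> 'I_n, bijective g /\
    forall i, cabs (e 0 i - r 0 (g i)) < eps.
Proof.
move=> es se /choice[g hg]; exists g; split=> //; apply: injF_bij => i j gij.
apply/eqP; apply: contraT => ij; have := se _ _ ij; rewrite leNgt => /negP[].
apply: lt_le_trans es; apply: le_lt_trans (cabs_dist _ (r 0 (g i)) _) _.
by rewrite mulr_natl mulr2n; apply: ltrD; rewrite // cabsB gij.
Qed.

End Roots.

Lemma uniform_continuityC {R : realType} {V : normedModType R} (X : set V)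
    (f : V -> R[i]) (eps : R) :
  compact X -> {within X, continuous f} -> 0 < eps ->
  exists2 r, 0 < r &
    forall x y, X x -> X y -> `|x - y| < r -> cabs (f x - f y) < eps.
Proof.
move=> cX cf eps0; have e20 : 0 < eps / 2 by rewrite divr_gt0.
have cRe : {within X, continuous (fun x => complex.Re (f x))}.
  exact: (cont_comp cf Re_continuous).
have cIm : {within X, continuous (fun x => complex.Im (f x))}.
  exact: (cont_comp cf Im_continuous).
have [r1 r10 h1] := uniform_continuity cX cRe e20.
have [r2 r20 h2] := uniform_continuity cX cIm e20.
exists (Num.min r1 r2); first by rewrite lt_min r10.
move=> x y Xx Xy; rewrite lt_min => /andP[xy1 xy2].
apply: le_lt_trans (cabs_le_ReIm _) _; rewrite (splitr eps) !raddfB.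
by apply: ltrD; [exact: h1|exact: h2].
Qed.

(** * Continuous lifting of root tuples over star-shaped compact sets *)

Section RootLifting.
Context {R : realType} {V : normedModType R} {n : nat}.
Local Notation C := R[i].
Variables (X : set V) (P : V -> C -> C).
Hypothesis X_compact : compact X.
Hypothesis P_cont : forall z, {within X, continuous (fun x => P x z)}.
Hypothesis P_roots : forall x, X x -> exists r : 'rV[C]_n, roots_of (P x) r.

(** Continuity in [x] is applied at the [n] roots [z = e 0 i] of [P x0]: smallness of [P x] there
    forces a root of [P x] near each of them. *)
Let local_near x0 (e : 'rV[C]_n) (eps : R) : X x0 -> roots_of (P x0) e ->
  0 < eps -> exists2 d, 0 < d & forall x (r : 'rV[C]_n), X x ->
    `|x0 - x| < d -> roots_of (P x) r ->
    forall i, exists j, cabs (e 0 i - r 0 j) < eps.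
Proof.
move=> Xx0 pe eps0; have en0 : 0 < eps ^+ n by rewrite exprn_gt0.
have : \forall x \near x0, X x -> forall i, cabs (P x (e 0 i)) < eps ^+ n.
  have h i : \forall x \near x0, X x -> cabs (P x (e 0 i)) < eps ^+ n.
    apply: (iffLR (withinP _ _) (@P_cont (e 0 i)) _ Xx0 [set w | cabs w < eps ^+ n]).
    by apply/nbhsC_cabs; exists (eps ^+ n) => // w /=; rewrite (roots_of_root i pe) subr0.
  have : \forall x \near x0, forall i, X x -> cabs (P x (e 0 i)) < eps ^+ n.
    exact: filter_forall h.
  by apply: filterS => x hx Xx i; exact: hx.
move=> /nbhs_normP[d /= d0 hd]; exists d => // x r Xx xd pr i.
by apply: roots_of_near pe pr _ => //; apply: hd.
Qed.

(** Near [x0] each root tuple is matched within [s / 4] to an [s]-separated one, so its entries stay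
    [s / 2] apart; compactness makes the constant uniform. *)
Lemma uniformly_separated : exists2 s : R, 0 < s &
  forall x (r : 'rV[C]_n), X x -> roots_of (P x) r -> separated s r.
Proof.
have [|s s0 hs] := @lebesgue_number _ _ X
  (fun s x => forall r : 'rV[C]_n, roots_of (P x) r -> separated s r) X_compact.
  move=> x0 Xx0; have [e pe] := P_roots Xx0.
  have [s s0 se] := separated_exists pe.1.
  have s40 : 0 < s / 4 by rewrite divr_gt0.
  have [d d0 hd] := local_near Xx0 pe s40.
  exists (Num.min d (s / 2)); first by rewrite lt_min d0 divr_gt0.
  move=> t x t0; rewrite !lt_min => /andP[_ ts] /andP[xd _] Xx r pr.
  have [|g [[g' gK g'K] hg]] := matching _ se (hd x r Xx xd pr); first lra.
  move=> j j' jj'.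
  have : s <= cabs (e 0 (g' j) - e 0 (g' j')).
    by apply: se; apply: contraNN jj' => /eqP/(congr1 g); rewrite !g'K => ->.
  have := cabs_dist (e 0 (g' j)) (r 0 j) (e 0 (g' j')).
  have := cabs_dist (r 0 j) (r 0 j') (e 0 (g' j')).
  have := hg (g' j); have := hg (g' j'); rewrite !g'K (cabsB (r 0 j')) => *; lra.
by exists s => // x r Xx; apply: hs.
Qed.

(** In one short step along the segment each lift moves by less than [s / 2], so lifts that agree
    before it are closer than [s] after it; being root tuples of the same [s]-separated polynomial,
    they still agree. *)
Lemma roots_unique (a b : V) (e e' : V -> 'rV[C]_n) :
  (forall t : R, 0 <= t <= 1 -> X (a + t *: (b - a))) ->
  {within X, continuous e} -> {within X, continuous e'} ->
  (forall x, X x -> roots_of (P x) (e x)) ->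
  (forall x, X x -> roots_of (P x) (e' x)) ->
  e a = e' a -> e b = e' b.
Proof.
move=> Xab ce ce' pe pe'; have [s s0 hs] := uniformly_separated.
have s20 : 0 < s / 2 by rewrite divr_gt0.
have unif (f : V -> 'rV[C]_n) : {within X, continuous f} ->
    exists2 d, 0 < d & forall x y, X x -> X y -> `|x - y| < d ->
      forall i, cabs (f x 0 i - f y 0 i) < s / 2.
  move=> cf.
  have /choice[d hd] : forall i : 'I_n, exists d : R, 0 < d /\
      forall x y, X x -> X y -> `|x - y| < d -> cabs (f x 0 i - f y 0 i) < s / 2.
    move=> i; have cfi : {within X, continuous (fun x => f x 0 i)}.
      exact: (cont_comp cf (@coord_continuous _ _ _ 0 i)).
    by have [d d0 hd] := uniform_continuityC X_compact cfi s20; exists d.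
  have h : \forall u \near (0 : R)^'+, forall i, u < d i.
    by apply: filter_forall => i; apply: nbhs_right_lt; have [] := hd i.
  have /filter_ex[u [u0 hu]] : \forall u \near (0 : R)^'+, 0 < u /\ forall i, u < d i.
    by apply: filterI => //; exact: nbhs_right_gt.
  exists u => // x y Xx Xy xy i; have [_] := hd i; apply => //.
  exact: lt_trans (hu i).
have [d d0 hd] := unif e ce; have [d' d0' hd'] := unif e' ce'.
have dd : 0 < Num.min d d' by rewrite lt_min d0.
apply: (segment_chain (P := fun x => e x = e' x) dd) => u v u01 v01.
set x := a + u *: _; set y := a + v *: _; rewrite lt_min => /andP[xy xy'] exy.
have Xx : X x by exact: Xab.
have Xy : X y by exact: Xab.
apply: (roots_of_uniq (pe' _ Xy) (pe _ Xy) (hs _ _ Xy (pe' _ Xy))) => i.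
apply: le_lt_trans (cabs_dist _ (e x 0 i) _) _; rewrite (splitr s).
by apply: ltrD; [rewrite cabsB; exact: hd|rewrite exy; exact: hd'].
Qed.

(** The transport sends a root tuple to the one within [s / 4] of it, obtained from two matchings
    within [s / 8] with a common centre. The three moves in the cocycle condition add up to less
    than [s], so uniqueness for [s]-separated tuples gives the identity. *)
Theorem root_lifting (c : V) (r0 : 'rV[C]_n) : X c ->
  (forall x (t : R), X x -> 0 <= t <= 1 -> X (c + t *: (x - c))) ->
  roots_of (P c) r0 ->
  exists e : V -> 'rV[C]_n, [/\ e c = r0,
    forall x, X x -> roots_of (P x) (e x) & {within X, continuous e}].
Proof.
move=> Xc star pr0; have [s s0 hs] := uniformly_separated.
have s80 : 0 < s / 8 by rewrite divr_gt0.
have [eta eta0 heta] : exists2 eta, 0 < eta & forall x, X x -> forall x', X x' ->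
    `|x - x'| < eta -> forall r : 'rV[C]_n, roots_of (P x) r ->
    exists r' : 'rV[C]_n, roots_of (P x') r' /\
      forall i, cabs (r' 0 i - r 0 i) < s / 4.
  apply: lebesgue_number => // x0 Xx0; have [e pe] := P_roots Xx0.
  have [d d0 hd] := local_near Xx0 pe s80.
  have se := hs _ _ Xx0 pe.
  exists (d / 2); first by rewrite divr_gt0.
  move=> u x u0 ud x0x Xx x' Xx' xx' r pr.
  have x0xd : `|x0 - x| < d by lra.
  have x0x' : `|x0 - x'| < d.
    rewrite (_ : x0 - x' = (x0 - x) + (x - x')); last by rewrite addrA subrK.
    by apply: le_lt_trans (ler_normD _ _) _; lra.
  have [r' pr'] := P_roots Xx'.
  have [|g [[gi gK giK] hg]] := matching _ se (hd x r Xx x0xd pr); first lra.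
  have [|g' [bg' hg']] := matching _ se (hd x' r' Xx' x0x' pr'); first lra.
  exists (\row_i r' 0 (g' (gi i))); split.
    apply: roots_of_perm pr'; apply: (inj_comp (f := g')); first exact: bij_inj.
    exact: can_inj giK.
  move=> i; rewrite mxE; have := hg (gi i); have := hg' (gi i); rewrite giK.
  have := cabs_dist (r' 0 (g' (gi i))) (e 0 (gi i)) (r 0 i).
  by rewrite (cabsB _ (e 0 (gi i))) => *; lra.
(* The default [r] is never reached for points of [X] closer than [eta], where a suitable tuple
   exists. *)
pose T (x : V) (r : 'rV[C]_n) (x' : V) : 'rV[C]_n :=
  xget r [set r' | roots_of (P x') r' /\ forall i, cabs (r' 0 i - r 0 i) < s / 4].
have TP x x' r : X x -> X x' -> `|x - x'| < eta -> roots_of (P x) r ->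
    roots_of (P x') (T x r x') /\ forall i, cabs (T x r x' 0 i - r 0 i) < s / 4.
  move=> Xx Xx' xx' pr; have [r' hr'] := heta x Xx x' Xx' xx' r pr.
  by rewrite /T; case: xgetP => [r'' -> []|/(_ r')].
have [|||e [ec ep eT]] := transport_lift (over := fun x r => roots_of (P x) r)
    (T := T) eta0 _ _ _ X_compact star Xc pr0.
- by move=> x x' r Xx Xx' xx' pr; have [] := TP x x' r Xx Xx' xx' pr.
- move=> x r Xx pr; have [|pT hT] := TP x x r Xx Xx _ pr; first by rewrite subrr normr0.
  apply: roots_of_uniq pr pT (hs _ _ Xx pr) _ => i; apply: lt_trans (hT i) _; lra.
- move=> x x' x'' r Xx Xx' Xx'' xx' x'x'' xx'' pr.
  have [pT hT] := TP x x' r Xx Xx' xx' pr.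
  have [pT' hT'] := TP _ _ _ Xx' Xx'' x'x'' pT.
  have [pT'' hT''] := TP _ _ _ Xx Xx'' xx'' pr.
  apply: roots_of_uniq pT'' pT' (hs _ _ Xx'' pT'') _ => i.
  have := hT i; have := hT' i; have := hT'' i.
  have := cabs_dist (T x' (T x r x') x'' 0 i) (T x r x' 0 i) (T x r x'' 0 i).
  have := cabs_dist (T x r x' 0 i) (r 0 i) (T x r x'' 0 i).
  by rewrite (cabsB (r 0 i)) => *; lra.
exists e; split=> //.
(* Some entry [j] of [e y] is within [s / 4] of [e x 0 i], and so is entry [i] by transport;
   separation by [s] forces [i = j]. *)
apply: cont_row => i; apply/subspace_continuousP => x Xx N /nbhsC_cabs[eps eps0 epsN].
have m0 : 0 < Num.min eps (s / 4) by rewrite lt_min eps0 divr_gt0.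
have [d d0 hd] := local_near Xx (ep x Xx) m0.
suff : within X (nbhs x) (fun y => N (e y 0 i)) by [].
have de : 0 < Num.min d (eta / 2) by rewrite lt_min d0 divr_gt0.
change (nbhs x (fun y => X y -> N (e y 0 i))).
apply/nbhs_normP; exists (Num.min d (eta / 2)) => // y xy Xy; apply: epsN.
have /andP[xyd xye] : (`|x - y| < d) && (`|x - y| < eta / 2) by rewrite -lt_min.
have xye' : `|x - y| < eta by lra.
have [pT hT] := TP x y (e x) Xx Xy xye' (ep x Xx).
have eyT := eT x y Xx Xy xye; rewrite -eyT in pT hT.
have [j] := hd y (e y) Xy xyd pT i; rewrite lt_min => /andP[ij1 ij2].
have [ij|ij] := eqVneq i j; first by rewrite ij cabsB -{1}ij; rewrite -ij in ij1 *.
have := hs _ _ Xy pT i j ij; have := hT i.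
by have := cabs_dist (e y 0 i) (e x 0 i) (e y 0 j); move=> *; lra.
Qed.

End RootLifting.

(** * The universal cover of a punctured plane *)

Section Words.
Implicit Types (w : seq nat) (j : nat).

(* Reduced words in a free product of groups of order 2, the letters being
   involutions: [act j] is multiplication by the [j]-th generator. *)
Definition act j w : seq nat :=
  if w is i :: v then if i == j then v else j :: w else [:: j].

Definition reduced w := if w is i :: v then path (fun a b : nat => a != b) i v else true.

Lemma reduced_behead i w : reduced (i :: w) -> reduced w.
Proof. by case: w => //= a w /andP[]. Qed.

Lemma reduced_act j w : reduced w -> reduced (act j w).
Proof.
case: w => //= i w; case: eqP => [_|/eqP ij] iw; last by rewrite /= eq_sym ij.
exact: reduced_behead iw.
Qed.

(** Reducedness enters when [j] cancels the head: the next letter then differs from [j], so the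
    second [act] puts [j] back. *)
Lemma actK j w : reduced w -> act j (act j w) = w.
Proof.
case: w => [|i [|i' w]] /=; first by rewrite eqxx.
  by case: eqP => [->|_] /=; rewrite ?eqxx.
case: (eqVneq i j) => [->|_] /=; last by rewrite eqxx.
by case/andP; rewrite eq_sym => /negPf ->.
Qed.

Lemma odd_act j w : odd (size (act j w)) = ~~ odd (size w).
Proof. by case: w => //= i w; case: eqP => _ //=; rewrite negbK. Qed.

Lemma act_longer j w : (size w < size (act j w))%N -> act j w = j :: w.
Proof. by case: w => //= i w; case: eqP => // _; rewrite ltnNge leqnSn. Qed.

Lemma size_act j w : (size (act j w) <= (size w).+1)%N.
Proof. by case: w => //= i w; case: eqP => _ /=; rewrite ?leqnSn // leqW. Qed.

Lemma all_act j w (P : pred nat) : P j -> all P w -> all P (act j w).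
Proof. by case: w => [|i w] /= Pj; rewrite ?Pj // => /andP[Pi Pw]; case: eqP; rewrite //= Pj Pi. Qed.

End Words.

(** The lower bound [b] serves the induction: it is the last entry passed, and a midpoint with the
    next entry is the witness for [j = 0]. *)
Lemma gap {R : realType} (s : seq R) (b : R) (j : nat) : path <%R b s -> (j <= size s)%N ->
  exists m, [/\ b < m, m \notin s & count (< m) s = j].
Proof.
elim: s b j => [|a s IH] b j /=.
  by rewrite leqn0 => _ /eqP ->; exists (b + 1); rewrite ltrDl.
case/andP => ba sa; case: j => [_|j]; last first.
  rewrite ltnS => /(IH _ _ sa)[m [am ms <-]]; exists m.
  by rewrite (lt_trans ba am) in_cons negb_or gt_eqF //= am add1n.
have /allP h : all (> a) s by rewrite (order_path_min lt_trans).
exists ((a + b) / 2).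
have ma : (a + b) / 2 < a by lra.
split; first lra.
  rewrite in_cons negb_or lt_eqF //=; apply/negP => /h /=.
  by rewrite ltNge (ltW ma).
rewrite ltNge (ltW ma) add0n; apply/eqP; rewrite -leqn0 leqNgt -has_count.
by apply/negP => /hasP[x /h /= ax]; rewrite ltNge ltW // (lt_trans ma).
Qed.

(** * Slit planes, strips and names of sheets *)

Section Plane.
Context {R : realType}.
Variable F : seq (R * R).
Implicit Types (z : R * R) (s : bool).

Definition sg s : R := if s then 1 else -1.

(* [slit true] (resp. [slit false]) is the plane cut along the downward (resp.
   upward) closed vertical half-lines issued from the points of [F]. *)
Definition slit s z : bool :=
  all (fun p => (z.1 == p.1) ==> (0 < sg s * (z.2 - p.2))) F.

Lemma slitP s z :
  reflect (forall p, p \in F -> z.1 = p.1 -> 0 < sg s * (z.2 - p.2)) (slit s z).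
Proof.
apply: (iffP allP) => h p pF; have := h p pF.
  by move=> /implyP hp zp; apply: hp; rewrite zp.
by move=> hp; apply/implyP => /eqP.
Qed.

Lemma slit_notin s z : slit s z -> z \notin F.
Proof.
by move=> /slitP h; apply/negP => /h/(_ erefl); rewrite subrr mulr0 ltxx.
Qed.

Definition strip_index z : nat := count (< z.1) (map fst F).

Definition off_lines z : bool := z.1 \notin map fst F.

Lemma off_lines_slit s z : off_lines z -> slit s z.
Proof.
move=> zF; apply/slitP => p pF zp; case/negP: zF; rewrite zp.
by apply/mapP; exists p.
Qed.

Lemma slit_off_lines z s s' : s != s' -> slit s z -> slit s' z -> off_lines z.
Proof.
move=> ss /slitP h /slitP h'; apply/negP => /mapP[p pF zp].
have := h _ pF zp; have := h' _ pF zp; move: ss.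
by rewrite /sg; case: s {h}; case: s' {h'} => // _; lra.
Qed.

Lemma strip_index_eq z z' :
  (forall t, (z.1 <= t <= z'.1) || (z'.1 <= t <= z.1) -> t \notin map fst F) ->
  strip_index z = strip_index z'.
Proof.
move=> h; apply: eq_in_count => a aF /=.
have [az|za] := ltP a z.1; have [az'|za'] := ltP a z'.1 => //.
  by have := h a; rewrite aF za' (ltW az) orbT => /(_ isT).
by have := h a; rewrite aF za (ltW az') => /(_ isT).
Qed.

Lemma slit_open s z : slit s z -> exists2 r : R, 0 < r &
  forall z', `|z'.1 - z.1| < r -> `|z'.2 - z.2| < r -> slit s z'.
Proof.
rewrite /slit; elim: F => [|p G IH] /=; first by exists 1.
case/andP => hp /IH[r r0 hr].
suff [r' r'0 hr'] : exists2 r' : R, 0 < r' &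
    forall z', `|z'.1 - z.1| < r' -> `|z'.2 - z.2| < r' ->
      (z'.1 == p.1) ==> (0 < sg s * (z'.2 - p.2)).
  exists (Num.min r r'); first by rewrite lt_min r0.
  by move=> z'; rewrite !lt_min => /andP[? ?] /andP[? ?]; rewrite hr' // hr.
have [zp|zp] := eqVneq z.1 p.1.
  rewrite zp eqxx /= in hp; exists (sg s * (z.2 - p.2)) => // z' _ h2.
  apply/implyP => _; move: hp h2; rewrite ltr_norml /sg => hs /andP[h3 h4].
  by case: (s) hs h3 h4 => hs h3 h4; lra.
exists `|z.1 - p.1|; first by rewrite normr_gt0 subr_eq0.
move=> z' + _; rewrite distrC => h1; apply/implyP => /eqP z'p.
by move: h1; rewrite z'p ltxx.
Qed.

Variable s0 : bool.
Hypothesis F_lines : forall p q, p \in F -> q \in F -> p.1 = q.1 -> p = q.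

(** A point on the vertical line of a puncture lies above or below it, hence off one of the two
    cuts. With two punctures on one line, the points between them would lie on both cuts, whence
    [F_lines]. *)
Lemma slit_cover z s : z \notin F -> slit s z || slit (~~ s) z.
Proof.
move=> zF; have [|zl] := boolP (z.1 \in map fst F); last first.
  by rewrite off_lines_slit.
case/mapP => p pF zp.
have uniqp q : q \in F -> z.1 = q.1 -> q = p.
  by move=> qF zq; apply: F_lines => //; rewrite -zq.
have zp2 : z.2 - p.2 != 0.
  rewrite subr_eq0; apply: contraNN zF => /eqP zp2.
  by rewrite (_ : z = p) //; case: z p zp zp2 {pF uniqp} => ? ? [? ?] /= -> ->.
apply/orP; case: (ltrgt0P (sg s * (z.2 - p.2))) => h.
- by left; apply/slitP => q qF /(uniqp q qF) ->.
- right; apply/slitP => q qF /(uniqp q qF) ->.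
  by move: h; rewrite /sg; case: (s) => /=; lra.
- by move/eqP: h; rewrite mulf_eq0 (negPf zp2) orbF /sg; case: (s); rewrite ?oppr_eq0 oner_eq0.
Qed.

(* Vertices of the universal cover: a word [w] stands for a copy of the slit
   plane of sign [wsign w], glued to that of [act j w] along the [j]-th strip. *)
Definition wsign (w : seq nat) : bool := s0 (+) odd (size w).

Definition rep s z (w : seq nat) : seq nat :=
  if wsign w == s then w else act (strip_index z) w.

Lemma wsign_act j w : wsign (act j w) = ~~ wsign w.
Proof. by rewrite /wsign odd_act addbN. Qed.

Lemma wsign_rep s z w : wsign (rep s z w) = s.
Proof.
by rewrite /rep; case: eqP => // /eqP; rewrite wsign_act -addNb; case: wsign; case: s.
Qed.

Lemma reduced_rep s z w : reduced w -> reduced (rep s z w).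
Proof. by rewrite /rep; case: eqP => // _; exact: reduced_act. Qed.

Lemma rep_id s z w : wsign w = s -> rep s z w = w.
Proof. by rewrite /rep => ->; rewrite eqxx. Qed.

Lemma rep_rep s s' z w : reduced w -> rep s z (rep s' z w) = rep s z w.
Proof.
move=> rw; rewrite {2}/rep; case: eqP => // /eqP ws'.
have [ss'|ss'] := eqVneq s s'.
  rewrite rep_id; first by rewrite /rep ss' (negPf ws').
  by rewrite wsign_act ss'; case: wsign ws'; case: (s').
have ws : wsign w = s by move: ws' ss'; case: wsign; case: (s); case: (s').
rewrite [RHS]rep_id // /rep wsign_act ws; case: eqP => [|_]; last exact: actK.
by case: (s).
Qed.

Lemma rep_strip s z z' w : strip_index z = strip_index z' -> rep s z w = rep s z' w.
Proof. by rewrite /rep => ->. Qed.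

Definition letters (w : seq nat) := all (fun j => j <= size F)%N w.

Lemma letters_rep s z w : letters w -> letters (rep s z w).
Proof.
rewrite /rep; case: eqP => // _; apply: all_act.
by rewrite /strip_index -(size_map fst F) count_size.
Qed.

Lemma size_rep s z w : (size (rep s z w) <= (size w).+1)%N.
Proof. by rewrite /rep; case: eqP => _; [exact: leqnSn|exact: size_act]. Qed.

End Plane.

Lemma between_lt {R : realType} (a b c t r : R) : `|a - c| < r -> `|b - c| < r ->
  (a <= t <= b) || (b <= t <= a) -> `|t - c| < r.
Proof.
rewrite !ltr_norml => /andP[? ?] /andP[? ?].
by case/orP => /andP[? ?]; apply/andP; split; lra.
Qed.

(** * Lifting a cube to the universal cover *)

Section Labelling.
Context {R : realType}.
Variables (k : nat) (F : seq (R * R)) (z0 : R * R) (s0 : bool).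
Hypothesis k2 : (2 <= k)%N.
Hypothesis F_lines : forall p q, p \in F -> q \in F -> p.1 = q.1 -> p = q.
Hypothesis z0_slit : slit F s0 z0.
Local Notation X := (cube R k).
Local Notation plane := [set z : R * R | z \notin F].
Local Notation slit := (slit F).
Local Notation wsign := (wsign s0).

(* A lift of [f] to the universal cover, as an open cover of the cube indexed
   by the sheets of bounded length met by the lift. *)
Definition labelling (f : 'rV[R]_k -> R * R) (O : seq nat -> 'rV[R]_k -> Prop)
    (L : nat) : Prop :=
  [/\ forall x, X x -> exists w, O w x,
      forall w x, O w x -> [/\ X x, slit (wsign w) (f x), (size w <= L)%N & letters F w],
      forall w x, O w x -> exists2 d : R, 0 < d &
        forall y, X y -> `|x - y| < d -> O w y,
      forall w w' x, O w x -> O w' x -> w <> w' -> w' = act (strip_index F (f x)) w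
    & forall x, cube_boundary R k x -> O [::] x].

(** By compactness there is one radius [r] such that the box of radius [r] around each [f x] lies in
    a slit plane, of sign [sigma x]. A word is carried from [x] to a nearby [y] inside the sheet of
    that sign. The cocycle condition holds because charts of different signs overlap in one strip,
    over which [rep] does not vary. *)
Lemma labelling_exists (f : 'rV[R]_k -> R * R) : spheroid R plane z0 k f ->
  exists O L, labelling f O L.
Proof.
case=> cf fF fb.
have cf1 : {within X, continuous (fun x => (f x).1)}.
  exact: (cont_comp cf cont_fst).
have cf2 : {within X, continuous (fun x => (f x).2)}.
  exact: (cont_comp cf cont_snd).
have [r r0 hr] : exists2 r, 0 < r & forall x, X x -> exists s, forall z,
    `|z.1 - (f x).1| < r -> `|z.2 - (f x).2| < r -> slit s z.
  apply: lebesgue_number; first exact: cube_compact.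
  move=> x Xx; have [s [r r0 hr]] : exists s, exists2 r : R, 0 < r &
      forall z, `|z.1 - (f x).1| < r -> `|z.2 - (f x).2| < r -> slit s z.
    have /orP[h|h] := slit_cover F_lines true (fF _ Xx).
      by exists true; exact: slit_open.
    by exists false; exact: slit_open.
  have r20 : 0 < r / 2 by rewrite divr_gt0.
  have near1 (g : 'rV[R]_k -> R) : {within X, continuous g} ->
      exists2 d : R, 0 < d & forall y, X y -> `|x - y| < d -> `|g y - g x| < r / 2.
    move=> /withinP/(_ _ Xx (ball (g x) (r / 2)) (nbhsx_ballx _ _ r20)).
    move=> /nbhs_normP[d /= d0 hd]; exists d => // y Xy xy.
    by rewrite distrC; exact: hd.
  have [d1 d10 h1] := near1 _ cf1; have [d2 d20 h2] := near1 _ cf2.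
  exists (Num.min (r / 2) (Num.min d1 d2)); first by rewrite !lt_min r20 d10 d20.
  move=> e y e0; rewrite !lt_min => /andP[er _] /andP[_ /andP[xy1 xy2]] Xy.
  exists s => z zy1 zy2; apply: hr.
    rewrite (_ : z.1 - _ = (z.1 - (f y).1) + ((f y).1 - (f x).1)); last first.
      by rewrite addrA subrK.
    apply: le_lt_trans (ler_normD _ _) _; rewrite (splitr r); apply: ltrD; last exact: h1.
    exact: lt_trans er.
  rewrite (_ : z.2 - _ = (z.2 - (f y).2) + ((f y).2 - (f x).2)); last first.
    by rewrite addrA subrK.
  apply: le_lt_trans (ler_normD _ _) _; rewrite (splitr r); apply: ltrD; last exact: h2.
  exact: lt_trans er.
have {hr} [sigma hsigma] : exists sigma : 'rV[R]_k -> bool, forall x, X x -> forall z,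
    `|z.1 - (f x).1| < r -> `|z.2 - (f x).2| < r -> slit (sigma x) z.
  have /choice[sigma hs] : forall x, exists s, X x -> forall z,
      `|z.1 - (f x).1| < r -> `|z.2 - (f x).2| < r -> slit s z.
    move=> x; have [Xx|nXx] := pselect (X x); last by exists true.
    by have [s hs] := hr x Xx; exists s.
  by exists sigma.
have fcX : compact X by exact: cube_compact.
have [e1 e10 he1] := uniform_continuity fcX cf1 r0.
have [e2 e20 he2] := uniform_continuity fcX cf2 r0.
pose eta := Num.min e1 e2.
have eta0 : 0 < eta by rewrite lt_min e10.
have close x y : X x -> X y -> `|x - y| < eta ->
    `|(f y).1 - (f x).1| < r /\ `|(f y).2 - (f x).2| < r.
  move=> Xx Xy; rewrite lt_min => /andP[xy1 xy2].
  by rewrite distrC (distrC (f y).2) he1 // he2.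
(* Two charts of different signs overlap in a single strip. *)
have same x x' y y' : X x -> X x' -> X y -> X y' -> sigma x != sigma x' ->
    `|x - y| < eta -> `|x' - y| < eta -> `|x - y'| < eta -> `|x' - y'| < eta ->
    strip_index F (f y) = strip_index F (f y').
  move=> Xx Xx' Xy Xy' ss xy x'y xy' x'y'; apply: strip_index_eq => t ht.
  have [a1 a2] := close _ _ Xx Xy xy; have [b1 b2] := close _ _ Xx' Xy x'y.
  have [c1 c2] := close _ _ Xx Xy' xy'; have [d1 d2] := close _ _ Xx' Xy' x'y'.
  apply: (@slit_off_lines _ _ (t, (f y).2) _ _ ss).
    by apply: hsigma => //=; exact: between_lt a1 c1 ht.
  by apply: hsigma => //=; exact: between_lt b1 d1 ht.
(* A preferred sign for each point, equal to [s0] at [z0], so that the boundary can carry the empty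
   word. *)
pose canon z := if slit s0 z then s0 else ~~ s0.
have canonP x : X x -> slit (canon (f x)) (f x).
  move=> Xx; have := slit_cover F_lines s0 (fF _ Xx).
  by rewrite /canon; case: ifP.
pose over x w := [/\ reduced w, wsign w = canon (f x) & letters F w].
pose T x w y := rep F s0 (canon (f y)) (f y) (rep F s0 (sigma x) (f x) w).
have [||||||W [W0 oW WT]] := @transport_lift _ _ _ X over T eta eta0 _ _ _ 0 [::] fcX.
- move=> x y w Xx Xy xy [rw sw lw]; split.
  + by do 2! apply: reduced_rep.
  + exact: wsign_rep.
  + by do 2! apply: letters_rep.
- by move=> x w Xx [rw sw lw]; rewrite /T rep_rep // rep_id.
- move=> x x' x'' w Xx Xx' Xx'' xx' x'x'' xx'' [rw sw lw]; rewrite /T.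
  have rw' := reduced_rep F s0 (sigma x) (f x) rw.
  rewrite (rep_rep _ _ (sigma x')) //.
  have [ss|ss] := eqVneq (sigma x) (sigma x').
    by rewrite (rep_id _ (f x')) // wsign_rep.
  have n0 (y : 'rV[R]_k) : `|y - y| < eta by rewrite subrr normr0.
  rewrite !(rep_strip s0 _ _ (same x x' x' x'' _ _ _ _ _ _ _ _ _)) // 1?distrC //.
  by rewrite rep_rep.
- by move=> x t Xx t01; apply: cube_convex => //; exact: cube0.
- exact: cube0.
- split=> //; rewrite /canon fb ?z0_slit /wsign ?addbF //.
  by apply: cube_boundary0; exact: ltn_trans k2.
have n0 (y : 'rV[R]_k) : `|y - y| < eta by rewrite subrr normr0.
have eta20 : 0 < eta / 2 by rewrite divr_gt0.
(* Transport lengthens a word by at most 2, so the length of [W] is locally bounded; the inverse of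
   the scale in [lebesgue_number] serves as the bound. A sheet in [O] may be one letter longer,
   whence the successor below. *)
have [l l0 hl] : exists2 l : R, 0 < l & forall x, X x -> (size (W x))%:R <= l^-1.
  apply: lebesgue_number => // x Xx; have N0 : 0 < (size (W x)).+2%:R :> R by [].
  exists (Num.min (eta / 2) (size (W x)).+2%:R^-1); first by rewrite lt_min eta20 invr_gt0.
  move=> e y e0; rewrite !lt_min => /andP[_ eN] /andP[xy _] Xy.
  apply: (@le_trans _ _ (size (W x)).+2%:R); last first.
    by rewrite -[leLHS]invrK lef_pV2 ?posrE ?invr_gt0 // ltW.
  rewrite ler_nat (WT x) // /T.
  by apply: leq_trans (size_rep _ _ _ _ _) _; rewrite ltnS size_rep.
(* The lifted point is recorded in every sheet that contains it: one sheet, or the two glued along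
   its strip. *)
pose O w x := [/\ X x, slit (wsign w) (f x) & rep F s0 (wsign w) (f x) (W x) = w].
exists O, (Num.truncn l^-1).+1; split.
- move=> x Xx; have [rw sw lw] := oW x Xx; exists (W x); split=> //.
    by rewrite sw; exact: canonP.
  exact: rep_id.
- move=> w x [Xx sx wE]; have [rw sw lw] := oW x Xx; split=> //.
    rewrite -wE; apply: leq_trans (size_rep _ _ _ _ _) _.
    by rewrite ltnS -[leqLHS](@natrK R) le_truncn // hl.
  by rewrite -wE; exact: letters_rep.
- move=> w x [Xx sx wE]; have [rw sw lw] := oW x Xx.
  have [r' r'0 hr'] := slit_open sx.
  have [d1 d10 hd1] := uniform_continuity fcX cf1 r'0.
  have [d2 d20 hd2] := uniform_continuity fcX cf2 r'0.
  exists (Num.min (eta / 2) (Num.min d1 d2)); first by rewrite !lt_min eta20 d10.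
  move=> y Xy; rewrite !lt_min => /andP[xye /andP[xy1 xy2]].
  have xy : `|x - y| < eta by lra.
  have y1 := hd1 _ _ Xx Xy xy1; have y2 := hd2 _ _ Xx Xy xy2.
  rewrite distrC in y1; rewrite distrC in y2.
  have sy : slit (wsign w) (f y) by exact: hr'.
  split=> //; rewrite (WT x) // /T.
  have rw' := reduced_rep F s0 (sigma x) (f x) rw.
  rewrite rep_rep //.
  have [ss|ss] := eqVneq (sigma x) (wsign w).
    by rewrite -ss rep_id ?wsign_rep // ss wE.
  suff sE : strip_index F (f x) = strip_index F (f y).
    by rewrite -(rep_strip _ _ _ sE) rep_rep.
  have [a1 a2] := close _ _ Xx Xy xy.
  apply: strip_index_eq => t ht.
  apply: (@slit_off_lines _ _ (t, (f x).2) _ _ ss).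
    apply: hsigma => //=; last by rewrite subrr normr0.
    by apply: between_lt a1 ht; rewrite subrr normr0.
  apply: hr' => //=; last by rewrite subrr normr0.
  by apply: between_lt y1 ht; rewrite subrr normr0.
- move=> w w' x [Xx sx wE] [_ sx' w'E] ww'.
  have [rw sw lw] := oW x Xx.
  rewrite -w'E -(rep_rep _ _ _ (wsign w)) // wE /rep.
  case: eqP => // ss; exfalso; apply: ww'.
  by rewrite -wE -w'E ss.
- move=> x bx; have Xx := cube_boundary_sub bx.
  (* On the boundary [f] is constant, so transport leaves the empty word unchanged, and for [k >= 2]
     short steps within the boundary reach all of it from 0. *)
  have Wx : W x = [::].
    apply: (boundary_chain (P := fun x => W x = [::]) k2 eta20) bx => // a b ba bb ab Wa.
    rewrite (WT a b (cube_boundary_sub ba) (cube_boundary_sub bb) ab) Wa /T.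
    rewrite !fb // rep_rep // rep_id // /canon z0_slit.
    by rewrite /wsign addbF.
  by split; rewrite ?Wx // /wsign ?addbF ?fb // rep_id // /wsign addbF.
Qed.

End Labelling.

Lemma strip_exists {R : realType} (F : seq (R * R)) (j : nat) :
  uniq (map fst F) -> (j <= size F)%N ->
  exists m, m \notin map fst F /\ count (< m) (map fst F) = j.
Proof.
move=> uF jF; pose s := sort <=%R (map fst F).
have us : uniq s by rewrite sort_uniq.
have ss : sorted <%R s by rewrite lt_sorted_uniq_le us sort_sorted //; exact: le_total.
have [b bs] : exists b, path <%R b s.
  by case: (s) ss => [_|a s' /= ?]; [exists 0|exists (a - 1); rewrite /= ltrBlDr ltrDl ltr01].
have [|m [_ ms mj]] := gap bs (j := j); first by rewrite size_sort size_map.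
exists m; split; first by move: ms; rewrite mem_sort.
by rewrite -mj; apply/seq.permP; rewrite perm_sym perm_sort.
Qed.

Lemma count_sub_eq {T : eqType} (s : seq T) (a b : pred T) :
  subpred a b -> count a s = count b s -> {in s, a =1 b}.
Proof.
move=> ab; elim: s => //= x s IH.
have le : (count a s <= count b s)%N by exact: sub_count.
case ax: (a x); case bx: (b x) => /=; rewrite ?add1n ?add0n => h.
- by case: h => /IH e y; rewrite in_cons => /predU1P[->|/e //]; rewrite ax bx.
- by have := ab _ ax; rewrite bx.
- by move: le; rewrite h ltnn.
- by move=> y; rewrite in_cons => /predU1P[->|/(IH h) //]; rewrite ax bx.
Qed.

Lemma seq_bound {R : realType} {T : eqType} (s : seq T) (g : T -> R) :
  exists2 c, 0 <= c & forall p, p \in s -> g p <= c.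
Proof.
elim: s => [|p s [c c0 IH]]; first by exists 0.
exists (Num.max c (g p)) => [|q]; first by rewrite le_max c0.
by rewrite in_cons le_max => /predU1P[->|/IH ->]; rewrite ?lexx ?orbT.
Qed.

(** * Vacating the outermost sheets and contracting in a slit plane *)

Section Pruning.
Context {R : realType}.
Variables (k : nat) (F : seq (R * R)) (z0 : R * R) (s0 : bool).
Hypothesis k2 : (2 <= k)%N.
Hypothesis F_uniq : uniq (map fst F).
Hypothesis z0_slit : slit F s0 z0.
Local Notation X := (cube R k).
Local Notation plane := [set z : R * R | z \notin F].

(** Clocks of a two-phase motion: [t1] runs during the first half of the time and [t2] during the
    second, so the second motion has not begun before time [1 / 2]. *)
Let t1 (t : R) := Num.min 1 (2 * t).
Let t2 (t : R) := Num.max 0 (2 * t - 1).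

Let t_lo (t : R) : 0 <= t -> t <= 1 / 2 -> t1 t = 2 * t /\ t2 t = 0.
Proof.
by move=> h0 h; rewrite /t1 /t2; case: (lerP 1 (2 * t)) => ?; case: (lerP 0 (2 * t - 1)) => ?; lra.
Qed.

Let t_hi (t : R) : 1 / 2 <= t -> t1 t = 1 /\ t2 t = 2 * t - 1.
Proof.
by move=> h; rewrite /t1 /t2; case: (lerP 1 (2 * t)) => ?; case: (lerP 0 (2 * t - 1)) => ?; lra.
Qed.

Let cont_t1 {U : topologicalType} (f : U -> R) : continuous f -> continuous (fun x => t1 (f x)).
Proof.
by move=> cf; apply: cont_min; [exact: cont_cst|apply: cont_mul => //; exact: cont_cst].
Qed.

Let cont_t2 {U : topologicalType} (f : U -> R) : continuous f -> continuous (fun x => t2 (f x)).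
Proof.
move=> cf; apply: cont_max; first exact: cont_cst.
apply: cont_add; last exact: cont_cst.
by apply: cont_mul => //; exact: cont_cst.
Qed.

(* Within [slit s]: first move vertically by [K], away from the half-lines,
   then horizontally to the abscissa [m]. *)
Let deform s (m K t : R) (z : R * R) : R * R :=
  (z.1 + t2 t * (m - z.1), z.2 + sg s * (K * t1 t)).

(** With heights bounded by [M], a vertical move by [2 * M + 1] ends at distance at least 1 beyond
    every puncture, on the uncut side; any horizontal motion is then harmless. *)
Let deform_slit s (m M t : R) (z : R * R) :
  (forall p, p \in F -> `|p.2| <= M) -> `|z.2| <= M -> 0 <= t ->
  slit F s z -> slit F s (deform s m (2 * M + 1) t z).
Proof.
move=> FM zM h0 /slitP sz; apply/slitP => p pF; rewrite /deform /=.
have := FM p pF; move: zM; rewrite !ler_norml => /andP[a1 a2] /andP[a3 a4].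
have [h|h] := lerP t (1 / 2).
  have [-> ->] := t_lo h0 h; rewrite mul0r addr0 => /(sz p pF).
  by rewrite /sg; case: (s); nra.
have [-> _ _] := t_hi (ltW h); rewrite mulr1 /sg; case: (s); lra.
Qed.

Let strip_between (m t : R) (z w : R * R) :
  0 <= t <= 1 -> off_lines F z -> m \notin map fst F ->
  count (< m) (map fst F) = strip_index F z -> w.1 = z.1 + t * (m - z.1) ->
  off_lines F w /\ strip_index F w = strip_index F z.
Proof.
move=> /andP[h0 h1] zF mF mz' wE.
have sep q : q \in map fst F -> (q < m) = (q < z.1).
  have [mz|zm] := lerP m z.1 => qF.
    by apply: (count_sub_eq _ mz' qF) => x /=; move/lt_le_trans; apply.
  by apply/esym; apply: (count_sub_eq _ (esym mz') qF) => x /= /lt_trans; apply.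
have zne q : q \in map fst F -> q != z.1 by move=> qF; apply: contraNneq zF => <-.
have mne q : q \in map fst F -> q != m by move=> qF; apply: contraNneq mF => <-.
have conv (a b : R) : 0 < a -> 0 < b -> 0 < (1 - t) * a + t * b.
  move=> a0 b0; case: (ltrP 0 t) => t0.
    by apply: ltr_wpDl; [apply: mulr_ge0; [lra|exact: ltW]|exact: mulr_gt0].
  have -> : t = 0 by apply/eqP; rewrite eq_le t0 h0.
  by rewrite subr0 mul1r mul0r addr0.
have wz q : q \in map fst F -> (q < w.1) = (q < z.1) /\ q != w.1.
  move=> qF; have := sep q qF; have := zne q qF; have := mne q qF.
  rewrite wE; case: (ltrgtP q m) => // qm _; case: (ltrgtP q z.1) => // qz _ _.
    have qw : q < z.1 + t * (m - z.1).
      have := conv (z.1 - q) (m - q); rewrite !subr_gt0 => /(_ qz qm); lra.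
    by rewrite qw lt_eqF.
  have qw : z.1 + t * (m - z.1) < q.
    have := conv (q - z.1) (q - m); rewrite !subr_gt0 => /(_ qz qm); lra.
  by rewrite ltNge (ltW qw) gt_eqF.
split.
  by apply/negP => /wz[_]; rewrite eqxx.
by apply: eq_in_count => q qF /=; have [->] := wz q qF.
Qed.

Lemma prune (f : 'rV[R]_k -> R * R) O L : spheroid R plane z0 k f ->
  labelling F s0 f O L.+1 ->
  exists f' O', homotopic_rel R plane z0 f f' /\ labelling F s0 f' O' L.
Proof.
case=> cf fF fb [Ocov Oinf Oop Oadj Obd].
have cX : compact X by exact: cube_compact.
have clX : closed X by apply: compact_closed; [exact: norm_hausdorff|].
(* Distinct words at one point differ by one [act], so their lengths have opposite parity. *)
have Suniq w w' x : O w x -> O w' x -> size w = L.+1 -> size w' = L.+1 -> w = w'.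
  move=> Ow Ow' sw sw'; have [//|/eqP ww'] := eqVneq w w'.
  have := odd_act (strip_index F (f x)) w.
  by rewrite -(Oadj _ _ _ Ow Ow' ww') sw sw'; case: odd.
have Spar w v x : O w x -> size w = L.+1 -> O v x -> (size v <= L)%N ->
    w = strip_index F (f x) :: v /\ off_lines F (f x).
  move=> Ow sw Ov sv; have vw : v <> w by move=> vw; rewrite vw sw ltnn in sv.
  have wE := Oadj _ _ _ Ov Ow vw.
  have [_ slw _ _] := Oinf _ _ Ow; have [_ slv _ _] := Oinf _ _ Ov.
  split; first by rewrite wE; apply: act_longer; rewrite -wE sw.
  apply: slit_off_lines slv slw.
  by rewrite wE wsign_act; case: wsign.
pose S x := exists w, size w = L.+1 /\ O w x.
have /choice[lab hlab] : forall x, exists w, S x -> size w = L.+1 /\ O w x.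
  move=> x; have [[w hw]|nS] := pselect (S x); first by exists w.
  by exists [::].
have /choice[mid hmid] : forall j, exists m, (j <= size F)%N ->
    m \notin map fst F /\ count (< m) (map fst F) = j.
  move=> j; have [jF|jF] := leqP j (size F); last by exists 0.
  by have [m hm] := strip_exists F_uniq jF; exists m.
pose mx x := if `[<S x>] then mid (head 0%N (lab x)) else (f x).1.
pose si := s0 (+) odd L.+1.
have si_lab x : S x -> wsign s0 (lab x) = si.
  by move=> /hlab[sw _]; rewrite /wsign sw.
have cf1 : {within X, continuous (fun x => (f x).1)} by exact: (cont_comp cf cont_fst).
have cf2 : {within X, continuous (fun x => (f x).2)} by exact: (cont_comp cf cont_snd).
have [M fM FM] : exists2 M : R, (forall x, X x -> `|(f x).2| <= M) &
    forall p, p \in F -> `|p.2| <= M.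
  have [c c0 hc] := seq_bound F (fun p => `|p.2|).
  have [M [_ hM]] := compact_bounded (continuous_compact cf2 cX).
  exists (Num.max c (M + 1)) => [x Xx|p /hc]; rewrite le_max; last by move=> ->.
  by apply/orP; right; apply: hM; [rewrite ltrDl|exists x].
pose K := 2 * M + 1.
(* [C] collects the points lying in maximal sheets only, where the push must be complete; on [B] it
   must not start. They are disjoint because boundary points carry the empty word. *)
pose C : set 'rV[R]_k := X `&` [set x | forall w, O w x -> size w = L.+1].
pose B : set 'rV[R]_k := X `&` [set x | cube_boundary R k x \/ ~ S x].
have clC : closed C.
  rewrite -openC openE => x /= nCx.
  have [Xx|nXx] := pselect (X x); last first.
    have : nbhs x (~` X) by apply: open_nbhs_nbhs; split => //; exact: closed_openC.
    by apply: filterS => y nXy [].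
  have [w [Ow sw]] : exists w, O w x /\ size w <> L.+1.
    apply: contrapT => h; apply: nCx; split=> // w Ow.
    by apply: contrapT => sw; apply: h; exists w.
  have [d d0 hd] := Oop _ _ Ow.
  apply: (near_norm d0) => y xy [Xy hy]; apply: sw.
  by apply: hy; apply: hd.
have clB : closed B.
  rewrite -openC openE => x /= nBx.
  have [Xx|nXx] := pselect (X x); last first.
    have : nbhs x (~` X) by apply: open_nbhs_nbhs; split => //; exact: closed_openC.
    by apply: filterS => y nXy [].
  have nbx : ~ cube_boundary R k x by move=> bx; apply: nBx; split=> //; left.
  have Sx : S x by apply: contrapT => nS; apply: nBx; split=> //; right.
  have [sw Ow] := hlab x Sx; have [d d0 hd] := Oop _ _ Ow.
  have h1 : nbhs x (~` (cube_boundary R k)).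
    by apply: open_nbhs_nbhs; split => //; apply: closed_openC; exact: cube_boundary_closed.
  have h2 : nbhs x (fun y => X y -> O (lab x) y).
    by apply: (near_norm d0) => y xy Xy; apply: hd.
  apply: filterS2 h1 h2 => y nby Oy [Xy [//|]]; apply.
  by exists (lab x); split=> //; exact: Oy.
have BC : B `&` C = set0.
  apply/seteqP; split=> // x [[Xx hB] [_ hC]]; case: hB => [/Obd/hC //|].
  by apply; have [w Ow] := Ocov _ Xx; exists w; split=> //; exact: hC.
have /(@uniform_separatorP _ R)[phi [cphi phi01 phiB phiC]] :=
  @normal_uniform_separator _ (@pseudometric_normal R 'rV[R]_k) B C clB clC BC.
have {}phi01 x : 0 <= phi x <= 1.
  by have := phi01 (phi x); rewrite /= in_itv /=; apply; exists x.
have {}phiB x : X x -> cube_boundary R k x \/ ~ S x -> phi x = 0.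
  by move=> Xx Bx; apply: phiB; exists x.
have {}phiC x : C x -> phi x = 1 by move=> Cx; apply: phiC; exists x.
pose H p := deform si (mx p.2) K (p.1 * phi p.2) (f p.2).
have t1_0 : t1 0 = 0 by have [|-> _] := @t_lo 0 (lexx _); rewrite ?mulr0 // divr_ge0.
have t2_0 : t2 0 = 0 by have [|_ ->] := @t_lo 0 (lexx _); rewrite // divr_ge0.
have H0 t x : t * phi x = 0 -> H (t, x) = f x.
  move=> h; rewrite /H /deform /= h t1_0 t2_0 mul0r !mulr0 !addr0.
  by case: (f x).
have tphi t x : 0 <= t <= 1 -> 0 <= t * phi x <= 1.
  move=> /andP[h0 h1]; have /andP[p0 p1] := phi01 x.
  by rewrite mulr_ge0 //= mulr_ile1.
have ctp : continuous (fun p : R * 'rV[R]_k => p.1 * phi p.2).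
  by apply: cont_mul; [exact: cont_fst|exact: (cont_comp cont_snd cphi)].
have csnd (g : 'rV[R]_k -> R) : {within X, continuous g} ->
    {within @cylinder R k, continuous (fun p => g p.2)}.
  move=> cg; apply: (within_comp (within_cont cont_snd) _ cg).
  by move=> [t x] /cylinderP[].
have cH2 : {within @cylinder R k, continuous (fun p => (H p).2)}.
  apply: (cont_add (csnd _ cf2)); apply: within_cont.
  apply: cont_mul; first exact: cont_cst.
  by apply: cont_mul; [exact: cont_cst|exact: cont_t1].
have cH1 : {within @cylinder R k, continuous (fun p => (H p).1)}.
  apply: within_local => -[t0 x0] /cylinderP[t01 Xx0].
  have [Sx0|nS] := pselect (S x0).
    have [sw Ow] := hlab x0 Sx0; have [d d0 hd] := Oop _ _ Ow.
    exists (fun p => (f p.2).1 + t2 (p.1 * phi p.2) * (mid (head 0%N (lab x0)) - (f p.2).1)).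
    split.
      apply: (cont_add (csnd _ cf1)); apply: cont_mul.
        by apply: within_cont; exact: cont_t2.
      apply: cont_add; last exact: (cont_opp (csnd _ cf1)).
      by apply: within_cont; exact: cont_cst.
    have : nbhs x0 (fun x => X x -> O (lab x0) x).
      by apply: (near_norm d0) => y xy Xy; apply: hd.
    move=> /(near_snd t0).
    apply: filterS => -[t x] /= Ox /cylinderP[_ Xx].
    have Sx : S x by exists (lab x0); split=> //; exact: Ox.
    have [swx Owx] := hlab x Sx.
    by rewrite /mx asboolT // (Suniq _ _ _ Owx (Ox Xx)).
  (* [mx] may jump where [S] ends, but near a point outside [S] the cut-off is below [1 / 2]: only
     the vertical phase has run and the abscissa is still that of [f]. *)
  exists (fun p => (f p.2).1); split; first exact: (csnd _ cf1).
  have hN : nbhs (phi x0) [set y | y < 1 / 2].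
    apply: open_nbhs_nbhs; split; first exact: open_lt.
    by rewrite /= phiB //; right.
  have : nbhs x0 (fun x => phi x < 1 / 2) := cphi x0 _ hN.
  move=> /(near_snd t0).
  apply: filterS => -[t x] /= hx /cylinderP[/andP[ht0 ht1] Xx].
  have /andP[p0 p1] := phi01 x.
  have [|_ ->] := @t_lo (t * phi x) (mulr_ge0 ht0 p0); last by rewrite mul0r addr0.
  by apply: le_trans (ltW hx); exact: ler_piMl.
have cH : {within @cylinder R k, continuous H}.
  apply: (within_eq (f := fun p => ((H p).1, (H p).2))); last exact: cont_pair.
  by move=> p _; case: (H p).
pose f' x := H (1, x).
have f'E x : ~ S x -> X x -> f' x = f x.
  by move=> nS Xx; apply: H0; rewrite phiB ?mulr0 //; right.
have f'S x w : O w x -> size w = L.+1 ->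
    off_lines F (f' x) /\ strip_index F (f' x) = head 0%N w.
  move=> Ow sw; have Sx : S x by exists w.
  have [swl Owl] := hlab x Sx; have lw := Suniq _ _ _ Owl Ow swl sw.
  have mE : mx x = mid (head 0%N w) by rewrite /mx asboolT // lw.
  have [Xx slw _ lett] := Oinf _ _ Ow.
  have [mF mj] : mid (head 0%N w) \notin map fst F /\
      count (< mid (head 0%N w)) (map fst F) = head 0%N w.
    by apply: hmid; move: lett sw; case: (w) => //= j v /andP[].
  (* On [C] the push is complete and ends at the abscissa [mid]. Elsewhere in [S] a shorter sheet is
     met as well, so the point is already in the right strip, and horizontal motion towards [mid]
     keeps it there however far it goes. *)
  have [Cx|nCx] := pselect (C x).
    rewrite /f' /H /= phiC // mul1r /off_lines /strip_index /deform /=.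
    have [_ ->] : t1 1 = 1 /\ t2 1 = 2 * 1 - 1 by apply: t_hi; lra.
    rewrite mE (_ : 2 * 1 - 1 = 1 :> R); last by ring.
    by rewrite mul1r addrC subrK.
  have [v [Ov sv]] : exists v, O v x /\ (size v <= L)%N.
    apply: contrapT => h; apply: nCx; split=> // v Ov; apply: contrapT => sv.
    apply: h; exists v; split=> //; have [_ _ + _] := Oinf _ _ Ov.
    by rewrite leq_eqVlt ltnS => /orP[/eqP|].
  have [wE off] := Spar _ _ _ Ow sw Ov sv.
  have t201 : 0 <= t2 (1 * phi x) <= 1.
    have /andP[h0 h1] := tphi 1 x (ltac:(by rewrite ler01 lexx)).
    have [h|h] := lerP (1 * phi x) (1 / 2); first by have [_ ->] := t_lo h0 h; rewrite lexx ler01.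
    by have [_ ->] := t_hi (ltW h); apply/andP; split; lra.
  have sE : count (< mid (head 0%N w)) (map fst F) = strip_index F (f x).
    by rewrite mj wE.
  have [//|? ->] := strip_between (w := f' x) t201 off mF sE.
    by rewrite /f' /H /deform /= mE.
  by rewrite wE.
(* A maximal word [j :: v] is replaced by [v]. Where it labelled the cube, [f'] now lies off the
   lines, hence in the slit planes of both signs. *)
exists f', (fun v x => (size v <= L)%N /\ (O v x \/ exists j, size v = L /\ O (j :: v) x)).
split.
  exists H; split.
  - exact: cH.
  - move=> t x t01 Xx; have [Sx|nS] := pselect (S x); last first.
      by rewrite H0 ?phiB ?mulr0 //; [exact: fF|right].
    have [_ Ow] := hlab x Sx; have [_ sl _ _] := Oinf _ _ Ow.
    apply: (@slit_notin _ _ si); apply: deform_slit => //; first exact: fM.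
      by have /andP[] := tphi t x t01.
    by rewrite -(si_lab x Sx).
  - by move=> x Xx; rewrite H0 // mul0r.
  - by [].
  - move=> t x t01 bx; rewrite H0 ?fb // phiB ?mulr0 //; last by left.
    exact: cube_boundary_sub.
split.
- move=> x Xx; have [w Ow] := Ocov x Xx; have [_ _ sw _] := Oinf _ _ Ow.
  move: sw; rewrite leq_eqVlt ltnS => /orP[/eqP sw|sw].
    case: w Ow sw => // j v Ow [sv]; exists v; rewrite sv; split=> //.
    by right; exists j.
  by exists w; split=> //; left.
- move=> v x [sv Ov].
  have [Xx lv] : X x /\ letters F v.
    by case: Ov => [/Oinf[]|[j [_ /Oinf[? _ _]]]] //= /andP[].
  split=> //; have [Sx|nS] := pselect (S x).
    have [sw Ow] := hlab x Sx; have [off _] := f'S _ _ Ow sw.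
    exact: off_lines_slit.
  rewrite f'E //; case: Ov => [/Oinf[]//|[j [sv' Ow]]].
  by case: nS; exists (j :: v); rewrite /= sv'.
- move=> v x [sv [Ov|[j [sv' Ow]]]].
    by have [d d0 hd] := Oop _ _ Ov; exists d => // y Xy xy; split=> //; left; apply: hd.
  have [d d0 hd] := Oop _ _ Ow; exists d => // y Xy xy; split=> //; right.
  by exists j; split=> //; apply: hd.
- have inS v x w : O w x -> size w = L.+1 -> (size v <= L)%N ->
      (O v x \/ exists j, size v = L /\ O (j :: v) x) -> v = behead w.
    move=> Ow sw sv [Ov|[j [sv' Ov]]]; first by have [-> _] := Spar _ _ _ Ow sw Ov sv.
    by rewrite (Suniq _ _ _ Ow Ov) //= sv'.
  move=> v v' x [sv Ov] [sv' Ov'] vv'.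
  have [[w [sw Ow]]|nS] := pselect (S x).
    by case: vv'; rewrite (inS v x w) // (inS v' x w).
  have nO u : (O u x \/ exists j, size u = L /\ O (j :: u) x) -> O u x.
    by case=> // -[j [su Ou]]; case: nS; exists (j :: u); rewrite /= su.
  have [Xx _ _ _] := Oinf _ _ (nO _ Ov).
  by rewrite f'E //; apply: Oadj => //; exact: nO.
- by move=> x bx; split=> //; left; exact: Obd.
Qed.

(* Lift [f] away from the half-lines by a large multiple of its distance to
   [z0], so that the straight-line homotopy to [z0] stays in the slit plane. *)
Lemma slit_contract (f : 'rV[R]_k -> R * R) : spheroid R plane z0 k f ->
  (forall x, X x -> slit F s0 (f x)) -> homotopic_rel R plane z0 f (fun=> z0).
Proof.
case=> cf fF fb fs.
(* [c] bounds the slopes, in modulus, of the lines from [z0] to the punctures. On the vertical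
   through [z0] the quotient is 0 by convention; those punctures are handled by [z0_slit]. *)
have [c c0 hc] := seq_bound F (fun p => `|z0.2 - p.2| / `|p.1 - z0.1|).
have cfst : {within @cylinder R k, continuous (fun p => (f p.2).1)}.
  apply: (within_comp (within_cont cont_snd) _ (cont_comp cf cont_fst)).
  by move=> [t x] /cylinderP[].
have csnd : {within @cylinder R k, continuous (fun p => (f p.2).2)}.
  apply: (within_comp (within_cont cont_snd) _ (cont_comp cf cont_snd)).
  by move=> [t x] /cylinderP[].
pose d z : R := `|z.1 - z0.1| + `|z.2 - z0.2|.
pose h z : R := sg s0 * ((c + 2) * d z).
exists (fun p => ((f p.2).1 - t2 p.1 * ((f p.2).1 - z0.1),
  (f p.2).2 + h (f p.2) * t1 p.1 - t2 p.1 * ((f p.2).2 - z0.2 + h (f p.2)))).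
have t1_0 : t1 0 = 0 by have [|-> _] := @t_lo 0 (lexx _); rewrite ?mulr0 // divr_ge0.
have t2_0 : t2 0 = 0 by have [|_ ->] := @t_lo 0 (lexx _); rewrite // divr_ge0.
have [t1_1 t2_1] : t1 1 = 1 /\ t2 1 = 1.
  by have [|-> ->] := @t_hi 1; [lra|split => //; ring].
split.
- have ct1 : {within @cylinder R k, continuous (fun p => t1 p.1)}.
    by apply: within_cont; apply: cont_t1; exact: cont_fst.
  have ct2 : {within @cylinder R k, continuous (fun p => t2 p.1)}.
    by apply: within_cont; apply: cont_t2; exact: cont_fst.
  have cst (a : R) : {within @cylinder R k, continuous (fun=> a)}.
    by apply: within_cont; exact: cont_cst.
  have c1 := cont_add cfst (cst (- z0.1)).
  have c2 := cont_add csnd (cst (- z0.2)).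
  have ch := cont_mul (cst (sg s0)) (cont_mul (cst (c + 2))
    (cont_add (cont_norm c1) (cont_norm c2))).
  apply: cont_pair.
    exact: (cont_add cfst (cont_opp (cont_mul ct2 c1))).
  apply: (cont_add (cont_add csnd (cont_mul ch ct1))).
  exact: (cont_opp (cont_mul ct2 (cont_add c2 ch))).
- move=> t x /andP[h0 h1] Xx /=; apply: (@slit_notin _ _ s0); apply/slitP => p pF /=.
  have sgsg : sg s0 * sg s0 = 1 :> R by rewrite /sg; case: (s0); ring.
  have d0 : 0 <= (c + 2) * d (f x).
    by apply: mulr_ge0; [lra|apply: addr_ge0; exact: normr_ge0].
  have [ht|ht] := lerP t (1 / 2).
    have [-> ->] := t_lo h0 ht; rewrite !mul0r !subr0 => fp.
    have := elimT (slitP _ _ _) (fs x Xx) p pF fp.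
    rewrite /h -mulrA; set e := _ * d _ in d0 *.
    have e0 : 0 <= e * (2 * t) by apply: mulr_ge0 => //; lra.
    rewrite (_ : sg s0 * ((f x).2 + sg s0 * (e * (2 * t)) - p.2) =
      sg s0 * ((f x).2 - p.2) + (sg s0 * sg s0) * (e * (2 * t))); last by ring.
    by rewrite sgsg; lra.
  have [-> ->] := t_hi (ltW ht); rewrite mulr1.
  set u := 2 * t - 1; have u1 : 0 <= 1 - u by rewrite /u; lra.
  set a := (f x).1 - z0.1; set b := (f x).2 - z0.2 => pE.
  have {}pE : p.1 - z0.1 = (1 - u) * a by rewrite -pE /a; ring.
  rewrite (_ : sg s0 * _ = sg s0 * (z0.2 - p.2) +
     (1 - u) * (sg s0 * b + (sg s0 * sg s0) * ((c + 2) * d (f x)))); last first.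
    by rewrite /h /b; ring.
  rewrite sgsg mul1r.
  have sb : - `|b| <= sg s0 * b.
    by rewrite /sg; case: (s0); rewrite ?mul1r ?mulN1r ?lerN2 ?ler_norm // lerNl -normrN ler_norm.
  have dab : d (f x) = `|a| + `|b| by [].
  have b0 := normr_ge0 b; have a0 := normr_ge0 a.
  (* In the factor [c + 2] one unit absorbs the vertical offset [b]; the remaining slope [c + 1]
     beats [c] strictly, so the segment to [z0] clears each puncture. *)
  have hq : (c + 1) * `|a| <= sg s0 * b + (c + 2) * d (f x).
    rewrite dab; have : 0 <= c * `|b| by exact: mulr_ge0.
    by lra.
  have hq' := ler_wpM2l u1 hq.
  have [pz|pz] := eqVneq z0.1 p.1.
    have := elimT (slitP _ _ _) z0_slit p pF pz.
    have : 0 <= (1 - u) * ((c + 1) * `|a|) by apply: mulr_ge0 => //; apply: mulr_ge0 => //; lra.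
    lra.
  have pz0 : 0 < `|p.1 - z0.1| by rewrite normr_gt0 subr_eq0 eq_sym.
  have := hc p pF; rewrite ler_pdivrMr // => hp.
  have pEn : `|p.1 - z0.1| = (1 - u) * `|a| by rewrite pE normrM ger0_norm.
  have s2 : - `|z0.2 - p.2| <= sg s0 * (z0.2 - p.2).
    by rewrite /sg; case: (s0); rewrite ?mul1r ?mulN1r ?lerN2 ?ler_norm // lerNl -normrN ler_norm.
  have : (1 - u) * ((c + 1) * `|a|) = c * `|p.1 - z0.1| + `|p.1 - z0.1| by rewrite pEn; ring.
  lra.
- by move=> x Xx; rewrite t1_0 t2_0 mulr0 !mul0r !subr0 addr0; case: (f x).
- move=> x Xx; rewrite t1_1 t2_1 !mul1r mulr1.
  rewrite (surjective_pairing z0) /=; congr pair; ring.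
- move=> t x t01 bx; rewrite fb // /h /d !subrr normr0 addr0 !mulr0 !mul0r !subr0 !addr0 mulr0 subr0.
  by case: (z0).
Qed.

Lemma labelling_null L (f : 'rV[R]_k -> R * R) O : spheroid R plane z0 k f ->
  labelling F s0 f O L -> homotopic_rel R plane z0 f (fun=> z0).
Proof.
elim: L f O => [|L IH] f O sf lf.
  apply: slit_contract => // x Xx; case: lf => Ocov Oinf _ _ _.
  have [w Ow] := Ocov x Xx; have [_ sl + _] := Oinf _ _ Ow.
  by rewrite leqn0 => /eqP/size0nil w0; move: sl; rewrite w0 /wsign addbF.
have [f' [Q [hf lf']]] := prune sf lf.
exact: homotopic_trans hf (IH _ _ (homotopic_spheroid hf) lf').
Qed.

End Pruning.

Theorem plane_aspherical {R : realType} (F : seq (R * R)) :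
  uniq (map fst F) -> aspherical R [set z : R * R | z \notin F].
Proof.
move=> uF k z0 f k2 sf.
have F_lines p q : p \in F -> q \in F -> p.1 = q.1 -> p = q.
  move=> pF qF pq; have [i iF iE] : exists2 i, (i < size F)%N & nth p F i = p.
    by exists (index p F); rewrite ?index_mem ?nth_index.
  have [j jF jE] : exists2 j, (j < size F)%N & nth p F j = q.
    by exists (index q F); rewrite ?index_mem ?nth_index.
  suff -> : q = p by [].
  rewrite -iE -jE; congr (nth _ _ _); apply/eqP.
  rewrite -(nth_uniq p.1 _ _ uF) ?size_map //.
  by rewrite !(nth_map p) // iE jE pq.
have z0F : z0 \notin F by exact: (spheroid_base (ltn_trans _ k2) sf).
have [s0 hs] : exists s, slit F s z0.
  by have /orP[] := slit_cover F_lines true z0F; [exists true|exists false].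
have [labels [L lf]] := labelling_exists k2 F_lines hs sf.
exact: (labelling_null uF hs sf lf).
Qed.

(** * Punctured planes with fixed and with moving punctures *)

(** A shear makes the abscissae of the punctures distinct. [bad (z, w)] is the shear factor that
    puts [z] and [w] on one vertical line, and [c + 1] exceeds all of these. *)
Theorem finite_complement_aspherical {R : realType} (F : seq R[i]) :
  aspherical R [set z : R[i] | z \notin F].
Proof.
pose bad (zw : R[i] * R[i]) : R :=
  (complex.Re zw.1 - complex.Re zw.2) / (complex.Im zw.2 - complex.Im zw.1).
have [c c0 hc] := seq_bound [seq (z, w) | z <- F, w <- F] bad.
pose l (z : R[i]) : R := complex.Re z + (c + 1) * complex.Im z.
have linj z w : z \in F -> w \in F -> l z = l w -> z = w.
  move=> zF wF; have : bad (z, w) <= c by apply: hc; apply: allpairs_f.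
  rewrite /bad /l; case: z w {zF wF} => [a b] [a' b'] /=.
  have [->|bb] := eqVneq b b'; first by move=> _ /addIr ->.
  have b0 : b' - b != 0 by rewrite subr_eq0 eq_sym.
  move=> h e; have : (a - a') / (b' - b) = c + 1.
    by apply: (canLR (mulfK b0)); rewrite mulrBr; lra.
  by move=> h'; move: h; rewrite h' gerDl ler10.
pose h (z : R[i]) : R * R := (l z, complex.Im z).
pose g (p : R * R) : R[i] := ((p.1 - (c + 1) * p.2) +i* p.2)%C.
have gh z : g (h z) = z.
  by case: z => a b; rewrite /g /h /l /= addrK.
pose F' := map h (undup F).
have uF' : uniq (map fst F').
  rewrite -map_comp map_inj_in_uniq ?undup_uniq // => z w.
  by rewrite !mem_undup; exact: linj.
have hinj : injective h by exact: can_inj gh.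
have hF' z : (h z \in F') = (z \in F) by rewrite mem_map // mem_undup.
have ch : continuous h.
  apply: cont_pair; last exact: Im_continuous.
  apply: cont_add; first exact: Re_continuous.
  by apply: cont_mul; [exact: cont_cst|exact: Im_continuous].
have cg : continuous g.
  apply: cont_complex; last exact: cont_snd.
  apply: cont_add; first exact: cont_fst.
  by apply: cont_opp; apply: cont_mul; [exact: cont_cst|exact: cont_snd].
move=> k z0 f k2 sf.
have sh := spheroid_map (B := [set z | z \notin F']) (within_cont ch) _ sf.
have {}sh : spheroid R [set z | z \notin F'] (h z0) k (fun t => h (f t)).
  by apply: sh => a /=; rewrite hF'.
have hh := plane_aspherical uF' k2 sh.
have hg p : h (g p) = p by case: p => a b; rewrite /g /h /l /= subrK.
have gF p : p \notin F' -> g p \notin F by rewrite -hF' hg.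
have := homotopic_map (B := [set z : R[i] | z \notin F]) (within_cont cg) gF hh.
rewrite gh.
by apply: (homotopic_eq (f := fun t => g (h (f t))) (g := fun=> z0)) => t _ //; rewrite gh.
Qed.

Section MovingPoints.
Context {R : realType} {n : nat}.
Local Notation C := R[i].

Definition bump (r : R) (a w : C) : R := Num.max 0 (1 - cabs (w - a) / r).

(** Identity plus displacements weighted by tent functions of radius [r]. If the points [a i] are at
    least [r] apart, each tent vanishes at the other points, so [a i] goes to [b i]. *)
Definition drag (r : R) (a b : 'I_n -> C) (w : C) : C :=
  w + \sum_i (b i - a i) * (bump r (a i) w)%:C%C.

Lemma drag_id r a w : drag r a a w = w.
Proof. by rewrite /drag big1 ?addr0 // => i _; rewrite subrr mul0r. Qed.

Lemma drag_point r a b j : 0 < r ->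
  (forall i i', i != i' -> r <= cabs (a i - a i')) -> drag r a b (a j) = b j.
Proof.
move=> r0 sep; rewrite /drag (bigD1 j) //= big1 => [|i ij].
  rewrite /bump subrr cabs0 mul0r subr0 max_r ?ler01 // mulr1 addr0.
  by rewrite addrC subrK.
rewrite /bump max_l ?mulr0 // subr_le0 ler_pdivlMr // mul1r; apply: sep.
by rewrite eq_sym.
Qed.

Lemma bump_lipschitz r a w w' : 0 < r ->
  `|bump r a w - bump r a w'| <= cabs (w - w') / r.
Proof.
move=> r0.
have h x y : x - y <= `|x - y| :> R by exact: ler_norm.
have maxl (x y : R) : `|Num.max 0 x - Num.max 0 y| <= `|x - y|.
  rewrite !ler_norml; have := h x y; have := h y x; rewrite (distrC y).
  by case: (lerP 0 x) => ?; case: (lerP 0 y) => ? *; apply/andP; split; lra.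
apply: le_trans (maxl _ _) _.
rewrite (_ : 1 - _ - _ = (cabs (w' - a) - cabs (w - a)) / r); last by field; exact: lt0r_neq0.
rewrite normrM normfV (ger0_norm (ltW r0)) ler_pM2r ?invr_gt0 //.
have := cabs_dist w w' a; have := cabs_dist w' w a; rewrite (cabsB w' w).
by move=> ? ?; rewrite ler_norml; apply/andP; split; lra.
Qed.

Lemma cabs_sum (I : Type) (s : seq I) (G : I -> C) :
  cabs (\sum_(i <- s) G i) <= \sum_(i <- s) cabs (G i).
Proof.
elim: s => [|i s IH]; first by rewrite !big_nil cabs0.
by rewrite !big_cons; apply: le_trans (cabsD _ _) _; rewrite lerD2l.
Qed.

(** The displacement is Lipschitz with constant the sum of the [cabs (b i - a i)] divided by [r],
    which is below 1; the identity plus a strict contraction is injective. *)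
Lemma drag_inj r a b : 0 < r -> \sum_i cabs (b i - a i) < r ->
  injective (drag r a b).
Proof.
move=> r0 small w w' e; apply/eqP; apply: contraT; rewrite -subr_eq0 -cabs_gt0 => ww'.
suff : cabs (w - w') < cabs (w - w') by rewrite ltxx.
have {1}-> : w - w' =
    \sum_i (b i - a i) * (bump r (a i) w' - bump r (a i) w)%:C%C.
  transitivity (\sum_i (b i - a i) * (bump r (a i) w')%:C%C
    - \sum_i (b i - a i) * (bump r (a i) w)%:C%C).
    by move: e; rewrite /drag => e; apply/eqP; rewrite subr_eq addrAC eq_sym subr_eq e addrC.
  by rewrite -sumrB; apply: eq_bigr => i _; rewrite rmorphB /= mulrBr.
apply: le_lt_trans (cabs_sum _ _) _.
apply: (@le_lt_trans _ _ ((\sum_i cabs (b i - a i)) * (cabs (w - w') / r))).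
  rewrite mulr_suml; apply: ler_sum => i _; rewrite cabsM cabs_real.
  by apply: ler_wpM2l; [exact: cabs_ge0|rewrite distrC; exact: bump_lipschitz].
by rewrite mulrA ltr_pdivrMr // mulrC ltr_pM2l.
Qed.

Variables (k : nat) (v : 'I_n -> R * 'rV[R]_k -> C) (w : 'rV[R]_k -> C).
Hypothesis v_cont : forall i, {within @cylinder R k, continuous (v i)}.
Hypothesis v_inj : forall p, cylinder p -> injective (v^~ p).
Hypothesis w_cont : {within cube R k, continuous w}.
Hypothesis w_avoid : forall x i, cube R k x -> w x != v i (0, x).

(* Homotopy lifting in the bundle of complements of [n] moving points. *)
Lemma moving_points : exists W : R * 'rV[R]_k -> C,
  [/\ {within @cylinder R k, continuous W},
      forall x, cube R k x -> W (0, x) = w x,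
      forall p i, cylinder p -> W p != v i p
    & forall x, cube R k x ->
        (forall t i, 0 <= t <= 1 -> v i (t, x) = v i (0, x)) ->
        forall t, 0 <= t <= 1 -> W (t, x) = w x].
Proof.
pose P (p : R * 'rV[R]_k) (z : C) := \prod_(i < n) (z - v i p).
have Pcont z : {within @cylinder R k, continuous (P^~ z)}.
  apply: cont_prod => i; apply: cont_add; last exact: (cont_opp (@v_cont i)).
  exact: cont_cst.
have Proots p : cylinder p -> exists r : 'rV[C]_n, roots_of (P p) r.
  move=> cp; exists (\row_i v i p); split.
    by move=> i j; rewrite !mxE; exact: v_inj.
  by move=> z; apply: eq_bigr => i _; rewrite mxE.
have [r r0 hr] := uniformly_separated (@cylinder_compact R k) Pcont Proots.
have {}hr p : cylinder p -> forall i j, i != j -> r <= cabs (v i p - v j p).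
  move=> cp i j ij; have := hr p (\row_i v i p) cp _ i j ij; rewrite !mxE; apply.
  split; first by move=> i' j'; rewrite !mxE; exact: v_inj.
  by move=> z; apply: eq_bigr => i' _; rewrite mxE.
(* The [n] displacements of one stage, each below [r / (n + 1)], add up to less than [r], as
   [drag_inj] requires. *)
have rn0 : 0 < r / n.+1%:R by rewrite divr_gt0.
have [d d0 hd] : exists2 d : R, 0 < d & forall i p q, cylinder p -> cylinder q ->
    `|p - q| < d -> cabs (v i p - v i q) < r / n.+1%:R.
  have /choice[d hd] : forall i, exists d : R, 0 < d /\ forall p q, cylinder p ->
      cylinder q -> `|p - q| < d -> cabs (v i p - v i q) < r / n.+1%:R.
    move=> i; have [d d0 hd] := uniform_continuityC (@cylinder_compact R k) (@v_cont i) rn0.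
    by exists d.
  have h : \forall u \near (0 : R)^'+, forall i, u < d i.
    by apply: filter_forall => i; apply: nbhs_right_lt; have [] := hd i.
  have /filter_ex[u [u0 hu]] : \forall u \near (0 : R)^'+, 0 < u /\ forall i, u < d i.
    by apply: filterI => //; exact: nbhs_right_gt.
  exists u => // i p q cp cq pq; have [_] := hd i; apply => //.
  exact: lt_trans (hu i).
have [N hN] : exists N : nat, 1 < N.+1%:R * d.
  by exists (Num.truncn d^-1); rewrite -ltr_pdivrMr // div1r truncnS_gt.
have N0 : 0 < N.+1%:R :> R by [].
(* [c m] stops the clock at time [m / (N + 1)], and stage [m] of [W] follows the points up to that
   time. Stages that start after the time of [p] act as the identity, and [c N.+1] is the identity
   on the cylinder. *)
pose c m (p : R * 'rV[R]_k) := (Num.min p.1 (m%:R / N.+1%:R), p.2).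
have cc m p : cylinder p -> cylinder (c m p).
  case: p => t x /cylinderP[/andP[t0 t1] cx]; apply/cylinderP; split=> //.
  by rewrite le_min ge_min t0 t1 divr_ge0.
have ccont m : continuous (c m).
  apply: cont_pair; last exact: cont_snd.
  by apply: cont_min; [exact: cont_fst|exact: cont_cst].
have vc m i : {within @cylinder R k, continuous (fun p => v i (c m p))}.
  exact: (within_comp (within_cont (ccont m)) (@cc m) (@v_cont i)).
pose W := fix W m p := if m is m'.+1
  then drag r (fun i => v i (c m' p)) (fun i => v i (c m p)) (W m' p) else w p.2.
have c0 p : cylinder p -> c 0%N p = (0, p.2).
  by case: p => t x /cylinderP[/andP[t0 t1] cx]; rewrite /c mul0r min_r.
have cstep m p : cylinder p -> `|c m.+1 p - c m p| < d.
  case: p => t x _; rewrite prod_normE /= subrr normr0.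
  rewrite gt_max d0 andbT.
  have hNd : N.+1%:R^-1 < d by rewrite -div1r ltr_pdivrMr // mulrC.
  have h1 : (m.+1%:R / N.+1%:R : R) = m%:R / N.+1%:R + N.+1%:R^-1.
    by rewrite -natr1 mulrDl mul1r.
  have i0 : 0 < (N.+1%:R^-1 : R) by rewrite invr_gt0.
  rewrite h1; set q := m%:R / N.+1%:R in h1 *; set e := N.+1%:R^-1 in hNd i0 h1 *.
  by case: (lerP t (q + e)) => ?; case: (lerP t q) => ?; rewrite ltr_norml; apply/andP; split; lra.
exists (W N.+1); split.
- elim: N.+1 => [|m IH] /=.
    apply: (within_comp (within_cont cont_snd) _ w_cont).
    by move=> [t x] /cylinderP[].
  apply: (cont_add IH); apply: cont_sum => i; apply: cont_mul.
    exact: (cont_add (vc m.+1 i) (cont_opp (vc m i))).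
  have cst (a : R) : {within @cylinder R k, continuous (fun=> a)}.
    by apply: within_cont; exact: cont_cst.
  apply: (@cont_complex _ (subspace (@cylinder R k))); last exact: cst.
  apply: cont_max; first exact: cst.
  apply: (cont_add (cst 1)); apply: cont_opp; apply: cont_mul; last exact: cst.
  exact: (cont_comp (cont_add IH (cont_opp (vc m i))) cabs_continuous).
- move=> x cx; elim: N.+1 => //= m IH; rewrite IH.
  have cE m' : c m' (0, x) = (0, x) by rewrite /c min_l // divr_ge0.
  rewrite (_ : (fun i => v i (c m.+1 (0, x))) = (fun i => v i (c m (0, x)))) ?drag_id //.
  by apply/funext => i; rewrite !cE.
- move=> p i cp; have -> : v i p = v i (c N.+1 p).
    case: p cp => t x /cylinderP[/andP[t0 t1] cx].
    by rewrite /c divff ?gt_eqF // min_l.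
  elim: N.+1 => [|m IH] /=.
    rewrite c0 //; apply: w_avoid; by case: p cp => t x /cylinderP[].
  (* The drag takes each point at clock [m] to its place at clock [m + 1] and is injective, so
     hitting the new place would mean having hit the old one. *)
  apply: contraNneq IH; rewrite -{1}(@drag_point r (fun i => v i (c m p))
    (fun i => v i (c m.+1 p)) i r0 (hr _ (cc m p cp))).
  move/drag_inj => -> //.
  apply: (@le_lt_trans _ _ (\sum_(i < n) r / n.+1%:R)).
    by apply: ler_sum => j _; apply: ltW; apply: hd; [exact: cc|exact: cc|exact: cstep].
  rewrite sumr_const card_ord -(mulr_natr (r / n.+1%:R) n) -mulrA gtr_pMr //.
  by rewrite mulrC ltr_pdivrMr // mul1r ltr_nat.
- move=> x cx vx t t01; elim: N.+1 => //= m IH; rewrite IH.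
  have vE m' i : v i (c m' (t, x)) = v i (0, x).
    have /cylinderP[h _] : cylinder (c m' (t, x)) by apply: cc; apply/cylinderP.
    exact: vx.
  rewrite (_ : (fun i => v i (c m.+1 (t, x))) = (fun i => v i (c m (t, x)))) ?drag_id //.
  by apply/funext => i; rewrite !vE.
Qed.

End MovingPoints.

(** * Integrals of polynomials *)

Section Integral.
Context {R : realType}.
Local Notation C := R[i].
Local Notation mu := (@lebesgue_measure R).

Lemma Rintegral_deriv_poly (p : {poly R}) :
  \int[mu]_(s in `[0, 1]) (p^`()).[s] = p.[1] - p.[0].
Proof.
rewrite /Rintegral (@continuous_FTC2 _ _ (horner p)) //.
- by apply: continuous_subspaceT => x; exact: continuous_horner.
- split=> [x _||]; first exact: derivable_horner.
    by apply: cvg_at_right_filter; exact: continuous_horner.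
  by apply: cvg_at_left_filter; exact: continuous_horner.
- by move=> x _; rewrite derivE.
Qed.

Section RealPart.
(** To be instantiated by [complex.Re] and [complex.Im]; real linearity reduces both to the
    fundamental theorem for real polynomials. *)
Variable h : C -> R.
Hypothesis hD : {morph h : x y / x + y}.
Hypothesis hM : forall (z : C) (x : R), h (z * x%:C%C) = h z * x.

Let h0 : h 0 = 0.
Proof. by have := hM 0 0; rewrite mul0r mulr0. Qed.

Let hB x y : h (x - y) = h x - h y.
Proof. by apply/eqP; rewrite eq_sym subr_eq -hD subrK. Qed.

Let hMn z n : h (z *+ n) = h z *+ n.
Proof. by elim: n => [|n IH]; rewrite ?mulr0n // !mulrS hD IH. Qed.

Lemma horner_realpart (p : {poly C}) (s : R) : h p.[s%:C%C] = (map_poly h p).[s].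
Proof.
rewrite horner_coef (big_morph h hD h0).
rewrite (horner_coef_wide _ (size_poly _ _)).
by apply: eq_bigr => i _; rewrite -rmorphXn /= hM coef_map_id0.
Qed.

Lemma deriv_map_realpart (p : {poly C}) : (map_poly h p)^`() = map_poly h p^`().
Proof.
by apply/polyP => i; rewrite coef_deriv !coef_map_id0 // coef_deriv hMn.
Qed.

Lemma Rintegral_realpart (K : {poly C}) (a b : C) :
  \int[mu]_(s in `[0, 1]) h (K^`().[a + s%:C%C * (b - a)] * (b - a))
    = h (K.[b] - K.[a]).
Proof.
pose G := K \Po (a%:P + (b - a) *: 'X).
have GE s : K^`().[a + s%:C%C * (b - a)] * (b - a) = G^`().[s%:C%C].
  rewrite deriv_comp hornerM horner_comp !poly.derivE !hornerE.
  by rewrite /= mulr1 [s%:C%C * _]mulrC.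
rewrite (_ : (fun s => _) = horner (map_poly h G)^`()); last first.
  by apply/funext => s; rewrite GE horner_realpart deriv_map_realpart.
rewrite Rintegral_deriv_poly -!horner_realpart -hB.
have -> : G.[1%:C%C] = K.[b] by rewrite rmorph1 horner_comp hornerD hornerZ hornerC hornerX mulr1 addrC subrK.
by have -> : G.[0%:C%C] = K.[a] by rewrite rmorph0 horner_comp hornerD hornerZ hornerC hornerX mulr0 addr0.
Qed.

End RealPart.

Lemma cintegral_primitive (f : C -> C) (K : {poly C}) (a b : C) :
  (forall z, f z = K^`().[z]) -> cintegral R f a b = K.[b] - K.[a].
Proof.
move=> fK; rewrite /cintegral.
have -> : f = horner K^`() by apply/funext.
rewrite (@Rintegral_realpart (@complex.Re R)); last first.
- by move=> [x y] z /=; rewrite mulr0 subr0.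
- by move=> [x y] [x' y'].
rewrite (@Rintegral_realpart (@complex.Im R)); last first.
- by move=> [x y] z /=; rewrite mulr0 add0r.
- by move=> [x y] [x' y'].
by case: (_ - _).
Qed.

End Integral.

(** * Configurations and polynomials *)

Section Configurations.
Context {R : realType}.
Local Notation C := R[i].
Local Notation pt := (pt R).
Local Notation Qint := (Qint R).

Lemma pt_inj n (x : ordered_conf R n) : injective (pt x).
Proof. exact: (set_mem (valP x)). Qed.

Definition mk_conf n (r : 'rV[C]_n) (H : injective (r 0)) : ordered_conf R n :=
  exist (fun x => x \in distinct_pts R n) r (mem_set H).

Lemma pt_mk_conf n (r : 'rV[C]_n) (H : injective (r 0)) i :
  pt (mk_conf H) i = r 0 i.
Proof. by []. Qed.

Lemma conf_projP n (x y : ordered_conf R n) :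
  conf_proj R x = conf_proj R y <->
  exists s : 'S_n, forall i, pt y i = pt x (s i).
Proof.
split=> [h|[s xy]].
  have /eqmodP/existsP[s /forallP xy] : (x = y %[mod {eq_quot (conf_equivRel R n)}])%qT := h.
  by exists s => i; apply/eqP.
suff : (x = y %[mod {eq_quot (conf_equivRel R n)}])%qT by [].
by apply/eqmodP; apply/existsP; exists s; apply/forallP => i; rewrite xy.
Qed.

Lemma prod_pt_perm n (x y : ordered_conf R n) (s : 'S_n) (F : C -> {poly C}) :
  (forall i, pt y i = pt x (s i)) -> \prod_(i < n) F (pt y i) = \prod_(i < n) F (pt x i).
Proof.
move=> xy; rewrite [RHS](reindex_inj (@perm_inj _ s)).
by apply: eq_bigr => i _; rewrite xy.
Qed.

Lemma Qpoly_perm m (b b' : ordered_conf R m) :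
  conf_proj R b = conf_proj R b' -> Qpoly R b' = Qpoly R b.
Proof.
move=> /conf_projP[s bb']; rewrite /Qpoly.
by rewrite (prod_pt_perm (fun z => 'X - z%:P) bb').
Qed.

(** Passing to the quotient and back only permutes the roots; neither [Qpoly] nor a condition over
    all pairs depends on their order. *)
Lemma QF_P m (b : ordered_conf R m) : QF R m b <->
  forall k j : 'I_m, k != j -> Qint b (pt b k) (pt b j) != 0.
Proof.
split=> [[b' hb' bb']|hb]; last by exists b.
have [s sE] := iffLR (conf_projP _ _) bb'.
move=> k j kj; rewrite /Defs.Qint (Qpoly_perm bb') !sE; apply: hb'.
by apply: contraNN kj => /eqP/perm_inj ->.
Qed.

Lemma RF_P n (x : ordered_conf R n) : RF R n x <->
  exists (b : ordered_conf R n.-1) (c : C),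
   [/\ QF R n.-1 b, forall k : 'I_n.-1, c != Qint b 0 (pt b k)
     & forall z : C, (\prod_(i < n) ('X - (pt x i)%:P)).[z] = Qint b 0 z - c].
Proof.
split=> [[y [b [c [hb hc hz]]] yx]|[b [c [hb hc hz]]]]; last by exists x => //; exists b, c.
exists b, c; split=> // z; rewrite -hz.
have [s sE] := iffLR (conf_projP _ _) yx.
by rewrite (prod_pt_perm (fun z => 'X - z%:P) sE).
Qed.

Lemma conf_proj_continuous n : continuous (@conf_proj R n).
Proof. exact: pi_continuous. Qed.

Lemma val_continuous n : continuous (val : ordered_conf R n -> 'rV[C]_n).
Proof. exact: initial_continuous. Qed.

Lemma pt_continuous n (i : 'I_n) : continuous (fun x : ordered_conf R n => pt x i).
Proof. exact: (cont_comp (@val_continuous n) (@coord_continuous _ _ _ 0 i)). Qed.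

Lemma cont_conf (T : topologicalType) n (f : T -> ordered_conf R n) :
  (forall i, continuous (fun t => pt (f t) i)) -> continuous f.
Proof.
by move=> cf; apply: continuous_comp_initial; apply: cont_row => i; exact: cf.
Qed.

(** Homotopies are total functions, while [r p] may have repeated entries outside [S]; there the
    arbitrary configuration [y] fills in. *)
Lemma conf_glue (T : topologicalType) (S : set T) n (r : T -> 'rV[C]_n)
    (y : ordered_conf R n) :
  (forall p, S p -> injective (r p 0)) ->
  (forall i, {within S, continuous (fun p => r p 0 i)}) ->
  exists f : T -> ordered_conf R n, (forall p, S p -> val (f p) = r p) /\
    {within S, continuous f}.
Proof.
move=> rinj cr.
pose f p := if pselect (injective (r p 0)) is left h then mk_conf h else y.
have fE p : S p -> val (f p) = r p.
  by move=> Sp; rewrite /f; case: pselect => // -[]; exact: rinj.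
exists f; split=> //; apply: cont_conf => i.
by apply: within_eq (@cr i) => p Sp; rewrite /Defs.pt fE.
Qed.

(** The value at [z] is symmetric in the roots and descends to the quotient. These functions turn a
    spheroid in [conf R n] into a continuous family of polynomials, to which root lifting
    applies. *)
Lemma conf_poly_continuous n (z : C) : exists2 g : conf R n -> C,
  continuous g & forall x, g (conf_proj R x) = \prod_(i < n) (z - pt x i).
Proof.
pose h (x : ordered_conf R n) := \prod_(i < n) (z - pt x i).
have ch : continuous h.
  apply: cont_prod => i; apply: cont_add; first exact: cont_cst.
  by apply: cont_opp; exact: pt_continuous.
have hE x y : conf_proj R x = conf_proj R y -> h x = h y.
  move=> /conf_projP[s xy]; rewrite /h [LHS](reindex_inj (@perm_inj _ s)).
  by apply: eq_bigr => i _; rewrite xy.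
exists (h \o generic_quotient.repr).
  apply: repr_comp_continuous => // x y /eqP xy; apply/eqP; exact: hE.
by move=> x; apply: hE; exact: reprK.
Qed.

End Configurations.

(** * Lifting spheroids from unordered to ordered configurations *)

Section Lifting.
Context {R : realType}.
Local Notation C := R[i].
Local Notation pt := (pt R).

Definition conf_poly n (x : ordered_conf R n) (z : C) : C := \prod_(i < n) (z - pt x i).

Lemma conf_roots n (x : ordered_conf R n) : roots_of (conf_poly x) (val x).
Proof. by split; [exact: pt_inj|]. Qed.

Lemma conf_proj_surj n (y : conf R n) : exists x, conf_proj R x = y.
Proof. by exists (generic_quotient.repr y); exact: reprK. Qed.

Lemma conf_poly_proj n (x y : ordered_conf R n) :
  conf_poly x = conf_poly y -> conf_proj R x = conf_proj R y.
Proof.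
move=> xy; apply/conf_projP; apply: (roots_of_permutation (p := conf_poly x)).
  exact: conf_roots.
by rewrite xy; exact: conf_roots.
Qed.

Lemma conf_lifting {V : normedModType R} (X : set V) n (P : V -> C -> C) (c : V)
    (y : ordered_conf R n) :
  compact X -> X c ->
  (forall x (t : R), X x -> 0 <= t <= 1 -> X (c + t *: (x - c))) ->
  (forall z, {within X, continuous (fun x => P x z)}) ->
  (forall x, X x -> exists r : 'rV[C]_n, roots_of (P x) r) ->
  P c = conf_poly y ->
  exists e : V -> ordered_conf R n, [/\ e c = y,
    forall x, X x -> P x = conf_poly (e x) & {within X, continuous e}].
Proof.
move=> cX Xc star Pc Pr Py.
have [|e [ec er ce]] := root_lifting cX Pc Pr (c := c) (r0 := val y) Xc star.
  by rewrite Py; exact: conf_roots.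
have [|i|f [fE cf]] := @conf_glue R V X n e y; first by move=> x Xx; exact: (er x Xx).1.
  exact: (cont_comp ce (@coord_continuous _ _ _ 0 i)).
exists f; split=> // [|x Xx]; first by apply: val_inj; rewrite fE // ec.
apply/funext => z; rewrite (er x Xx).2 /conf_poly; apply: eq_bigr => i _.
by rewrite /Defs.pt fE.
Qed.

Lemma conf_unique {V : normedModType R} (X : set V) n (e e' : V -> ordered_conf R n)
    (a b : V) :
  compact X -> (forall t : R, 0 <= t <= 1 -> X (a + t *: (b - a))) ->
  {within X, continuous e} -> {within X, continuous e'} ->
  (forall x, X x -> conf_poly (e x) = conf_poly (e' x)) -> e a = e' a -> e b = e' b.
Proof.
move=> cX Xab ce ce' ee' eab; apply: val_inj.
apply: (@roots_unique _ _ _ X (fun x => conf_poly (e x)) cX _ _ a b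
  (fun x => val (e x)) (fun x => val (e' x))) => //.
- move=> z; apply: cont_prod => i; apply: cont_add; first exact: cont_cst.
  by apply: cont_opp; exact: (cont_comp ce (@pt_continuous _ _ i)).
- by move=> x _; exists (val (e x)); exact: conf_roots.
- exact: (cont_comp ce (@val_continuous _ _)).
- exact: (cont_comp ce' (@val_continuous _ _)).
- by move=> x _; exact: conf_roots.
- by move=> x Xx; rewrite ee' //; exact: conf_roots.
- by rewrite eab.
Qed.

(** A continuous choice of root tuples of one fixed polynomial is constant along segments, and for
    [k >= 2] segments inside the boundary link every boundary point to 0. *)
Lemma conf_boundary_cst k n (e : 'rV[R]_k -> ordered_conf R n) : (2 <= k)%N ->
  {within cube R k, continuous e} ->
  (forall x, cube_boundary R k x -> conf_poly (e x) = conf_poly (e 0)) ->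
  forall x, cube_boundary R k x -> e x = e 0.
Proof.
move=> k2 ce eP.
apply: (boundary_segments (P := fun x => e x = e 0) k2) => // a b ab ea.
apply: (@conf_unique _ (cube_boundary R k) n e (fun=> e 0) a b) => //.
- exact: cube_boundary_compact.
- by apply: within_sub ce; exact: cube_boundary_sub.
- by apply: within_cont; exact: cont_cst.
Qed.

Lemma cube_star k x (t : R) : cube R k x -> 0 <= t <= 1 ->
  cube R k (0 + t *: (x - 0)).
Proof. by move=> cx; apply: cube_convex => //; exact: cube0. Qed.

(** Continuity of roots lifts the spheroid to ordered configurations; the lift is constant on the
    boundary, so it is a spheroid, and its null-homotopy is projected back. *)
Lemma quotient_aspherical n (B : set (conf R n)) :
  aspherical R (@conf_proj R n @^-1` B) -> aspherical R B.
Proof.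
move=> asph k b f k2 sf; have k0 : (0 < k)%N by exact: ltn_trans k2.
have [cf fB fb] := sf.
have [y yb] := conf_proj_surj b.
have /choice[g hg] : forall z, exists g : conf R n -> C, continuous g /\
    forall x, g (conf_proj R x) = conf_poly x z.
  by move=> z; have [g cg gE] := @conf_poly_continuous R n z; exists g.
pose P t z := g z (f t).
have PE t x : conf_proj R x = f t -> P t = conf_poly x.
  by move=> xt; apply/funext => z; rewrite /P -xt (hg z).2.
have f0 : f 0 = b by rewrite fb //; exact: cube_boundary0.
have [|||e [e0 eP ce]] := @conf_lifting _ (cube R k) n P 0 y (@cube_compact R k)
  (@cube0 R k) (@cube_star k).
- by move=> z; exact: (cont_comp cf (hg z).1).
- move=> t _; have [x xt] := conf_proj_surj (f t); exists (val x).
  by rewrite (PE _ _ xt); exact: conf_roots.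
- by apply: PE; rewrite yb f0.
have projE t : cube R k t -> conf_proj R (e t) = f t.
  move=> ct; have [x xt] := conf_proj_surj (f t); rewrite -xt.
  by apply: conf_poly_proj; rewrite -eP // (PE _ _ xt).
have se : spheroid R (@conf_proj R n @^-1` B) y k e.
  split=> // [t ct|t bt]; first by rewrite /= projE //; exact: fB.
  rewrite -e0; apply: (conf_boundary_cst k2 ce) => // x bx.
  rewrite -eP ?(PE _ y) ?yb ?fb ?e0 //; exact: cube_boundary_sub.
have := homotopic_map (B := B) (within_cont (@conf_proj_continuous R n)) _ (asph _ _ _ k2 se).
rewrite yb => /(_ (fun a h => h)).
by apply: homotopic_eq => // t ct; exact: projE.
Qed.

Lemma quotient_K_pi_1 n (B : set (conf R n)) :
  K_pi_1 R (@conf_proj R n @^-1` B) -> aspherical R (@conf_proj R n @^-1` B) ->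
  K_pi_1 R B.
Proof.
move=> [[x Bx] conn _] asph; apply: aspherical_K_pi_1.
- by exists (conf_proj R x).
- have -> : B = conf_proj R @` (@conf_proj R n @^-1` B).
    apply/seteqP; split=> [y By|_ [z Bz <-] //].
    by have [z zy] := conf_proj_surj y; exists z => //=; rewrite zy.
  apply: connected_continuous_connected => //.
  by apply: within_cont; exact: conf_proj_continuous.
- exact: quotient_aspherical.
Qed.

End Lifting.

(** * Polynomials, primitives and critical points *)

Section Polynomials.
Context {R : realType}.
Local Notation C := R[i].
Local Notation pt := (pt R).
Local Notation Qint := (Qint R).
Implicit Types (p q : {poly C}).

Lemma poly_ext p q : (forall z, p.[z] = q.[z]) -> p = q.
Proof.
move=> pq; apply/eqP; rewrite -subr_eq0; apply/negPn/negP => d0.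
pose s := [seq (i%:R : C) | i <- iota 0 (size (p - q))].
have us : uniq s by rewrite map_inj_uniq ?iota_uniq //; apply: (mulrIn (x := 1 : C)); exact: oner_neq0.
have rs : all (root (p - q)) s.
  by apply/allP => _ /mapP[i _ ->]; rewrite /root hornerD hornerN pq subrr.
by have := max_poly_roots d0 rs us; rewrite size_map size_iota ltnn.
Qed.

(** For an explicit list [horner_rec s] computes, so an identity of polynomial functions checked by
    [ring] yields the equality of coefficients one index at a time. *)
Lemma coef_eq0 (s : seq C) : (forall z, horner_rec s z = 0) -> forall i, s`_i = 0.
Proof.
move=> s0 i; rewrite -coef_Poly (_ : Poly s = 0) ?coef0 //.
by apply: poly_ext => z; rewrite horner_Poly s0 horner0.
Qed.

Lemma primitive_exists q : exists p, p^`() = q.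
Proof.
exists (\poly_(i < (size q).+1) (q`_i.-1 / i%:R)).
apply/polyP => i; rewrite coef_deriv coef_poly ltnS.
case: ltnP => iq; last by rewrite mul0rn nth_default.
by rewrite -(mulr_natr (q`_i / i.+1%:R) i.+1) divfK // pnatr_eq0.
Qed.

Lemma monic_MXaddC p (c : C) : p \is monic ->
  p * 'X + c%:P \is monic /\ size (p * 'X + c%:P) = (size p).+1.
Proof.
move=> pm; have p0 := monic_neq0 pm.
have sp : size (p * 'X + c%:P) = (size p).+1 by rewrite size_MXaddC (negPf p0).
split=> //; rewrite monicE lead_coefE sp /= coefD coefMX coefC.
have : (0 < size p)%N by rewrite size_poly_gt0.
move: pm; rewrite monicE lead_coefE.
by case: (size p) => //= n /eqP -> _; rewrite addr0.
Qed.

Lemma closed_roots n p : p \is monic -> size p = n.+1 ->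
  exists r : 'rV[C]_n, p = \prod_(i < n) ('X - (r 0 i)%:P).
Proof.
move=> pm sp; have [rs pE] := closed_field_poly_normal p.
rewrite (monicP pm) scale1r in pE.
have srs : size rs = n by move: sp; rewrite pE size_prod_XsubC => -[].
exists (\row_i nth 0 rs i); rewrite pE (big_nth 0) srs big_mkord.
by apply: eq_bigr => i _; rewrite mxE.
Qed.

Lemma horner_prod_XsubC n (r : 'rV[C]_n) z :
  (\prod_(i < n) ('X - (r 0 i)%:P)).[z] = \prod_(i < n) (z - r 0 i).
Proof. by rewrite horner_prod; apply: eq_bigr => i _; rewrite hornerXsubC. Qed.

Lemma simple_roots n (r : 'rV[C]_n) :
  let p := \prod_(i < n) ('X - (r 0 i)%:P) in
  injective (r 0) <-> (forall a, p.[a] = 0 -> (p^`()).[a] != 0).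
Proof.
move=> p; have pE : p = \prod_(z <- [seq r 0 i | i <- enum 'I_n]) ('X - z%:P).
  by rewrite big_map big_enum.
have inj_uniq : injective (r 0) <-> uniq [seq r 0 i | i <- enum 'I_n].
  split=> [inj|u i j ij]; first by rewrite map_inj_uniq // enum_uniq.
  have /(nth_uniq 0) : uniq [seq r 0 i | i <- enum 'I_n] by [].
  move=> /(_ i j); rewrite size_map size_enum_ord => /(_ (ltn_ord i) (ltn_ord j)).
  have nE (l : 'I_n) : nth 0 [seq r 0 i | i <- enum 'I_n] l = r 0 l.
    by rewrite (nth_map i) ?size_enum_ord // nth_ord_enum.
  by rewrite !nE ij eqxx => /esym/eqP/val_inj.
rewrite inj_uniq -separable_prod_XsubC -pE unlock.
split=> [/Pdiv.ClosedField.coprimepP h a pa|h].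
  by apply: h; rewrite /root pa.
by apply/Pdiv.ClosedField.coprimepP => a /rootP; exact: h.
Qed.

Lemma Qpoly_root m (b : ordered_conf R m) z :
  (Qpoly R b).[z] = 0 <-> exists k, z = pt b k.
Proof.
have m0 : (m.+1%:R : C) != 0 by rewrite pnatr_eq0.
rewrite /Qpoly hornerZ horner_prod; split=> [/eqP|[k ->]].
  rewrite mulf_eq0 (negPf m0) /= prodf_seq_eq0 => /hasP[k _ /=].
  by rewrite hornerXsubC subr_eq0 => /eqP ->; exists k.
by rewrite (bigD1 k) //= hornerXsubC subrr mul0r mulr0.
Qed.

Lemma Qint_primitive m (b : ordered_conf R m) (K : {poly C}) u v :
  K^`() = Qpoly R b -> Qint b u v = K.[v] - K.[u].
Proof. by move=> KQ; apply: cintegral_primitive => z; rewrite KQ. Qed.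

(** If [c] were a critical value, [pt b k] would be a common zero of the polynomial of [x] and of
    its derivative, hence a multiple root. *)
Lemma critical_value_neq n (x : ordered_conf R n) m (b : ordered_conf R m) (c : C) :
  (forall z, conf_poly x z = Qint b 0 z - c) -> forall k, c != Qint b 0 (pt b k).
Proof.
move=> xb k; have [K KQ] := primitive_exists (Qpoly R b).
have pK : \prod_(i < n) ('X - (val x 0 i)%:P) = K - (K.[0] + c)%:P.
  apply: poly_ext => z; rewrite horner_prod_XsubC.
  have := xb z; rewrite /conf_poly /Defs.pt => ->.
  by rewrite (Qint_primitive _ _ KQ) hornerD hornerN hornerC opprD addrA.
have := (iffLR (simple_roots (val x))) (@pt_inj R n x).
rewrite pK => h; apply: contraTneq isT => ck.
have := h (pt b k); rewrite hornerD hornerN hornerC ck (Qint_primitive _ _ KQ).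
rewrite subrKC subrr => /(_ erefl); rewrite derivB derivC subr0 KQ => /eqP[].
by apply/Qpoly_root; exists k.
Qed.

(** The zeros of the derivative are the [pt b k]; as [p] does not vanish there, its roots are
    simple. *)
Lemma conf_of_critical n (p : {poly C}) m (b : ordered_conf R m) :
  p \is monic -> size p = n.+1 -> p^`() = Qpoly R b ->
  (forall k, p.[pt b k] != 0) ->
  exists x : ordered_conf R n, forall z, conf_poly x z = p.[z].
Proof.
move=> pm sp pQ pb; have [r pr] := closed_roots pm sp.
have inj : injective (r 0).
  apply/simple_roots; rewrite -pr => a pa; rewrite pQ; apply/eqP.
  by move=> /Qpoly_root[k ak]; have := pb k; rewrite -ak pa eqxx.
by exists (mk_conf inj) => z; rewrite pr horner_prod_XsubC.
Qed.

End Polynomials.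

(** * Degrees three and four *)

Section SmallDegree.
Context {R : realType}.
Local Notation C := R[i].
Local Notation pt := (pt R).
Local Notation Qint := (Qint R).
Local Notation "x `0" := (pt x (Ordinal (isT : (0 < _.+1)%N))) (at level 2).
Local Notation "x `1" := (pt x (Ordinal (isT : (1 < _.+2)%N))) (at level 2).
Local Notation "x `2" := (pt x (Ordinal (isT : (2 < _.+3)%N))) (at level 2).
Local Notation "x `3" := (pt x (Ordinal (isT : (3 < _.+4)%N))) (at level 2).

Lemma ord2P (P : 'I_2 -> Prop) : P (Ordinal (isT : 0 < 2)%N) ->
  P (Ordinal (isT : 1 < 2)%N) -> forall i, P i.
Proof.
move=> P0 P1 [[|[|m]] lt] //.
  by rewrite (bool_irrelevance lt isT).
by rewrite (bool_irrelevance lt isT).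
Qed.

Lemma ord3P (P : 'I_3 -> Prop) : P (Ordinal (isT : 0 < 3)%N) ->
  P (Ordinal (isT : 1 < 3)%N) -> P (Ordinal (isT : 2 < 3)%N) -> forall i, P i.
Proof.
move=> P0 P1 P2 [[|[|[|m]]] lt] //.
- by rewrite (bool_irrelevance lt isT).
- by rewrite (bool_irrelevance lt isT).
- by rewrite (bool_irrelevance lt isT).
Qed.

Lemma ord4P (P : 'I_4 -> Prop) : P (Ordinal (isT : 0 < 4)%N) ->
  P (Ordinal (isT : 1 < 4)%N) -> P (Ordinal (isT : 2 < 4)%N) ->
  P (Ordinal (isT : 3 < 4)%N) -> forall i, P i.
Proof.
move=> P0 P1 P2 P3 [[|[|[|[|m]]]] lt] //.
- by rewrite (bool_irrelevance lt isT).
- by rewrite (bool_irrelevance lt isT).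
- by rewrite (bool_irrelevance lt isT).
- by rewrite (bool_irrelevance lt isT).
Qed.

Lemma pt_eq n (x : ordered_conf R n) i j : (pt x i == pt x j) = (i == j).
Proof. exact: (inj_eq (@pt_inj _ _ x)). Qed.

Lemma conf_poly2 (x : ordered_conf R 2) z : conf_poly x z = (z - x`0) * (z - x`1).
Proof.
rewrite /conf_poly !big_ord_recl big_ord0 mulr1.
by congr (_ * _); congr (_ - pt _ _); exact: val_inj.
Qed.

Lemma conf_poly3 (x : ordered_conf R 3) z :
  conf_poly x z = (z - x`0) * (z - x`1) * (z - x`2).
Proof.
rewrite /conf_poly !big_ord_recl big_ord0 mulr1 !mulrA.
by congr (_ * _ * _); congr (_ - pt _ _); exact: val_inj.
Qed.

Lemma conf_poly4 (x : ordered_conf R 4) z :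
  conf_poly x z = (z - x`0) * (z - x`1) * (z - x`2) * (z - x`3).
Proof.
rewrite /conf_poly !big_ord_recl big_ord0 mulr1 !mulrA.
by congr (_ * _ * _ * _); congr (_ - pt _ _); exact: val_inj.
Qed.

Lemma Qpoly_conf m (b : ordered_conf R m) z : (Qpoly R b).[z] = m.+1%:R * conf_poly b z.
Proof.
rewrite /Qpoly hornerZ horner_prod; congr (_ * _).
by apply: eq_bigr => i _; rewrite hornerXsubC.
Qed.

Definition prim2 (b : ordered_conf R 2) : {poly C} :=
  (('X - (3 / 2 * (b`0 + b`1))%:P) * 'X + (3 * (b`0 * b`1))%:P) * 'X.

Lemma prim2_deriv b : (prim2 b)^`() = Qpoly R b.
Proof.
apply: poly_ext => z; rewrite Qpoly_conf conf_poly2 /prim2.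
by rewrite !poly.derivE !hornerE /=; field.
Qed.

Definition e1 (b : ordered_conf R 3) : C := b`0 + b`1 + b`2.
Definition e2 (b : ordered_conf R 3) : C := b`0 * b`1 + b`0 * b`2 + b`1 * b`2.
Definition e3 (b : ordered_conf R 3) : C := b`0 * b`1 * b`2.

(** The primitive of [Qpoly R b] with constant term [c], in Horner form so that monicity and size
    follow from repeated use of [monic_MXaddC]. *)
Definition prim3 (b : ordered_conf R 3) (c : C) : {poly C} :=
  ((('X - (4 / 3 * e1 b)%:P) * 'X + (2 * e2 b)%:P) * 'X + (- (4 * e3 b))%:P) * 'X + c%:P.

Lemma prim3_horner b c z : (prim3 b c).[z] =
  (((z - 4 / 3 * e1 b) * z + 2 * e2 b) * z - 4 * e3 b) * z + c.
Proof. by rewrite /prim3 !(hornerD, hornerMX, hornerN, hornerC, hornerX). Qed.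

Lemma prim3_deriv b c : (prim3 b c)^`() = Qpoly R b.
Proof.
apply: poly_ext => z; rewrite Qpoly_conf conf_poly3 /prim3 /e1 /e2 /e3.
by rewrite !poly.derivE !hornerE /=; field.
Qed.

Lemma prim3_monic b c : prim3 b c \is monic /\ size (prim3 b c) = 5%N.
Proof.
have [h1 s1] := monic_MXaddC (2 * e2 b) (monicXsubC (4 / 3 * e1 b)).
have [h2 s2] := monic_MXaddC (- (4 * e3 b)) h1.
have [h3 s3] := monic_MXaddC c h2.
by split=> //; rewrite s3 s2 s1 size_XsubC.
Qed.

Lemma Qint3E (b : ordered_conf R 3) u v : Qint b u v = (prim3 b 0).[v] - (prim3 b 0).[u].
Proof. by apply: Qint_primitive; exact: prim3_deriv. Qed.

Lemma Qint2E (b : ordered_conf R 2) u v : Qint b u v = (prim2 b).[v] - (prim2 b).[u].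
Proof. by apply: Qint_primitive; exact: prim2_deriv. Qed.

(** The two critical values of a monic cubic differ, up to sign, by half the cube of the difference
    of the critical points, so they are never equal. *)
Lemma QF2 (b : ordered_conf R 2) : QF R 2 b.
Proof.
have b01 : b`1 - b`0 != 0 by rewrite subr_eq0 pt_eq.
have D : (prim2 b).[b`1] - (prim2 b).[b`0] = - (b`1 - b`0) ^+ 3 / 2.
  by rewrite /prim2 !hornerE /=; field.
have D0 : (prim2 b).[b`1] - (prim2 b).[b`0] != 0.
  by rewrite D mulf_neq0 ?oppr_eq0 ?expf_neq0 // invr_eq0 pnatr_eq0.
apply/QF_P; apply: ord2P; apply: ord2P => //; rewrite Qint2E => // _.
by rewrite -opprB oppr_eq0.
Qed.

(** The difference of two critical values of a quartic factors as the cube of the difference of the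
    two critical points times a linear form, which vanishes when the third critical point is their
    midpoint. *)
Lemma QF3 (b : ordered_conf R 3) : QF R 3 b <->
  [/\ b`0 + b`1 - 2 * b`2 != 0, b`0 + b`2 - 2 * b`1 != 0 & b`1 + b`2 - 2 * b`0 != 0].
Proof.
have b01 : b`1 - b`0 != 0 by rewrite subr_eq0 pt_eq.
have b02 : b`2 - b`0 != 0 by rewrite subr_eq0 pt_eq.
have b12 : b`2 - b`1 != 0 by rewrite subr_eq0 pt_eq.
pose K := prim3 b 0.
have D01 : K.[b`1] - K.[b`0] = - (b`1 - b`0) ^+ 3 / 3 * (b`0 + b`1 - 2 * b`2).
  by rewrite /K !prim3_horner /e1 /e2 /e3; field.
have D02 : K.[b`2] - K.[b`0] = - (b`2 - b`0) ^+ 3 / 3 * (b`0 + b`2 - 2 * b`1).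
  by rewrite /K !prim3_horner /e1 /e2 /e3; field.
have D12 : K.[b`2] - K.[b`1] = - (b`2 - b`1) ^+ 3 / 3 * (b`1 + b`2 - 2 * b`0).
  by rewrite /K !prim3_horner /e1 /e2 /e3; field.
have nz (u v : C) : u != 0 -> (- u ^+ 3 / 3 * v != 0) = (v != 0).
  move=> u0; have h : - u ^+ 3 / 3 != 0.
    by rewrite mulf_neq0 ?invr_eq0 ?pnatr_eq0 // oppr_eq0 expf_neq0.
  by rewrite mulf_eq0 (negPf h).
rewrite QF_P; split=> [h|[h01 h02 h12]].
  split.
  - by rewrite -(nz _ _ b01) -D01 -Qint3E; apply: h.
  - by rewrite -(nz _ _ b02) -D02 -Qint3E; apply: h.
  - by rewrite -(nz _ _ b12) -D12 -Qint3E; apply: h.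
have d01 : K.[b`1] - K.[b`0] != 0 by rewrite D01 nz.
have d02 : K.[b`2] - K.[b`0] != 0 by rewrite D02 nz.
have d12 : K.[b`2] - K.[b`1] != 0 by rewrite D12 nz.
apply: ord3P; apply: ord3P => // _; rewrite Qint3E -/K //.
- by rewrite -opprB oppr_eq0.
- by rewrite -opprB oppr_eq0.
- by rewrite -opprB oppr_eq0.
Qed.

(** The expression is a quarter of the discriminant of the derivative of the cubic, and by [QF2]
    distinct critical points are enough. Conversely these are recovered by the quadratic formula,
    with [t] a square root of [d]. *)
Lemma RF3 (x : ordered_conf R 3) : RF R 3 x <->
  x`0 ^+ 2 + x`1 ^+ 2 + x`2 ^+ 2 - x`0 * x`1 - x`0 * x`2 - x`1 * x`2 != 0.
Proof.
set d := _ - x`1 * x`2.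
have xE z : (\prod_(i < 3) ('X - (pt x i)%:P)).[z] = conf_poly x z.
  by rewrite horner_prod; apply: eq_bigr => i _; rewrite hornerXsubC.
split=> [/RF_P[b [c [_ _ hz]]]|d0].
  have b01 : b`1 - b`0 != 0 by rewrite subr_eq0 pt_eq.
  pose s := [:: c - x`0 * x`1 * x`2;
    x`0 * x`1 + x`0 * x`2 + x`1 * x`2 - 3 * (b`0 * b`1);
    3 / 2 * (b`0 + b`1) - (x`0 + x`1 + x`2)].
  have s0 z : horner_rec s z = 0.
    have := hz z; rewrite xE conf_poly3 Qint2E /prim2 !hornerE /= => {}hz.
    rewrite /=; move/eqP: hz; rewrite -subr_eq0 => /eqP hz'; rewrite -[RHS]hz'; ring.
  have E2 : x`0 * x`1 + x`0 * x`2 + x`1 * x`2 = 3 * (b`0 * b`1).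
    by apply/eqP; rewrite -subr_eq0; apply/eqP; exact: (coef_eq0 s0 1).
  have E1 : x`0 + x`1 + x`2 = 3 / 2 * (b`0 + b`1).
    by apply/esym/eqP; rewrite -subr_eq0; apply/eqP; exact: (coef_eq0 s0 2).
  have -> : d = (x`0 + x`1 + x`2) ^+ 2 - 3 * (x`0 * x`1 + x`0 * x`2 + x`1 * x`2).
    by rewrite /d; ring.
  rewrite E1 E2 (_ : _ - _ = 9 / 4 * (b`1 - b`0) ^+ 2); last by field.
  by rewrite mulf_neq0 ?expf_neq0 // mulf_neq0 ?invr_eq0 // pnatr_eq0.
pose t := sqrtc d; have tE : t ^+ 2 = d by exact: sqr_sqrtc.
have t0 : t != 0 by apply: contraNneq d0 => t0; rewrite -tE t0 expr0n.
pose r : 'rV[C]_2 := \row_i (if i == 0 then (x`0 + x`1 + x`2 + t) / 3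
  else (x`0 + x`1 + x`2 - t) / 3).
have rinj : injective (r 0).
  have n01 : r 0 (Ordinal (isT : 0 < 2)%N) != r 0 (Ordinal (isT : 1 < 2)%N).
    rewrite !mxE /= -subr_eq0 -mulrBl.
    rewrite mulf_neq0 ?invr_eq0 ?pnatr_eq0 //.
    rewrite (_ : _ - _ = 2 * t); last by ring.
    by rewrite mulf_neq0 // pnatr_eq0.
  apply: ord2P; apply: ord2P => // /eqP; first by rewrite (negPf n01).
  by rewrite eq_sym (negPf n01).
pose b := mk_conf rinj.
have b0 : b`0 = (x`0 + x`1 + x`2 + t) / 3 by rewrite pt_mk_conf mxE.
have b1 : b`1 = (x`0 + x`1 + x`2 - t) / 3 by rewrite pt_mk_conf mxE.
have b01 : 3 * (b`0 * b`1) = x`0 * x`1 + x`0 * x`2 + x`1 * x`2.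
  rewrite b0 b1 (_ : 3 * _ = ((x`0 + x`1 + x`2) ^+ 2 - t ^+ 2) / 3); last by field.
  by rewrite tE /d; field.
have bS : 3 / 2 * (b`0 + b`1) = x`0 + x`1 + x`2 by rewrite b0 b1; field.
have hz z : conf_poly x z = Qint b 0 z - x`0 * x`1 * x`2.
  by rewrite Qint2E /prim2 b01 bS conf_poly3 !hornerE /=; ring.
apply/RF_P; exists b, (x`0 * x`1 * x`2); split; first exact: QF2.
  exact: critical_value_neq hz.
by move=> z; rewrite xE.
Qed.

Definition E1 (x : ordered_conf R 4) : C := x`0 + x`1 + x`2 + x`3.
Definition E2 (x : ordered_conf R 4) : C :=
  x`0 * x`1 + x`0 * x`2 + x`0 * x`3 + x`1 * x`2 + x`1 * x`3 + x`2 * x`3.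
Definition E3 (x : ordered_conf R 4) : C :=
  x`0 * x`1 * x`2 + x`0 * x`1 * x`3 + x`0 * x`2 * x`3 + x`1 * x`2 * x`3.
Definition E4 (x : ordered_conf R 4) : C := x`0 * x`1 * x`2 * x`3.

(* A quarter of the derivative of [conf_poly x]. *)
Definition deriv4 (x : ordered_conf R 4) (z : C) : C :=
  z ^+ 3 - 3 / 4 * E1 x * z ^+ 2 + E2 x / 2 * z - E3 x / 4.

(** Integration of the derivative [4 * deriv4 x]: both sides say that the coefficients of positive
    degree correspond, and the constant term of the quartic is [E4 x]. *)
Lemma conf_poly_prim3 (x : ordered_conf R 4) (b : ordered_conf R 3) :
  conf_poly b = deriv4 x <-> conf_poly x = horner (prim3 b (E4 x)).
Proof.
split=> h; apply/funext => z.
  pose s := [:: E3 x / 4 - e3 b; e2 b - E2 x / 2; 3 / 4 * E1 x - e1 b].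
  have s0 w : horner_rec s w = 0.
    have := congr1 (fun f => f w) h; rewrite conf_poly3 /deriv4 /= => hw.
    rewrite /=; move/eqP: hw; rewrite -subr_eq0 => /eqP hw.
    by rewrite -[RHS]hw /e1 /e2 /e3; ring.
  have h3 : e3 b = E3 x / 4.
    by apply/esym/eqP; rewrite -subr_eq0; apply/eqP; exact: (coef_eq0 s0 0).
  have h2 : e2 b = E2 x / 2.
    by apply/eqP; rewrite -subr_eq0; apply/eqP; exact: (coef_eq0 s0 1).
  have h1 : e1 b = 3 / 4 * E1 x.
    by apply/esym/eqP; rewrite -subr_eq0; apply/eqP; exact: (coef_eq0 s0 2).
  by rewrite conf_poly4 prim3_horner h1 h2 h3 /E1 /E2 /E3 /E4; field.
pose s := [:: (0 : C); 4 * e3 b - E3 x; E2 x - 2 * e2 b; 4 / 3 * e1 b - E1 x].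
have s0 w : horner_rec s w = 0.
  have := congr1 (fun f => f w) h; rewrite conf_poly4 prim3_horner => hw.
  rewrite /=; move/eqP: hw; rewrite -subr_eq0 => /eqP hw.
  by rewrite -[RHS]hw /E1 /E2 /E3 /E4 /e1 /e2 /e3; ring.
have h3 : E3 x = 4 * e3 b.
  by apply/esym/eqP; rewrite -subr_eq0; apply/eqP; exact: (coef_eq0 s0 1).
have h2 : E2 x = 2 * e2 b.
  by apply/eqP; rewrite -subr_eq0; apply/eqP; exact: (coef_eq0 s0 2).
have h1 : E1 x = 4 / 3 * e1 b.
  by apply/esym/eqP; rewrite -subr_eq0; apply/eqP; exact: (coef_eq0 s0 3).
by rewrite conf_poly3 /deriv4 h1 h2 h3 /e1 /e2 /e3; field.
Qed.

Lemma prim3_shift b c z : (prim3 b c).[z] = Qint b 0 z + c.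
Proof. by rewrite Qint3E !prim3_horner; ring. Qed.

(** Evaluation at 0 forces [c = - E4 x], and [critical_value_neq] provides the condition on [c], so
    only the critical points remain as data. *)
Lemma RF4 (x : ordered_conf R 4) : RF R 4 x <->
  exists b : ordered_conf R 3, QF R 3 b /\ conf_poly b = deriv4 x.
Proof.
have xE z : (\prod_(i < 4) ('X - (pt x i)%:P)).[z] = conf_poly x z.
  by rewrite horner_prod; apply: eq_bigr => i _; rewrite hornerXsubC.
split=> [/RF_P[b [c [hb _ hz]]]|[b [hb /conf_poly_prim3 hx]]].
  exists b; split=> //; apply/conf_poly_prim3/funext => z.
  rewrite -xE hz prim3_shift; congr (_ + _).
  have := hz 0; rewrite xE conf_poly4 Qint3E subrr => hz0.
  by rewrite -[LHS]add0r -hz0 /E4; ring.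
have hz z : conf_poly x z = Qint b 0 z - - E4 x by rewrite hx prim3_shift opprK.
apply/RF_P; exists b, (- E4 x); split=> //; first exact: critical_value_neq hz.
by move=> z; rewrite xE.
Qed.

End SmallDegree.

(** * Asphericity *)

Section Asphericity.
Context {R : realType}.
Local Notation C := R[i].
Local Notation pt := (pt R).
Local Notation Qint := (Qint R).
Local Notation "x `0" := (pt x (Ordinal (isT : (0 < _.+1)%N))) (at level 2).
Local Notation "x `1" := (pt x (Ordinal (isT : (1 < _.+2)%N))) (at level 2).
Local Notation "x `2" := (pt x (Ordinal (isT : (2 < _.+3)%N))) (at level 2).
Local Notation "x `3" := (pt x (Ordinal (isT : (3 < _.+4)%N))) (at level 2).

Lemma conf_ext n (x y : ordered_conf R n) : (forall i, pt x i = pt y i) -> x = y.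
Proof. by move=> xy; apply: val_inj; apply/rowP => i; exact: xy. Qed.

Lemma pt_sub_continuous n (i j : 'I_n) :
  continuous (fun x : ordered_conf R n => (pt x i - pt x j : C)).
Proof.
apply: cont_add; first exact: pt_continuous.
by apply: cont_opp; exact: pt_continuous.
Qed.

(* In the coordinates [x0], [x1 - x0], [(x2 - x0) / (x1 - x0)] the set is the
   product of [C], [C^*] and a finitely punctured plane. *)
Lemma arrangement_aspherical (F : seq C) (A : set (ordered_conf R 3)) :
  0 \in F -> 1 \in F ->
  (forall x, A x <-> (x`2 - x`0) / (x`1 - x`0) \notin F) ->
  aspherical R A.
Proof.
move=> F0 F1 AE k x f k2 sf; have [cf fA fx] := sf.
have cpt i : continuous (fun y : ordered_conf R 3 => pt y i) by exact: pt_continuous.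
pose sub (y : ordered_conf R 3) : C := y`1 - y`0.
pose quo (y : ordered_conf R 3) : C := (y`2 - y`0) / (y`1 - y`0).
have sub0 y : sub y != 0 by rewrite /sub subr_eq0 pt_eq.
have csub : continuous sub by exact: pt_sub_continuous.
have cquo : continuous quo.
  exact: (cont_mul (@pt_sub_continuous 3 _ _) (cont_inv sub0 csub)).
have [Ha [cHa _ Ha0 Ha1 Hax]] := @finite_complement_aspherical R [::] k x`0
  (fun t => (f t)`0) k2 (spheroid_map (within_cont (cpt _)) (fun _ _ => isT) sf).
have [Hb [cHb HbF Hb0 Hb1 Hbx]] : homotopic_rel R [set z : C | z \notin [:: 0]] (sub x)
    (fun t => sub (f t)) (fun=> sub x).
  apply: finite_complement_aspherical k2 _.
  by apply: (spheroid_map (within_cont csub)) sf => y _ /=; rewrite inE.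
have [Hc [cHc HcF Hc0 Hc1 Hcx]] : homotopic_rel R [set z : C | z \notin F] (quo x)
    (fun t => quo (f t)) (fun=> quo x).
  apply: finite_complement_aspherical k2 _.
  by apply: (spheroid_map (within_cont cquo)) sf => y /AE.
(* The three homotopies are reassembled into a triple; its entries stay distinct because [Hb] avoids
   0 and [Hc] avoids 0 and 1. *)
pose r (p : R * 'rV[R]_k) : 'rV[C]_3 :=
  \row_i nth 0 [:: Ha p; Ha p + Hb p; Ha p + Hb p * Hc p] i.
have [||H [HE cH]] := @conf_glue R _ (@cylinder R k) 3 r x.
- move=> [s t] /cylinderP[s01 ct].
  have := HbF s t s01 ct; have := HcF s t s01 ct; rewrite /= !inE => hc hb.
  have hc0 : Hc (s, t) != 0 by apply: contraNneq hc => ->.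
  have hc1 : Hc (s, t) != 1 by apply: contraNneq hc => ->.
  have n01 : Ha (s, t) != Ha (s, t) + Hb (s, t).
    by rewrite -subr_eq0 opprD addrA subrr sub0r oppr_eq0.
  have n02 : Ha (s, t) != Ha (s, t) + Hb (s, t) * Hc (s, t).
    by rewrite -subr_eq0 opprD addrA subrr sub0r oppr_eq0 mulf_neq0.
  have n12 : Ha (s, t) + Hb (s, t) != Ha (s, t) + Hb (s, t) * Hc (s, t).
    rewrite -subr_eq0 opprD addrACA subrr add0r.
    by rewrite -{1}[Hb _]mulr1 -mulrBr mulf_neq0 // subr_eq0 eq_sym.
  apply: ord3P; apply: ord3P => //; rewrite !mxE /= => /eqP.
  + by rewrite (negPf n01).
  + by rewrite (negPf n02).
  + by rewrite eq_sym (negPf n01).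
  + by rewrite (negPf n12).
  + by rewrite eq_sym (negPf n02).
  + by rewrite eq_sym (negPf n12).
- have cb := cont_add cHa cHb; have cc := cont_add cHa (cont_mul cHb cHc).
  apply: ord3P.
  + by apply: within_eq cHa => p _; rewrite mxE.
  + by apply: within_eq cb => p _; rewrite mxE.
  + by apply: within_eq cc => p _; rewrite mxE.
have H0 p : cylinder p -> (H p)`0 = Ha p by move=> cp; rewrite /Defs.pt HE // mxE.
have H1 p : cylinder p -> (H p)`1 = Ha p + Hb p by move=> cp; rewrite /Defs.pt HE // mxE.
have H2 p : cylinder p -> (H p)`2 = Ha p + Hb p * Hc p by move=> cp; rewrite /Defs.pt HE // mxE.
have ext p y : cylinder p -> Ha p = y`0 -> Hb p = sub y -> Hc p = quo y -> H p = y.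
  move=> cp ha hb hc; apply: conf_ext; apply: ord3P.
  - by rewrite H0.
  - by rewrite H1 // ha hb /sub; ring.
  - by rewrite H2 // ha hb hc /quo -/(sub y) [sub y * _]mulrC divfK // addrC subrK.
exists H; split=> //.
- move=> s t s01 ct; have cp : cylinder (s, t) by apply/cylinderP.
  apply/AE; rewrite H2 // H1 // H0 // !(addrAC _ _ (- Ha _)) subrr !add0r.
  have hb : Hb (s, t) != 0 by have := HbF s t s01 ct; rewrite /= inE.
  by rewrite mulrAC divff // mul1r; exact: HcF.
- move=> t ct; have cp : cylinder (0 : R, t) by apply/cylinderP; rewrite lexx ler01.
  by apply: ext; rewrite ?Ha0 ?Hb0 ?Hc0.
- move=> t ct; have cp : cylinder (1 : R, t) by apply/cylinderP; rewrite lexx ler01.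
  by apply: ext; rewrite ?Ha1 ?Hb1 ?Hc1.
- move=> s t s01 bt.
  have cp : cylinder (s, t) by apply/cylinderP; split=> //; exact: cube_boundary_sub.
  by apply: ext; rewrite ?Hax ?Hbx ?Hcx.
Qed.

(** For the ratio [z], the third point meets one of the first two at 0 and 1, and one of the three
    points is the midpoint of the others at -1, 2 and [1 / 2]. *)
Lemma QF3_aspherical : aspherical R (QF R 3).
Proof.
apply: (@arrangement_aspherical [:: 0; 1; -1; 2; 1 / 2]); rewrite ?inE ?eqxx ?orbT //.
move=> x; have x01 : x`1 - x`0 != 0 by rewrite subr_eq0 pt_eq.
have x02 : x`2 - x`0 != 0 by rewrite subr_eq0 pt_eq.
have x12 : x`2 - x`1 != 0 by rewrite subr_eq0 pt_eq.
pose z := (x`2 - x`0) / (x`1 - x`0); rewrite -/z.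
have zE : x`2 - x`0 = z * (x`1 - x`0) by rewrite /z divfK.
have z0 : z != 0 by rewrite mulf_neq0 ?invr_eq0.
have z1 : z - 1 != 0.
  apply: contraNneq x12 => z1; rewrite (_ : _ - _ = (z - 1) * (x`1 - x`0)); last first.
    by rewrite [RHS]mulrBl -zE; ring.
  by rewrite z1 mul0r.
have e2 : x`0 + x`1 - 2 * x`2 = (1 - 2 * z) * (x`1 - x`0).
  by rewrite mulrBl -mulrA -zE; ring.
have e1 : x`0 + x`2 - 2 * x`1 = (z - 2) * (x`1 - x`0).
  by rewrite [RHS]mulrBl -zE; ring.
have e0 : x`1 + x`2 - 2 * x`0 = (z + 1) * (x`1 - x`0).
  by rewrite [RHS]mulrDl -zE; ring.
rewrite QF3 e0 e1 e2 !mulf_eq0 (negPf x01) !orbF !inE !negb_or z0 -(subr_eq0 z 1) z1 /=.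
rewrite -(subr_eq0 z (-1)) opprK -(subr_eq0 z 2).
have -> : (1 - 2 * z == 0) = (z == 1 / 2).
  have n2 : (2 : C) != 0 by rewrite pnatr_eq0.
  by rewrite subr_eq0 eq_sym -(inj_eq (mulfI n2) z) [2 * (1 / 2)](_ : _ = 1) //; field.
by split=> [[-> -> ->]|/and3P[]].
Qed.

(** [u] and [v] are the primitive sixth roots of unity, zeros of [z ^+ 2 - z + 1], which is the
    quadratic form divided by the square of the difference of the first two points. The excluded
    triples are the equilateral triangles. *)
Lemma RF3_aspherical : aspherical R (RF R 3).
Proof.
pose w : C := sqrtc (-3); have w2 : w ^+ 2 = -3 by exact: sqr_sqrtc.
pose u : C := (1 + w) / 2; pose v : C := (1 - w) / 2.
apply: (@arrangement_aspherical [:: 0; 1; u; v]); rewrite ?inE ?eqxx ?orbT //.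
move=> x; have x01 : x`1 - x`0 != 0 by rewrite subr_eq0 pt_eq.
have x02 : x`2 - x`0 != 0 by rewrite subr_eq0 pt_eq.
have x12 : x`2 - x`1 != 0 by rewrite subr_eq0 pt_eq.
pose z := (x`2 - x`0) / (x`1 - x`0); rewrite -/z.
have zE : x`2 = x`0 + z * (x`1 - x`0) by rewrite /z divfK // addrC subrK.
have z0 : z != 0 by rewrite mulf_neq0 ?invr_eq0.
have z1 : z - 1 != 0.
  apply: contraNneq x12 => z1; rewrite (_ : _ - _ = (z - 1) * (x`1 - x`0)); last first.
    by rewrite zE; ring.
  by rewrite z1 mul0r.
have uv : (z - u) * (z - v) = z ^+ 2 - z + 1.
  rewrite (_ : _ * _ = z ^+ 2 - z + (1 - w ^+ 2) / 4); last by rewrite /u /v; field.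
  by rewrite w2; field.
rewrite RF3 (_ : _ - _ = (z - u) * (z - v) * (x`1 - x`0) ^+ 2); last first.
  by rewrite uv zE; ring.
rewrite !mulf_eq0 (negPf x01) !orbF !inE !negb_or z0 -(subr_eq0 z 1) z1 /=.
by rewrite !subr_eq0.
Qed.

End Asphericity.

(** * Asphericity of the space of quartics *)

Section Quartics.
Context {R : realType}.
Local Notation C := R[i].
Local Notation pt := (pt R).
Local Notation Qint := (Qint R).

Lemma e1_continuous : continuous (@e1 R).
Proof. by apply: cont_add; [apply: cont_add|]; exact: pt_continuous. Qed.

Lemma e2_continuous : continuous (@e2 R).
Proof.
by apply: cont_add; [apply: cont_add|]; apply: cont_mul; exact: pt_continuous.
Qed.

Lemma e3_continuous : continuous (@e3 R).
Proof. by apply: cont_mul; [apply: cont_mul|]; exact: pt_continuous. Qed.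

Lemma E1_continuous : continuous (@E1 R).
Proof.
by apply: cont_add; [apply: cont_add; [apply: cont_add|]|]; exact: pt_continuous.
Qed.

Lemma E2_continuous : continuous (@E2 R).
Proof.
by apply: cont_add; [apply: cont_add; [apply: cont_add; [apply: cont_add;
  [apply: cont_add|]|]|]|]; apply: cont_mul; exact: pt_continuous.
Qed.

Lemma E3_continuous : continuous (@E3 R).
Proof.
by apply: cont_add; [apply: cont_add; [apply: cont_add|]|];
  (apply: cont_mul; [apply: cont_mul|]); exact: pt_continuous.
Qed.

Lemma E4_continuous : continuous (@E4 R).
Proof.
by apply: cont_mul; [apply: cont_mul; [apply: cont_mul|]|]; exact: pt_continuous.
Qed.

Lemma deriv4_continuous (z : C) : continuous (fun x : ordered_conf R 4 => deriv4 x z).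
Proof.
have cst (a : C) : continuous (fun _ : ordered_conf R 4 => a) by exact: cont_cst.
have c1 := cont_mul (cont_mul (cst (3 / 4)) E1_continuous) (cst (z ^+ 2)).
have c2 := cont_mul (cont_mul E2_continuous (cst 2^-1)) (cst z).
have c3 := cont_mul E3_continuous (cst 4^-1).
exact: (cont_add (cont_add (cont_add (cst (z ^+ 3)) (cont_opp c1)) c2) (cont_opp c3)).
Qed.

Lemma prim3_continuous (T : topologicalType) (b : T -> ordered_conf R 3) (c z : T -> C) :
  continuous b -> continuous c -> continuous z ->
  continuous (fun t => (prim3 (b t) (c t)).[z t]).
Proof.
move=> cb cc cz.
have cst (a : C) : continuous (fun _ : T => a) by exact: cont_cst.
have c1 := cont_mul (cst (4 / 3)) (cont_comp cb e1_continuous).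
have c2 := cont_mul (cst 2) (cont_comp cb e2_continuous).
have c3 := cont_mul (cst 4) (cont_comp cb e3_continuous).
have h := cont_add (cont_mul (cont_add (cont_mul (cont_add (cont_mul
  (cont_add cz (cont_opp c1)) cz) c2) cz) (cont_opp c3)) cz) cc.
by under eq_fun do rewrite prim3_horner.
Qed.

Definition crit (b : ordered_conf R 3) (k : 'I_3) : C := (prim3 b 0).[pt b k].

Lemma critE b k : crit b k = Qint b 0 (pt b k).
Proof. by rewrite /crit prim3_shift addr0. Qed.

Lemma crit_inj b : QF R 3 b -> injective (crit b).
Proof.
move=> /QF_P hb i j ij; apply/eqP; apply: contraT => /hb.
by rewrite Qint3E -!/(crit b _) ij subrr eqxx.
Qed.

Lemma crit_continuous k : continuous (fun b => crit b k).
Proof.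
apply: prim3_continuous; [by move=> b; exact: cvg_id|exact: cont_cst|].
exact: pt_continuous.
Qed.

Lemma E4E (x : ordered_conf R 4) : E4 x = conf_poly x 0.
Proof. by rewrite conf_poly4 /E4; ring. Qed.

(* Lift the critical points, contract them in [QF 3] while the (translated)
   critical values are avoided, contract the constant term in the complement of
   the critical values, and finally lift the four roots along the homotopy. *)
Lemma RF4_aspherical : aspherical R (RF R 4).
Proof.
move=> k x f k2 sf; have [cf fA fx] := sf.
have k0 : (0 < k)%N by exact: ltn_trans k2.
have Ax : RF R 4 x by exact: spheroid_base sf.
have f0 : f 0 = x by rewrite fx //; exact: cube_boundary0.
have [b0 [Qb0 b0x]] := iffLR (RF4 x) Ax.
have [|||e [e0 eP ce]] := @conf_lifting _ _ (cube R k) 3 (fun t => deriv4 (f t)) 0 b0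
  (@cube_compact R k) (@cube0 R k) (@cube_star R k).
- by move=> z; exact: (cont_comp cf (@deriv4_continuous z)).
- move=> t ct; have [b [_ <-]] := iffLR (RF4 _) (fA t ct).
  by exists (val b); exact: conf_roots.
- by rewrite f0 b0x.
have eQ t : cube R k t -> QF R 3 (e t).
  move=> ct; have [b [Qb bE]] := iffLR (RF4 _) (fA t ct).
  have eb : conf_proj R (e t) = conf_proj R b by apply: conf_poly_proj; rewrite bE eP.
  by rewrite /QF /= eb.
have ex t : cube_boundary R k t -> e t = b0.
  move=> bt; rewrite -e0; apply: (conf_boundary_cst k2 ce) => // u bu.
  by rewrite -(eP u (cube_boundary_sub bu)) -(eP 0 (@cube0 R k)) fx // f0.
have se : spheroid R (QF R 3) b0 k e by [].
have [HB [cHB HBQ HB0 HB1 HBx]] := QF3_aspherical k2 se.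
have HBQ' p : cylinder p -> QF R 3 (HB p).
  by case: p => s t /cylinderP[s01 ct]; exact: HBQ.
(* [crit] is computed with constant term 0, so a quartic with constant term [c] vanishes at a
   critical point when [- c] is one of these values; hence the sign. *)
pose w t : C := - E4 (f t).
have cw : {within cube R k, continuous w}.
  exact: (cont_opp (cont_comp cf E4_continuous)).
have fz t : cube R k t -> conf_poly (f t) = horner (prim3 (e t) (E4 (f t))).
  by move=> ct; apply/conf_poly_prim3; rewrite eP.
have [|||W [cW W0 Wv Wb]] := @moving_points R 3 k (fun i p => crit (HB p) i) w _ _ cw _.
- by move=> i; exact: (cont_comp cHB (@crit_continuous i)).
- by move=> p cp; apply: crit_inj; exact: HBQ'.
- move=> t i ct; rewrite HB0 // critE.
  apply: (@critical_value_neq R 4 (f t)) => // z.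
  by rewrite fz // prim3_shift opprK.
pose c0 : C := - E4 x.
have Wx s t : 0 <= s <= 1 -> cube_boundary R k t -> W (s, t) = c0.
  move=> s01 bt; rewrite Wb //; first by rewrite /w fx.
    exact: cube_boundary_sub.
  by move=> u i u01; rewrite !HBx // lexx ler01.
have l01 : 0 <= (0 : R) <= 1 by rewrite lexx ler01.
have l11 : 0 <= (1 : R) <= 1 by rewrite lexx ler01.
pose E : set (ordered_conf R 3 * C) := [set q | QF R 3 q.1 /\ forall i, q.2 != crit q.1 i].
have h1 : homotopic_rel R E (b0, c0) (fun t => (e t, w t)) (fun t => (b0, W (1, t))).
  exists (fun p => (HB p, W p)); split.
  - exact: cont_pair.
  - move=> s t s01 ct; have cp : cylinder (s, t) by apply/cylinderP.
    by split=> [|i]; [exact: HBQ|exact: Wv].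
  - by move=> t ct; rewrite HB0 // W0.
  - by move=> t ct; rewrite HB1.
  - by move=> s t s01 bt; rewrite HBx // Wx.
pose F := [seq crit b0 i | i <- enum 'I_3].
have FE z : (z \notin F) <-> forall i, z != crit b0 i.
  split=> [zF i|h]; last by apply/mapP => -[i _ zi]; have := h i; rewrite zi eqxx.
  by apply: contraNneq zF => ->; apply: map_f; rewrite mem_enum.
have sW : spheroid R [set z : C | z \notin F] c0 k (fun t => W (1, t)).
  split.
  - apply: (within_comp (f := fun t => (1 : R, t)) _ _ cW) => [|t ct]; last exact/cylinderP.
    have cp : continuous (fun t : 'rV[R]_k => (1 : R, t)).
      apply: cont_pair; last by move=> t; exact: cvg_id.
      by move=> t; exact: (@cont_cst 'rV[R]_k _ (1 : R)).
    exact: within_cont cp.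
  - move=> t ct /=; apply/FE => i; rewrite -[b0](HB1 t ct).
    by apply: Wv; apply/cylinderP.
  - by move=> t bt; rewrite Wx.
have h2 : homotopic_rel R E (b0, c0) (fun t => (b0, W (1, t))) (fun=> (b0, c0)).
  have cp : continuous (fun z : C => (b0, z)).
    apply: cont_pair; last by move=> z; exact: cvg_id.
    by move=> z; exact: (@cont_cst C _ b0).
  apply: (homotopic_map (A := [set z : C | z \notin F]) (h := fun z => (b0, z))).
  - exact: within_cont cp.
  - by move=> z zF; split=> //; exact/FE.
  - exact: finite_complement_aspherical k2 sW.
have [H [cH HE H0 H1 Hx]] := homotopic_trans h1 h2.
have HE' p : cylinder p -> E (H p) by case: p => s t /cylinderP[s01 ct]; exact: HE.
pose P p := horner (prim3 (H p).1 (- (H p).2)).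
have [||||||Z [Z0 PZ cZ]] := @conf_lifting _ _ (@cylinder R k) 4 P (0, 0) x.
- exact: cylinder_compact.
- exact: cylinder0.
- by move=> p t cp t01; apply: cylinder_convex => //; exact: cylinder0.
- move=> z; apply: (@prim3_continuous (subspace (@cylinder R k))).
  + exact: (cont_comp cH cont_fst).
  + exact: (cont_opp (cont_comp cH cont_snd)).
  + exact: cont_cst.
- move=> p cp; have [Qb cb] := HE' p cp.
  have [pm ps] := prim3_monic (H p).1 (- (H p).2).
  have [|y yP] := conf_of_critical pm ps (prim3_deriv _ _).
    by move=> i; rewrite prim3_shift -critE subr_eq0 eq_sym.
  exists (val y); rewrite (_ : P p = conf_poly y); first exact: conf_roots.
  by apply/funext => z; rewrite yP.
- by rewrite /P H0 /= ?opprK -?fz ?f0 //; exact: cube0.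
have PZ0 t : cube R k t -> conf_poly (Z (0, t)) = conf_poly (f t).
  move=> ct; rewrite -PZ; last exact/cylinderP.
  by rewrite /P H0 //= opprK fz.
have ccyl : continuous (@snd R 'rV[R]_k) by exact: cont_snd.
(* Uniqueness of lifts identifies [Z] with [f] on the bottom face, and further on with the constant
   [x] along vertical segments over the boundary and on the top face. *)
have Z0f t : cube R k t -> Z (0, t) = f t.
  move=> ct; pose X0 : set (R * 'rV[R]_k) := [set 0] `*` cube R k.
  have X0c : X0 `<=` @cylinder R k by move=> [s u] [/= -> cu]; exact/cylinderP.
  apply: (@conf_unique _ _ X0 4 Z (fun p => f p.2) (0, 0) (0, t)) => //.
  - by apply: compact_setX; [exact: compact_set1|exact: cube_compact].
  - move=> u u01; split; first by rewrite /= subrr scaler0 addr0.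
    by apply: cube_convex => //; exact: cube0.
  - exact: within_sub X0c cZ.
  - by apply: (within_comp (within_cont ccyl) _ cf) => -[s u] [].
  - by move=> [s u] [/= -> cu]; exact: PZ0.
  - by rewrite Z0 f0.
have xP p : H p = (b0, c0) -> cylinder p -> conf_poly (Z p) = conf_poly x.
  move=> Hp cp; rewrite -PZ // /P Hp /= opprK.
  by rewrite -f0 fz ?f0 ?e0 //; exact: cube0.
have Zx s t : 0 <= s <= 1 -> cube_boundary R k t -> Z (s, t) = x.
  move=> s01 bt; have ct := cube_boundary_sub bt.
  pose X0 : set (R * 'rV[R]_k) := `[0, 1]%classic `*` [set t].
  have X0c : X0 `<=` @cylinder R k.
    by move=> [u v] [/= u01 ->]; apply/cylinderP; split=> //; rewrite in_itv in u01.
  apply: (@conf_unique _ _ X0 4 Z (fun=> x) (0, t) (s, t)) => //.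
  - by apply: compact_setX; [exact: segment_compact|exact: compact_set1].
  - move=> u /andP[u0 u1]; split; last by rewrite /= subrr scaler0 addr0.
    rewrite /= add0r subr0 in_itv /= /GRing.scale /=; have /andP[s0 s1] := s01.
    by rewrite mulr_ge0 //= mulr_ile1.
  - exact: within_sub X0c cZ.
  - by apply: within_cont; exact: cont_cst.
  - move=> [u v] uv; apply: xP; last exact: X0c.
    by case: uv => /= u01 ->; apply: Hx => //; rewrite in_itv in u01.
  - by rewrite Z0f // fx.
exists Z; split=> //.
- move=> s t s01 ct; have cp : cylinder (s, t) by apply/cylinderP.
  have [Qb _] := HE s t s01 ct; apply/RF4; exists (H (s, t)).1; split=> //.
  apply/conf_poly_prim3; rewrite E4E -PZ // /P; congr (horner (prim3 _ _)).
  by rewrite prim3_shift Qint3E subrr add0r.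
- move=> t ct; pose X0 : set (R * 'rV[R]_k) := [set 1] `*` cube R k.
  have X0c : X0 `<=` @cylinder R k by move=> [s u] [/= -> cu]; exact/cylinderP.
  apply: (@conf_unique _ _ X0 4 Z (fun=> x) (1, 0) (1, t)) => //.
  - by apply: compact_setX; [exact: compact_set1|exact: cube_compact].
  - move=> u u01; split; first by rewrite /= subrr scaler0 addr0.
    by apply: cube_convex => //; exact: cube0.
  - exact: within_sub X0c cZ.
  - by apply: within_cont; exact: cont_cst.
  - move=> [s u] su; apply: xP; last exact: X0c.
    by case: su => /= -> cu; exact: H1.
  - by apply: Zx => //; exact: cube_boundary0.
Qed.

End Quartics.

(** * Connectedness *)

Section Connectedness.
Context {R : realType}.
Local Notation C := R[i].
Local Notation pt := (pt R).
Local Notation "x `0" := (pt x (Ordinal (isT : (0 < _.+1)%N))) (at level 2).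
Local Notation "x `1" := (pt x (Ordinal (isT : (1 < _.+2)%N))) (at level 2).
Local Notation "x `2" := (pt x (Ordinal (isT : (2 < _.+3)%N))) (at level 2).
Local Notation "x `3" := (pt x (Ordinal (isT : (3 < _.+4)%N))) (at level 2).

(* One of the parabolas through 0 and 1 avoids the zeros of [q]. *)
Lemma path_avoiding_roots (q : {poly C}) : q.[0] != 0 -> q.[1] != 0 ->
  exists g : R -> C, [/\ continuous g, g 0 = 0, g 1 = 1 &
    forall s, 0 <= s <= 1 -> q.[g s] != 0].
Proof.
move=> q0 q1; have [rs qE] := closed_field_poly_normal q.
have lq : lead_coef q != 0.
  by rewrite lead_coef_eq0; apply: contraNneq q0 => ->; rewrite horner0.
(* For a root [b] the quotient is the parameter of the parabola through 0, 1 and [b]; [c + 1]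
   exceeds all of these, and the end points are covered by [q0] and [q1]. *)
have [c c0 hc] := seq_bound rs (fun b : C =>
  complex.Im b / (complex.Re b * (1 - complex.Re b))).
exists (fun s => (s +i* ((c + 1) * (s * (1 - s))))%C); split.
- apply: cont_complex; first by move=> s; exact: cvg_id.
  apply: cont_mul; first exact: cont_cst.
  apply: cont_mul; first by move=> s; exact: cvg_id.
  apply: cont_add; first exact: cont_cst.
  by apply: cont_opp => s; exact: cvg_id.
- by rewrite mul0r mulr0.
- by rewrite subrr !mulr0.
move=> s /andP[s0 s1]; set b := Complex _ _.
have [ss|ss] := eqVneq (s * (1 - s)) 0.
  move/eqP: (ss); rewrite mulf_eq0 => /orP[/eqP s_0|/eqP s_1].
    by rewrite /b ss s_0 mulr0.
  by rewrite /b ss mulr0 (_ : s = 1) //; lra.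
rewrite qE hornerZ mulf_neq0 // horner_prod.
apply/negP => /eqP/eqP; rewrite prodf_seq_eq0 => /hasP[a ars /=].
rewrite hornerXsubC subr_eq0 => /eqP ab.
by have := hc a ars; rewrite -ab /= mulfK // gerDl ler10.
Qed.

(* Two points are joined by a path in the complex line through them. *)
Lemma hypersurface_complement_connected n (A : set (ordered_conf R n))
    (G : 'rV[C]_n -> C) :
  (forall r, G r != 0 -> injective (r 0)) ->
  (forall x, A x <-> G (val x) != 0) ->
  (forall r d : 'rV[C]_n, exists q : {poly C}, forall s, q.[s] = G (r + s *: d)) ->
  connected A.
Proof.
move=> Ginj AG Gpoly.
have [->|/set0P[x Ax]] := eqVneq A set0; first exact: connected0.
pose I := [set B : set (ordered_conf R n) | [/\ connected B, B x & B `<=` A]].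
suff -> : A = \bigcup_(B in I) B.
  apply: bigcup_connected; last by move=> B [].
  by exists x => B [].
apply/seteqP; split=> [y Ay|y [B [_ _ BA] /BA]//].
pose d := val y - val x.
have [q qE] := Gpoly (val x) d.
have q0 : q.[0] != 0 by rewrite qE scale0r addr0; apply/AG.
have q1 : q.[1] != 0 by rewrite qE scale1r addrC subrK; apply/AG.
have [g [cg g0 g1 gq]] := path_avoiding_roots q0 q1.
pose r (s : R) := val x + g s *: d.
have rG s : 0 <= s <= 1 -> G (r s) != 0 by move=> s01; rewrite -qE; exact: gq.
have [||f [fE cf]] := @conf_glue R _ `[(0 : R), 1]%classic n r x.
- by move=> s /=; rewrite in_itv /= => s01; apply: Ginj; exact: rG.
- move=> i; apply: within_cont.
  rewrite (_ : (fun s => _) = (fun s => val x 0 i + g s * d 0 i)); last first.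
    by apply/funext => s; rewrite !mxE.
  by apply: cont_add; [exact: cont_cst|apply: cont_mul; [exact: cg|exact: cont_cst]].
have i0 : `[(0 : R), 1]%classic 0 by rewrite /= in_itv /= lexx ler01.
have i1 : `[(0 : R), 1]%classic 1 by rewrite /= in_itv /= lexx ler01.
exists (f @` `[(0 : R), 1]%classic).
  split.
  - by apply: connected_continuous_connected => //; exact: segment_connected.
  - by exists 0 => //; apply: val_inj; rewrite fE // /r g0 scale0r addr0.
  - move=> _ [s s01 <-]; apply/AG; rewrite fE //; apply: rG.
    by move: s01; rewrite /= in_itv.
by exists 1 => //; apply: val_inj; rewrite fE // /r g1 scale1r addrC subrK.
Qed.

Lemma aspherical_hypersurface_complement n (A : set (ordered_conf R n)) (G : 'rV[C]_n -> C) :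
  (forall r, G r != 0 -> injective (r 0)) ->
  (forall x, A x <-> G (val x) != 0) ->
  (forall r d : 'rV[C]_n, exists q : {poly C}, forall s, q.[s] = G (r + s *: d)) ->
  (exists r, G r != 0) -> aspherical R A -> K_pi_1 R A.
Proof.
move=> Ginj AG Gpoly [r Gr]; apply: aspherical_K_pi_1.
  by exists (mk_conf (Ginj _ Gr)); apply/AG.
exact: hypersurface_complement_connected Ginj AG Gpoly.
Qed.

(** The discriminants are written over any commutative ring: evaluated in [C] they cut out the
    hypersurfaces, and evaluated in [{poly C}] on the coordinates of a complex line they give the
    restriction to that line. *)
Definition vdm3 (S : comNzRingType) (a b c : S) : S := (b - a) * (c - a) * (c - b).

Definition vdm4 (S : comNzRingType) (a b c d : S) : S :=
  (b - a) * (c - a) * (d - a) * (c - b) * (d - b) * (d - c).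

Lemma vdm3_inj (r : 'rV[C]_3) :
  vdm3 (r 0 (Ordinal (isT : 0 < 3)%N)) (r 0 (Ordinal (isT : 1 < 3)%N))
    (r 0 (Ordinal (isT : 2 < 3)%N)) != 0 <-> injective (r 0).
Proof.
split.
  rewrite /vdm3 !mulf_eq0 !negb_or !subr_eq0 => /andP[/andP[n01 n02] n12].
  apply: ord3P; apply: ord3P => // /eqP.
  - by rewrite eq_sym (negPf n01).
  - by rewrite eq_sym (negPf n02).
  - by rewrite (negPf n01).
  - by rewrite eq_sym (negPf n12).
  - by rewrite (negPf n02).
  - by rewrite (negPf n12).
by move=> rinj; rewrite /vdm3 !mulf_neq0 // subr_eq0 (inj_eq rinj).
Qed.

Lemma vdm4_inj (r : 'rV[C]_4) :
  vdm4 (r 0 (Ordinal (isT : 0 < 4)%N)) (r 0 (Ordinal (isT : 1 < 4)%N))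
    (r 0 (Ordinal (isT : 2 < 4)%N)) (r 0 (Ordinal (isT : 3 < 4)%N)) != 0 <->
  injective (r 0).
Proof.
split.
  rewrite /vdm4 !mulf_eq0 !negb_or !subr_eq0.
  move=> /andP[/andP[/andP[/andP[/andP[n01 n02] n03] n12] n13] n23].
  apply: ord4P; apply: ord4P => // /eqP; rewrite ?(negPf n01) ?(negPf n02)
    ?(negPf n03) ?(negPf n12) ?(negPf n13) ?(negPf n23) // eq_sym
    ?(negPf n01) ?(negPf n02) ?(negPf n03) ?(negPf n12) ?(negPf n13) ?(negPf n23) //.
by move=> rinj; rewrite /vdm4 !mulf_neq0 // subr_eq0 (inj_eq rinj).
Qed.

Definition lineP n (r d : 'rV[C]_n) (i : 'I_n) : {poly C} :=
  (r 0 i)%:P + 'X * (d 0 i)%:P.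

Lemma horner_lineP n (r d : 'rV[C]_n) i s : (lineP r d i).[s] = (r + s *: d) 0 i.
Proof. by rewrite /lineP hornerD hornerC hornerM hornerX hornerC !mxE. Qed.

Definition RF3_disc (S : comNzRingType) (a b c : S) : S :=
  vdm3 a b c * (a ^+ 2 + b ^+ 2 + c ^+ 2 - a * b - a * c - b * c).

Definition QF3_disc (S : comNzRingType) (a b c : S) : S :=
  vdm3 a b c * ((a + b - 2 * c) * (a + c - 2 * b) * (b + c - 2 * a)).

Definition sym1 (S : comNzRingType) (a b c d : S) : S := a + b + c + d.
Definition sym2 (S : comNzRingType) (a b c d : S) : S :=
  a * b + a * c + a * d + b * c + b * d + c * d.
Definition sym3 (S : comNzRingType) (a b c d : S) : S :=
  a * b * c + a * b * d + a * c * d + b * c * d.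

(* In terms of the elementary symmetric functions of the roots of a quartic, and
   up to constants: the discriminant of its derivative, and the value of its
   derivative at the mean of the roots. *)
Definition derivative_disc (S : comNzRingType) (u v w : S) : S :=
  9 * u ^+ 2 * v ^+ 2 - 32 * v ^+ 3 - 27 * u ^+ 3 * w + 108 * u * v * w - 108 * w ^+ 2.
Definition derivative_mean (S : comNzRingType) (u v w : S) : S := - u ^+ 3 + 4 * u * v - 8 * w.

Definition RF4_disc (S : comNzRingType) (a b c d : S) : S :=
  vdm4 a b c d * (derivative_disc (sym1 a b c d) (sym2 a b c d) (sym3 a b c d) *
                  derivative_mean (sym1 a b c d) (sym2 a b c d) (sym3 a b c d)).

Section Morphisms.
Variables (S S' : comNzRingType) (f : {rmorphism S -> S'}).

Lemma rmorph_RF3_disc a b c : f (RF3_disc a b c) = RF3_disc (f a) (f b) (f c).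
Proof. by rewrite /RF3_disc /vdm3 !(rmorphM, rmorphB, rmorphD, rmorphXn). Qed.

Lemma rmorph_QF3_disc a b c : f (QF3_disc a b c) = QF3_disc (f a) (f b) (f c).
Proof.
by rewrite /QF3_disc /vdm3 !(rmorph_nat, rmorphM, rmorphB, rmorphD, rmorphXn).
Qed.

Let rmorph_vdm4 a b c d : f (vdm4 a b c d) = vdm4 (f a) (f b) (f c) (f d).
Proof. by rewrite /vdm4 !(rmorphM, rmorphB). Qed.

Let rmorph_sym1 a b c d : f (sym1 a b c d) = sym1 (f a) (f b) (f c) (f d).
Proof. by rewrite /sym1 !rmorphD. Qed.

Let rmorph_sym2 a b c d : f (sym2 a b c d) = sym2 (f a) (f b) (f c) (f d).
Proof. by rewrite /sym2 !(rmorphM, rmorphD). Qed.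

Let rmorph_sym3 a b c d : f (sym3 a b c d) = sym3 (f a) (f b) (f c) (f d).
Proof. by rewrite /sym3 !(rmorphM, rmorphD). Qed.

Let rmorph_derivative_disc u v w : f (derivative_disc u v w) = derivative_disc (f u) (f v) (f w).
Proof.
by rewrite /derivative_disc !(rmorph_nat, rmorphXn, rmorphM, rmorphB, rmorphD).
Qed.

Let rmorph_derivative_mean u v w : f (derivative_mean u v w) = derivative_mean (f u) (f v) (f w).
Proof.
by rewrite /derivative_mean !(rmorph_nat, rmorphXn, rmorphM, rmorphB, rmorphD, rmorphN).
Qed.

Lemma rmorph_RF4_disc a b c d :
  f (RF4_disc a b c d) = RF4_disc (f a) (f b) (f c) (f d).
Proof.
rewrite /RF4_disc rmorphM rmorph_vdm4 rmorphM rmorph_derivative_disc rmorph_derivative_mean.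
by rewrite rmorph_sym1 rmorph_sym2 rmorph_sym3.
Qed.

End Morphisms.

Local Notation row3 r G := (G (r 0 (Ordinal (isT : 0 < 3)%N))
  (r 0 (Ordinal (isT : 1 < 3)%N)) (r 0 (Ordinal (isT : 2 < 3)%N))).

Lemma RF3_K_pi_1 : K_pi_1 R (RF R 3).
Proof.
apply: (@aspherical_hypersurface_complement 3 _ (fun r => row3 r (@RF3_disc C))).
- by move=> r; rewrite mulf_eq0 negb_or => /andP[/vdm3_inj].
- move=> x; rewrite RF3 mulf_eq0 negb_or; split=> [h|/andP[]//].
  by apply/andP; split=> //; apply/vdm3_inj; exact: pt_inj.
- move=> r d; exists (RF3_disc (lineP r d (Ordinal (isT : 0 < 3)%N))
    (lineP r d (Ordinal (isT : 1 < 3)%N)) (lineP r d (Ordinal (isT : 2 < 3)%N))) => s.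
  by rewrite -!horner_lineP; exact: (rmorph_RF3_disc (horner_eval s)).
- exists (\row_i i%:R); rewrite !mxE /=.
  rewrite (_ : RF3_disc _ _ _ = 6); last by rewrite /RF3_disc /vdm3; ring.
  by rewrite pnatr_eq0.
- exact: RF3_aspherical.
Qed.

Lemma QF3_K_pi_1 : K_pi_1 R (QF R 3).
Proof.
apply: (@aspherical_hypersurface_complement 3 _ (fun r => row3 r (@QF3_disc C))).
- by move=> r; rewrite mulf_eq0 negb_or => /andP[/vdm3_inj].
- move=> x; rewrite QF3 mulf_eq0 negb_or; split=> [[h2 h1 h0]|/andP[_]].
    apply/andP; split; first by apply/vdm3_inj; exact: pt_inj.
    by rewrite !mulf_neq0.
  by rewrite !mulf_eq0 !negb_or => /andP[/andP[? ?] ?].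
- move=> r d; exists (QF3_disc (lineP r d (Ordinal (isT : 0 < 3)%N))
    (lineP r d (Ordinal (isT : 1 < 3)%N)) (lineP r d (Ordinal (isT : 2 < 3)%N))) => s.
  by rewrite -!horner_lineP; exact: (rmorph_QF3_disc (horner_eval s)).
(* In an equally spaced triple such as 0, 1, 2 one point is the midpoint of the others, so 0, 1, 3
   is taken. *)
- exists (\row_i nth 0 [:: 0; 1; 3] i); rewrite !mxE /=.
  rewrite (_ : QF3_disc _ _ _ = - 120); last by rewrite /QF3_disc /vdm3; ring.
  by rewrite oppr_eq0 pnatr_eq0.
- exact: QF3_aspherical.
Qed.

Lemma cubic_coefs (a b c u v w : C) :
  (forall z, (z - a) * (z - b) * (z - c) = z ^+ 3 - u * z ^+ 2 + v * z - w) ->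
  [/\ u = a + b + c, v = a * b + a * c + b * c & w = a * b * c].
Proof.
move=> h; pose s := [:: w - a * b * c; a * b + a * c + b * c - v; u - (a + b + c)].
have s0 z : horner_rec s z = 0.
  have /eqP := h z; rewrite -subr_eq0 => /eqP hz.
  by rewrite -[RHS]hz /=; ring.
split; first by apply/eqP; rewrite -subr_eq0; apply/eqP; exact: (coef_eq0 s0 2).
  by apply/esym/eqP; rewrite -subr_eq0; apply/eqP; exact: (coef_eq0 s0 1).
by apply/eqP; rewrite -subr_eq0; apply/eqP; exact: (coef_eq0 s0 0).
Qed.

(** A critical point is the midpoint of the two others exactly when it is the mean of all three, and
    that mean is also the mean of the four roots. Hence the product of the three linear conditions
    of [QF3] is, up to a constant, the derivative at the mean of the roots, a polynomial in [E1 x],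
    [E2 x] and [E3 x]. *)
Lemma deriv4_roots (x : ordered_conf R 4) (a b c : C) :
  (forall z, deriv4 x z = (z - a) * (z - b) * (z - c)) ->
  derivative_disc (E1 x) (E2 x) (E3 x) = 64 * (vdm3 a b c) ^+ 2 /\
  derivative_mean (E1 x) (E2 x) (E3 x) =
    32 / 27 * ((a + b - 2 * c) * (a + c - 2 * b) * (b + c - 2 * a)).
Proof.
move=> h; have [h1 h2 h3] := cubic_coefs (fun z => esym (h z)).
have {}h1 : E1 x = 4 / 3 * (a + b + c) by rewrite -h1; field.
have {}h2 : E2 x = 2 * (a * b + a * c + b * c) by rewrite -h2; field.
have {}h3 : E3 x = 4 * (a * b * c) by rewrite -h3; field.
rewrite /derivative_disc /derivative_mean h1 h2 h3 /vdm3.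
by split; field.
Qed.

(** Eliminates the auxiliary [b], as a hypersurface equation in the roots of the quartic requires.
    Conversely [b] is recovered as the roots of [deriv4 x], distinct because the discriminant is
    nonzero. *)
Lemma RF4_discP (x : ordered_conf R 4) :
  RF R 4 x <-> derivative_disc (E1 x) (E2 x) (E3 x) != 0 /\ derivative_mean (E1 x) (E2 x) (E3 x) != 0.
Proof.
have n64 : (64 : C) != 0 by rewrite pnatr_eq0.
have n32 : (32 / 27 : C) != 0 by rewrite mulf_neq0 ?invr_eq0 ?pnatr_eq0.
rewrite RF4; split=> [[b [/QF3[q2 q1 q0] bx]]|[D0 M0]].
  have [|-> ->] := @deriv4_roots x b`0 b`1 b`2.
    by move=> z; rewrite -bx conf_poly3.
  split; last by rewrite !mulf_neq0.
  by rewrite mulf_neq0 // expf_neq0 //; apply/(vdm3_inj (val b)); exact: pt_inj.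
pose p : {poly C} := (('X - (3 / 4 * E1 x)%:P) * 'X + (E2 x / 2)%:P) * 'X + (- (E3 x / 4))%:P.
have [p1 s1] := monic_MXaddC (E2 x / 2) (monicXsubC (3 / 4 * E1 x)).
have [p2 s2] := monic_MXaddC (- (E3 x / 4)) p1.
have [|r pr] := closed_roots (n := 3) p2; first by rewrite s2 s1 size_XsubC.
have hx z : deriv4 x z = \prod_(i < 3) (z - r 0 i).
  rewrite -horner_prod_XsubC -pr /deriv4.
  by rewrite !(hornerD, hornerMX, hornerN, hornerC, hornerX); ring.
have h3 z : deriv4 x z = (z - r 0 (Ordinal (isT : 0 < 3)%N)) *
    (z - r 0 (Ordinal (isT : 1 < 3)%N)) * (z - r 0 (Ordinal (isT : 2 < 3)%N)).
  rewrite hx !big_ord_recl big_ord0 mulr1 !mulrA.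
  by congr (_ * _ * _); congr (_ - r _ _); exact: val_inj.
have [dE mE] := deriv4_roots h3.
have rinj : injective (r 0).
  apply/vdm3_inj; apply: contraNneq D0 => v0.
  by rewrite dE v0 expr0n mulr0.
exists (mk_conf rinj); split; last by apply/funext => z; rewrite hx.
move: M0; rewrite mE mulf_eq0 (negPf n32) /= !mulf_eq0 !negb_or => /andP[/andP[? ?] ?].
by apply/QF3.
Qed.

Lemma RF4_K_pi_1 : K_pi_1 R (RF R 4).
Proof.
apply: (@aspherical_hypersurface_complement 4 _ (fun r : 'rV[C]_4 =>
  RF4_disc (r 0 (Ordinal (isT : 0 < 4)%N)) (r 0 (Ordinal (isT : 1 < 4)%N))
    (r 0 (Ordinal (isT : 2 < 4)%N)) (r 0 (Ordinal (isT : 3 < 4)%N)))).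
- by move=> r; rewrite /RF4_disc mulf_eq0 negb_or => /andP[/vdm4_inj].
- move=> x; rewrite RF4_discP.
  have v0 : vdm4 x`0 x`1 x`2 x`3 != 0 by apply/vdm4_inj; exact: pt_inj.
  have DM (u v w : C) : w != 0 -> u != 0 /\ v != 0 <-> w * (u * v) != 0.
    by move=> w0; rewrite !mulf_eq0 (negPf w0) /= negb_or; split=> [[u0 ?]|/andP[]//]; rewrite u0.
  exact: DM v0.
- move=> r d; exists (RF4_disc (lineP r d (Ordinal (isT : 0 < 4)%N))
    (lineP r d (Ordinal (isT : 1 < 4)%N)) (lineP r d (Ordinal (isT : 2 < 4)%N))
    (lineP r d (Ordinal (isT : 3 < 4)%N))) => s.
  by rewrite -!horner_lineP; exact: (rmorph_RF4_disc (horner_eval s)).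
(* The roots 0, 1, 2, 3 are symmetric about their mean, which would then be a critical point; moving
   the last one breaks the symmetry. *)
- exists (\row_i nth 0 [:: 0; 1; 2; 4] i); rewrite !mxE /=.
  rewrite /RF4_disc (_ : vdm4 _ _ _ _ = 48); last by rewrite /vdm4; ring.
  rewrite (_ : sym1 _ _ _ _ = 7); last by rewrite /sym1; ring.
  rewrite (_ : sym2 _ _ _ _ = 14); last by rewrite /sym2; ring.
  rewrite (_ : sym3 _ _ _ _ = 8); last by rewrite /sym3; ring.
  rewrite (_ : derivative_disc _ _ _ = 2300); last by rewrite /derivative_disc; ring.
  rewrite (_ : derivative_mean _ _ _ = - 15); last by rewrite /derivative_mean; ring.
  by rewrite !mulf_neq0 ?oppr_eq0 ?pnatr_eq0.
- exact: RF4_aspherical.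
Qed.

End Connectedness.

Theorem corollary4p4 (R : realType) :
  K_pi_1 R (RF R 3) /\ K_pi_1 R (RC R 3) /\
  K_pi_1 R (QF R 3) /\ K_pi_1 R (QC R 3) /\
  K_pi_1 R (RF R 4) /\ K_pi_1 R (RC R 4).
Proof.
have h3 := @RF3_K_pi_1 R; have q3 := @QF3_K_pi_1 R; have h4 := @RF4_K_pi_1 R.
split=> //; split; first exact: quotient_K_pi_1 h3 (@RF3_aspherical R).
split=> //; split; first exact: quotient_K_pi_1 q3 (@QF3_aspherical R).
by split=> //; exact: quotient_K_pi_1 h4 (@RF4_aspherical R).
Qed.
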